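(* Let $H$ be a real Hilbert space, and let $A$ be a nonnegative self-adjoint (unbounded) linear operator on $H$ with dense domain $D(A)$. Let $\gamma\geq 1$, and let $$0\leq p\leq\frac{\gamma^{2}+1}{\gamma^{2}+2\gamma-1}.$$ Let $(u_{0},u_{1})\in D(A)\times D(A^{1/2})$ satisfy $A^{1/2}u_{0}\neq 0$. Then there exists $\varepsilon_{0}>0$ such that for every $\varepsilon\in(0,\varepsilon_{0})$ the Cauchy problem $$\varepsilon u_{\varepsilon}''(t)+\frac{1}{(1+t)^{p}}u_{\varepsilon}'(t)+|A^{1/2}u_{\varepsilon}(t)|^{2\gamma}Au_{\varepsilon}(t)=0\quad\forall t\geq 0,\qquad u_{\varepsilon}(0)=u_{0},\quad u_{\varepsilon}'(0)=u_{1},$$ has a unique global solution $$u_{\varepsilon}\in C^{2}([0,+\infty);H)\cap C^{1}([0,+\infty);D(A^{1/2}))\cap C^{0}([0,+\infty);D(A)).$$ Moreover there exist positive constants $C_{1}$ and $C_{2}$, independent of $\varepsilon\in(0,\varepsilon_0)$, such that for every $\varepsilon\in(0,\varepsilon_0)$ and every $t\geq 0$ $$\frac{C_{1}}{(1+t)^{(p+1)/\gamma}}\leq|A^{1/2}u_{\varepsilon}(t)|^{2}\leq\frac{C_{2}}{(1+t)^{(p+1)/(\gamma+1)}},$$ $$|Au_{\varepsilon}(t)|^{2}\leq\frac{C_{2}}{(1+t)^{(p+1)/\gamma}},$$ $$|u_{\varepsilon}'(t)|^{2}\leq\frac{C_{2}}{(1+t)^{[2\gamma^{2}+(1-p)\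gamma+p+1]/(\gamma^{2}+\gamma)}}.$$
   Context: $|x|$ and $\langle x,y\rangle$ denote the norm and scalar product of the real Hilbert space $H$. Nonnegative means $\langle Ax,x\rangle\geq 0$ for every $x\in D(A)$; for $\alpha\geq 0$ the power $A^{\alpha}$ with domain $D(A^{\alpha})$ is defined by the spectral theory of self-adjoint operators. $D(A)$ and $D(A^{1/2})$ are endowed with their graph norms. Uniqueness is meant in the stated regularity class. No coerciveness of $A$ is assumed. *)

(* Defs.v *)
From HB Require Import structures.
From mathcomp Require Import all_boot all_order all_algebra.
From mathcomp Require Import all_classical all_reals all_analysis.

Set Implicit Arguments.
Unset Strict Implicit.
Unset Printing Implicit Defensive.

Import Order.TTheory GRing.Theory Num.Theory.
Import numFieldNormedType.Exports.

Local Open Scope classical_set_scope.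
Local Open Scope ring_scope.

(* An unbounded operator: the values of [opfun] outside [opdom] are junk. *)
Record operator (H : Type) := Operator {
  opdom : set H;
  opfun :> H -> H
}.

HB.instance Definition _ (H : Type) := gen_eqMixin (operator H).
HB.instance Definition _ (H : Type) := gen_choiceMixin (operator H).

Section Operators.
Context {R : realType} {H : completeNormedModType R}.
Variable dot : {dot H for (idfun : R -> R)}.
Implicit Types (A B : operator H) (E : set R -> H -> H).

Definition hilbert_product := forall x : H, dot x x = `|x| ^+ 2.

Definition linear_operator A :=
  opdom A 0 /\
  forall (a : R) x y, opdom A x -> opdom A y ->
    opdom A (a *: x + y) /\ A (a *: x + y) = a *: A x + A y.

Definition densely_defined A := closure (opdom A) = setT.

(* [y] is in the domain of the adjoint of [A], which maps it to [z]. *)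
Definition adjoint_graph A (y z : H) :=
  forall x, opdom A x -> dot (A x) y = dot x z.

Definition selfadjoint A :=
  forall y z, adjoint_graph A y z <-> (opdom A y /\ A y = z).

Definition nonnegative A := forall x, opdom A x -> 0 <= dot (A x) x.

Definition orthogonal_projection (P : H -> H) :=
  [/\ linear P, (forall x, P (P x) = P x) &
      (forall x y, dot (P x) y = dot x (P y))].

Definition spectral_mass E (x : H) (S : set R) : \bar R := (dot (E S x) x)%:E.

Definition projection_valued_measure E :=
  [/\ (forall S, measurable S -> orthogonal_projection (E S)),
      (forall x, E setT x = x),
      (forall S T, measurable S -> measurable T ->
         forall x, E (S `&` T) x = E S (E T x)) &
      (forall x, semi_sigma_additive (spectral_mass E x))].

(* [B] is the operator \int f dE, with domain the vectors [x] such that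
   \int f^2 d<E x, x> is finite; its values are given by
   <B x, y> = \int f d<E x, y>, where the signed measure <E x, y> is written as
   (<E (x + y), x + y> - <E (x - y), x - y>) / 4 by polarization. Testing
   against the [y] in the domain of [B] makes both integrals finite, and it
   determines [B x] because this domain is dense. *)
Definition spectral_integral E (f : R -> R) B :=
  opdom B =
    [set x | (\int[spectral_mass E x]_l ((f l) ^+ 2)%:E < +oo)%E] /\
  forall x y, opdom B x -> opdom B y ->
    dot (B x) y =
      (fine (\int[spectral_mass E (x + y)%R]_l (f l)%:E) -
       fine (\int[spectral_mass E (x - y)%R]_l (f l)%:E)) / 4.

(* The spectral measure of a nonnegative operator is null on the negative
   half-line, so the value of [powR] there is irrelevant. *)
Definition is_power A (alpha : R) B :=
  exists E, [/\ projection_valued_measure E,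
                spectral_integral E id A &
                spectral_integral E (fun l => l `^ alpha) B].

(* By the spectral theorem the default value, an operator that is defined
   nowhere, is not used when [A] is self-adjoint and nonnegative. *)
Definition power A (alpha : R) : operator H :=
  xget (Operator set0 id) [set B | is_power A alpha B].

Definition graph_norm B (x : H) : R := `|x| + `|B x|.

End Operators.

(* Functions on [0, +oo[ with values in [H] are total functions on [R] whose
   values at negative times are ignored; derivatives are one-sided at 0. *)
Section HalfLine.
Context {R : realType} {H : completeNormedModType R}.
Implicit Types (u : R -> H) (D : set H) (N : H -> R).

Definition diff_quotient u (t s : R) : H := (s - t)^-1 *: (u s - u t).

Definition hderiv u (t : R) : H :=
  lim (diff_quotient u t s @[s --> within `[0, +oo[ t^']).

(* Regularity with values in the subspace [D] of [H] with norm [N]. *)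
Definition C0_into D N u :=
  forall t, 0 <= t ->
    D (u t) /\ N (u s - u t) @[s --> within `[0, +oo[ (nbhs t)] --> 0.

Definition C1_into D N u :=
  (forall t, 0 <= t ->
     [/\ D (u t), D (hderiv u t) &
         N (diff_quotient u t s - hderiv u t)
           @[s --> within `[0, +oo[ t^'] --> 0]) /\
  C0_into D N (hderiv u).

Definition C2_into D N u := C1_into D N u /\ C1_into D N (hderiv u).

End HalfLine.

Section CauchyProblem.
Context {R : realType} {H : completeNormedModType R}.
Variable dot : {dot H for (idfun : R -> R)}.

Definition global_solution (A : operator H) (p gamma eps : R) (u0 u1 : H)
    (u : R -> H) :=
  let rA := power dot A (1 / 2) in
  [/\ [/\ C2_into setT (fun x => `|x|) u,
          C1_into (opdom rA) (graph_norm rA) u &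
          C0_into (opdom A) (graph_norm A) u],
      (forall t, 0 <= t ->
         eps *: hderiv (hderiv u) t + (1 / (1 + t) `^ p) *: hderiv u t
         + `|rA (u t)| `^ (2 * gamma) *: A (u t) = 0),
      u 0 = u0 &
      hderiv u 0 = u1].

End CauchyProblem.

(* Main.v *)
From HB Require Import structures.
Require Import Defs.
From mathcomp Require Import all_boot all_order all_algebra.
From mathcomp Require Import all_classical all_reals all_analysis.
From mathcomp Require Import measurable_realfun ring lra.
Import Order.TTheory GRing.Theory Num.Theory.
Import numFieldNormedType.Exports.
Local Open Scope classical_set_scope.
Local Open Scope ring_scope.
Set Implicit Arguments.
Unset Strict Implicit.
Unset Printing Implicit Defensive.

(** For small [eps] the equation behaves like its parabolic limit
[(1 + t)^(- p) u' + |A^(1/2) u|^(2 gamma) A u = 0], whose solutions never reach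
[A^(1/2) u = 0] and decay like powers of [1 + t]. The proof has to transfer this
to the hyperbolic equation with constants that do not depend on [eps], and it
gets existence and uniqueness from the fact that the coefficient
[c = |A^(1/2) u|^(2 gamma)] stays positive on bounded intervals.

A priori estimates. Put [b = (1 + t)^(- p)], [X = |A^(1/2) u|^2],
[Y = <A u, u'>], [Z = |A^(1/2) u'|^2] and [Q = |A u|^2]; together with [|u|^2],
[<u, u'>] and [|u'|^2] they solve a closed system of differential equations
([energy_system]). As long as [X] varies slowly, in the sense that [eps |Y|] is
small compared with [b X], the following holds. The quotient
[eps (X Z - Y^2) / (c X^2) + Q / X] is nonincreasing
([dirichlet_quotient_bound]). It is the source of a relaxation equation for
[Y / X], so that [Y / X] is of the order of [c / b] ([log_derivative_bound]); this
gives the lower bound of [X] ([X_lower_bound]) and shows that the energy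
[F = eps Z / c + Q] is at most a multiple of [X] ([energy_le_X]). After adding a
small cross term, [F] satisfies a differential inequality of the form
[F' <= - k (1 + t)^p F^(gamma + 1)] ([hyperbolic_decay]), which yields the decay
of [|A u|^2]. The velocity follows as [|u'|] is at most of the order of
[c |A u| / b] ([velocity_bound]), the norm of [u] stays bounded ([norm_bound]),
and the same inequality one order below gives the decay of [X] ([X_decay]).
Returning to [Y / X], these bounds improve the slowness of [X] by a factor [eps]
([slow_improved]). The bounds do not depend on the constant of the bootstrap
hypothesis, so the continuity method closes for small [eps]
([uniform_energy_estimates]). The condition on [p] says precisely that the decay
of [X] and [F] compensates the weakness of the damping ([X_power_le]).

Existence. The square root of [A] that is used in the hypotheses comes with a
projection-valued measure [E] for [A]. The projections [P n] on the part of the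
spectrum below [n^2] have all the properties listed in [truncation]. On the range
of [P n] the operator is bounded; with the coefficient cut off at a high level the
equation becomes an ordinary differential equation with a globally Lipschitz field,
which the Picard iteration solves ([second_order_picard]). The a priori estimates
apply and show that the cut-off is not seen ([approximants_exist]). The difference
of two approximations satisfies a linear equation up to an error that is
controlled by the energy [eps |w'|^2 + c |A^(1/2) w|^2] ([wave_difference]), so
the approximations converge. The energy of the next order, for their high
frequencies, is small uniformly in [n] ([approx_tails]); hence also [A u] and
[A^(1/2) u'] converge locally uniformly, and the limit has the required regularity
([approx_limit]).

Uniqueness is the estimate of [wave_difference] once more ([wave_unique]), and the
decay estimates pass to the limit. *)

(** * Barriers and continuity arguments *)

Section RealCalculus.
Context {R : realType}.
Implicit Types (f g : R -> R) (t s T L : R).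

Lemma continuous_lt_near f t L : {for t, continuous f} -> f t < L ->
  exists2 d, 0 < d & forall s, `|s - t| < d -> f s < L.
Proof.
move=> fc ftL.
have Lf : 0 < L - f t by rewrite subr_gt0.
move/cvgrPdist_lt: fc => /(_ _ Lf)/nbhs_ballP[d /= d0 H].
exists d => // s st; have /= := H s; rewrite /ball /= distrC => /(_ st).
by rewrite distrC => /(le_lt_trans (ler_norm _)); rewrite ltrBlDr subrK.
Qed.

Lemma is_derive_continuous f t df : is_derive t 1 f df ->
  {for t, continuous f}.
Proof.
by move=> [fd _]; apply: differentiable_continuous; exact/derivable1_diffP.
Qed.

Lemma derive_le0_nonincreasing f (df : R -> R) (a b : R) : a <= b ->
  (forall t, a <= t <= b -> is_derive t 1 f (df t)) ->
  (forall t, a <= t <= b -> df t <= 0) -> f b <= f a.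
Proof.
move=> ab fd df0.
have [t tab] : exists2 c, c \in `[a, b]%R & f b - f a = df c * (b - a).
  apply: MVT_segment => //.
    by move=> t; rewrite in_itv/= => /andP[/ltW at_ /ltW tb]; apply/fd/andP.
  apply: continuous_in_subspaceT => t; rewrite inE/= in_itv/= => tab.
  exact: is_derive_continuous (fd _ tab).
rewrite in_itv/= in tab => E.
by rewrite -subr_le0 E mulr_le0_ge0 ?df0// subr_ge0.
Qed.

(** Above the level [L] the derivative is nonpositive, so [f] cannot climb past
[L] after the last time at which it is at most [L]. *)
Lemma barrier f (df : R -> R) T L :
  (forall t : R, 0 <= t <= T -> is_derive t 1 f (df t)) -> f 0 <= L ->
  (forall t : R, 0 <= t <= T -> L <= f t -> df t <= 0) ->
  forall t : R, 0 <= t <= T -> f t <= L.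
Proof.
move=> fd f0L H t1 /andP[t10 t1T]; rewrite leNgt; apply/negP => ft1.
pose S := [set r | 0 <= r <= t1 /\ f r <= L].
have S0 : S 0 by split=> //; rewrite lexx.
have supS : has_sup S by split; [exists 0|exists t1 => r [/andP[]]].
have s0 : 0 <= sup S by exact: (ub_le_sup supS.2).
have st1 : sup S <= t1 by apply: ge_sup; [exists 0|move=> r [/andP[]]].
set s := sup S in s0 st1.
have fdt t : 0 <= t <= t1 -> is_derive t 1 f (df t).
  by move=> /andP[? tt1]; apply: fd; apply/andP; split=> //; exact: le_trans tt1 t1T.
have fsL : f s <= L.
  rewrite leNgt; apply/negP => fs.
  have nfs : - f s < - L by rewrite ltrN2.
  have sI : 0 <= s <= t1 by rewrite s0.
  have [d d0 Hd] := continuous_lt_near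
    (@continuousN _ _ _ f s (is_derive_continuous (fdt _ sI))) nfs.
  have [r Sr sr] := sup_adherent d0 supS.
  have rs : r <= s by exact: ub_le_sup supS.2 _ Sr.
  have /Hd : `|r - s| < d by rewrite distrC ger0_norm ?subr_ge0// ltrBlDl -ltrBlDr.
  by rewrite ltrN2 ltNge Sr.2.
have : f t1 <= f s.
  apply: (@derive_le0_nonincreasing f df) => // t /andP[st tt1].
    by apply: fdt; rewrite tt1 (le_trans s0 st).
  have tt0 : 0 <= t <= T by rewrite (le_trans s0 st) (le_trans tt1 t1T).
  have [->|ts] := eqVneq t s.
    have [E|E] := eqVneq s t1; first by move: ft1; rewrite -E ltNge fsL.
    have st1' : s < t1 by rewrite lt_neqAle E.
    have [fsl|fsl] := ltP (f s) L; last by apply: H => //; rewrite s0 (le_trans st1 t1T).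
    have sI : 0 <= s <= t1 by rewrite s0.
    have fcs := is_derive_continuous (fdt _ sI).
    have [d d0 Hd] := continuous_lt_near fcs fsl.
    have m0 : 0 < Num.min d (t1 - s) by rewrite lt_min d0 subr_gt0.
    pose r := s + Num.min d (t1 - s) / 2.
    have rs : s < r by rewrite /r ltrDl divr_gt0.
    have : f r < L.
      apply: Hd; rewrite /r addrAC subrr add0r ger0_norm ?divr_ge0 ?ltW//.
      rewrite ltr_pdivrMr//; have : Num.min d (t1 - s) <= d by rewrite ge_min lexx.
      by move: d0 m0; lra.
    move=> /ltW frL; have /(ub_le_sup supS.2) : S r.
      split=> //; rewrite (le_trans s0 (ltW rs))/= /r.
      have : Num.min d (t1 - s) <= t1 - s by rewrite ge_min lexx orbT.
      by move: m0; lra.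
    by rewrite -/s leNgt rs.
  apply: H => //; rewrite leNgt; apply/negP => /ltW ftL.
  have /(ub_le_sup supS.2) : S t by split=> //; rewrite tt1 (le_trans s0 st).
  by rewrite -/s => ts'; move: ts; rewrite eq_le ts' st.
by move=> /le_trans/(_ fsL); rewrite leNgt ft1.
Qed.

(** Induction along the half-line: the infimum of the times at which [P] fails
would contradict the step. *)
Lemma real_induction (P : R -> Prop) :
  (forall T, 0 <= T -> (forall t : R, 0 <= t < T -> P t) ->
     exists2 d, 0 < d & forall t, T <= t < T + d -> P t) ->
  forall t : R, 0 <= t -> P t.
Proof.
move=> step t0 t00; apply: contrapT => nP.
pose S := [set t | 0 <= t /\ ~ P t].
have lS : has_inf S by split; [exists t0|exists 0 => r []].
have i0 : 0 <= inf S by apply: lb_le_inf; [exists t0|move=> r []].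
have [t /andP[t_0 tI]|d d0 Pd] := step _ i0.
  apply: contrapT => nPt; have /(ge_inf lS.2) : S t by [].
  by rewrite leNgt tI.
have [r Sr rd] := inf_adherent d0 lS.
by apply: Sr.2; apply: Pd; rewrite rd (ge_inf lS.2 Sr).
Qed.

(** The bootstrap principle. A continuous [f] that starts nonpositive can only
become positive after reaching zero, and the improvement from [f <= 0] to
[f < 0] excludes this. *)
Lemma continuity_method f :
  (forall t : R, 0 <= t -> {for t, continuous f}) -> f 0 <= 0 ->
  (forall T, 0 <= T -> (forall t : R, 0 <= t <= T -> f t <= 0) -> f T < 0) ->
  forall t : R, 0 <= t -> f t < 0.
Proof.
move=> fc f0 step; apply: real_induction => T T0 PT.
have fT : f T < 0.
  apply: step => // t /andP[t0]; rewrite le_eqVlt => /orP[/eqP->|tT]; last first.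
    by apply/ltW/PT; rewrite t0.
  move: T0; rewrite le_eqVlt => /orP[/eqP<-//|T0].
  rewrite leNgt; apply/negP => fT.
  have := @continuousN _ _ _ f T (fc T (ltW T0)).
  have nfT : - f T < 0 by rewrite oppr_lt0.
  move=> /continuous_lt_near/(_ nfT)[d d0 Hd].
  have m0 : 0 < Num.min d T by rewrite lt_min d0 T0.
  have mT : Num.min d T <= T by rewrite ge_min lexx orbT.
  have md : Num.min d T <= d by rewrite ge_min lexx.
  have /Hd : `|T - Num.min d T / 2 - T| < d.
    by rewrite addrAC subrr add0r normrN ger0_norm; lra.
  rewrite oppr_lt0 ltNge ltW// PT//.
  by apply/andP; split; lra.
have [d d0 Hd] := continuous_lt_near (fc T T0) fT.
exists d => // t /andP[Tt tT]; apply: Hd.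
by rewrite ger0_norm ?subr_ge0// ltrBlDl.
Qed.

End RealCalculus.

(** * Differential inequalities with power weights *)

Section DerivativeRules.
Context {R : realType}.
Implicit Types (f g : R -> R) (t : R).

Lemma isder_eq f t (d d' : R) : is_derive t 1 f d -> d = d' -> is_derive t 1 f d'.
Proof. by move=> h <-. Qed.

Lemma isder_cst t (c : R) : is_derive t 1 (fun=> c) 0.
Proof. exact: is_derive_cst. Qed.

Lemma isder_id t : is_derive t 1 (fun s : R => s) 1.
Proof. exact: is_derive_id. Qed.

Lemma isder_add f g t (df dg : R) : is_derive t 1 f df -> is_derive t 1 g dg ->
  is_derive t 1 (fun s => f s + g s) (df + dg).
Proof. by move=> hf hg; apply: is_deriveD. Qed.

Lemma isder_opp f t (df : R) : is_derive t 1 f df ->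
  is_derive t 1 (fun s => - f s) (- df).
Proof. by move=> hf; apply: is_deriveN. Qed.

Lemma isder_sub f g t (df dg : R) : is_derive t 1 f df -> is_derive t 1 g dg ->
  is_derive t 1 (fun s => f s - g s) (df - dg).
Proof. by move=> hf hg; apply: is_deriveB. Qed.

Lemma isder_mul f g t (df dg : R) : is_derive t 1 f df -> is_derive t 1 g dg ->
  is_derive t 1 (fun s => f s * g s) (df * g t + f t * dg).
Proof.
move=> hf hg; apply: (isder_eq (is_deriveM hf hg)).
by rewrite addrC [X in X + _]mulrC.
Qed.

Lemma isder_scale f t (c df : R) : is_derive t 1 f df ->
  is_derive t 1 (fun s => c * f s) (c * df).
Proof.
move=> hf; apply: (isder_eq (isder_mul (isder_cst t c) hf)).
by rewrite mul0r add0r.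
Qed.

Lemma isder_inv f t (df : R) : f t != 0 -> is_derive t 1 f df ->
  is_derive t 1 (fun s => (f s)^-1) (- df / f t ^+ 2).
Proof.
move=> f0 hf; apply: (isder_eq (is_deriveV f0 hf)).
by rewrite /GRing.scale/= mulNr mulrC -mulNr.
Qed.

Lemma isder_sqr f t (df : R) : is_derive t 1 f df ->
  is_derive t 1 (fun s => f s ^+ 2) (2 * f t * df).
Proof.
move=> hf; apply: (isder_eq (isder_mul hf hf)); ring.
Qed.

(** The derivatives of the powers are recorded as logarithmic derivatives,
which keeps the exponents unchanged through all the differential inequalities. *)
Lemma isder_powR f t (a df : R) : 0 < f t -> is_derive t 1 f df ->
  is_derive t 1 (fun s => f s `^ a) (a * (df / f t) * f t `^ a).
Proof.
move=> f0 hf.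
have h := @is_derive1_comp _ (fun x : R => x `^ a) f t _ _ (is_derive1_powR a f0) hf.
apply: (isder_eq h).
have -> : f t `^ (a - 1) = f t `^ a / f t.
  by rewrite powRD ?powRN ?powRr1 ?ltW// (gt_eqF f0) implybT.
by field; rewrite gt_eqF.
Qed.

Lemma isder_1powR t (a : R) : 0 <= t ->
  is_derive t 1 (fun s => (1 + s) `^ a) (a / (1 + t) * (1 + t) `^ a).
Proof.
move=> t0; have t1 : 0 < 1 + t by rewrite ltr_pwDl.
apply: (isder_eq (isder_powR a t1 (isder_add (isder_cst t 1) (isder_id t)))).
by rewrite add0r mulrA mulr1.
Qed.

End DerivativeRules.

Section RealPowers.
Context {R : realType}.
Implicit Types (t x a c : R).

Lemma powR_add x a c : 0 < x -> x `^ a * x `^ c = x `^ (a + c).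
Proof. by move=> x0; rewrite powRD// (gt_eqF x0) implybT. Qed.

Lemma powR_succ x a : 0 < x -> x `^ (a + 1) = x `^ a * x.
Proof. by move=> x0; rewrite -powR_add// powRr1// ltW. Qed.

Lemma powR_pred x a : 0 < x -> x `^ a = x `^ (a - 1) * x.
Proof. by move=> x0; rewrite -powR_succ// subrK. Qed.

Lemma powR_sqr x a : 0 < x -> (x `^ a) ^+ 2 = x `^ (2 * a).
Proof. by move=> x0; rewrite expr2 powR_add// mulrDl mul1r. Qed.

Lemma powR_neg_le1 x a : 1 <= x -> a <= 0 -> x `^ a <= 1.
Proof. by move=> x1 a0; rewrite -[leRHS](powRr0 x) ler_powR. Qed.

Lemma powR_ge1 x a : 1 <= x -> 0 <= a -> 1 <= x `^ a.
Proof. by move=> x1 a0; rewrite -[leLHS](powRr0 x) ler_powR. Qed.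

Lemma powR_mono a x y : 0 <= a -> 0 <= x -> x <= y -> x `^ a <= y `^ a.
Proof. by move=> a0 x0 xy; rewrite ge0_ler_powR// nnegrE// (le_trans x0). Qed.

End RealPowers.

Section DifferentialInequalities.
Context {R : realType}.
Implicit Types (f : R -> R) (t : R).

(** A fast relaxation towards zero at rate [b / eps] forgets everything but the
size of the source: the quantity [s] never exceeds the level at which the
damping term beats the source. *)
Lemma relaxation (s ds b : R -> R) (eps K L T : R) : 0 < eps -> 0 <= K ->
  (forall t : R, 0 <= t <= T -> is_derive t 1 s (ds t)) ->
  (forall t : R, 0 <= t <= T -> 0 <= b t) ->
  (forall t : R, 0 <= t <= T -> 0 <= s t) ->
  (forall t : R, 0 <= t <= T ->
     eps * ds t <= b t * (2 * K * Num.sqrt (s t) - s t)) ->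
  2 * K <= L -> s 0 <= L ^+ 2 ->
  forall t : R, 0 <= t <= T -> s t <= L ^+ 2.
Proof.
move=> e0 K0 sd b0 s0 H KL sL; apply: (barrier sd sL) => t tT Ls.
rewrite -(pmulr_rle0 _ e0); apply: le_trans (H _ tT) _.
rewrite mulr_ge0_le0 ?b0// subr_le0 -{2}(sqr_sqrtr (s0 _ tT)) expr2.
have L0 : 0 <= L by apply: le_trans KL; rewrite mulr_ge0.
apply: ler_pM => //; rewrite ?mulr_ge0 ?sqrtr_ge0//.
by apply: (le_trans KL); rewrite -(ger0_norm L0) -sqrtr_sqr ler_wsqrtr.
Qed.

(** Comparison with the explicit solutions of [f' = - k (1 + t)^p f^(m + 1)]. *)
Lemma power_decay f (df : R -> R) (k p m C T : R) : 0 < m -> 0 < k -> 0 <= p ->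
  (forall t : R, 0 <= t <= T -> is_derive t 1 f (df t)) ->
  (forall t : R, 0 <= t <= T -> 0 <= f t) ->
  (forall t : R, 0 <= t <= T -> df t <= - k * (1 + t) `^ p * (f t `^ m * f t)) ->
  f 0 <= C -> 0 < C -> (p + 1) / m <= k * C `^ m ->
  forall t : R, 0 <= t <= T -> f t * (1 + t) `^ ((p + 1) / m) <= C.
Proof.
move=> m0 k0 p0 fd f0 H fC C0 Ck.
set q := (p + 1) / m.
have q0 : 0 <= q by rewrite divr_ge0 ?(ltW m0) ?addr_ge0.
pose g t := f t * (1 + t) `^ q.
pose dg t := df t * (1 + t) `^ q + f t * (q / (1 + t) * (1 + t) `^ q).
apply: (@barrier _ g dg).
- move=> t tT; apply: isder_mul; first exact: fd.
  by apply: isder_1powR; case/andP: tT.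
- by rewrite /g addr0 powR1 mulr1.
move=> t tT; rewrite /g => Cg.
have t0 : 0 <= t by case/andP: tT.
have t1 : 0 < 1 + t by rewrite ltr_pwDl.
have E0 : 0 < (1 + t) `^ q by rewrite powR_gt0.
have ft0 : 0 < f t by rewrite -(pmulr_lgt0 _ E0); apply: lt_le_trans Cg.
rewrite /dg; set e := (1 + t) `^ q in Cg E0 *.
have em : e `^ m = (1 + t) `^ p * (1 + t).
  by rewrite /e -powRrM /q divfK ?gt_eqF// powR_succ.
have key : q <= k * (f t `^ m * ((1 + t) `^ p * (1 + t))).
  rewrite -em -(powRM _ (ltW ft0) (ltW E0)); apply: (le_trans Ck); rewrite ler_pM2l//.
  by rewrite powR_mono// ltW.
have -> : df t * e + f t * (q / (1 + t) * e) = e * (df t + f t * q / (1 + t)).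
  by ring.
rewrite pmulr_rle0//; apply: le_trans (lerD (H _ tT) (lexx _)) _.
rewrite mulNr mulNr addrC subr_le0 ler_pdivrMr//.
apply: le_trans (ler_wpM2l (ltW ft0) key) _.
rewrite le_eqVlt; apply/orP; left; apply/eqP; ring.
Qed.

(** The same comparison from below. *)
Lemma power_lower_bound f (df : R -> R) (k p m C T : R) :
  0 < m -> 0 < k -> 0 <= p ->
  (forall t : R, 0 <= t <= T -> is_derive t 1 f (df t)) ->
  (forall t : R, 0 <= t <= T -> 0 < f t) ->
  (forall t : R, 0 <= t <= T -> - k * (1 + t) `^ p * (f t `^ m * f t) <= df t) ->
  C <= f 0 -> 0 < C -> k * C `^ m <= (p + 1) / m ->
  forall t : R, 0 <= t <= T -> C <= f t * (1 + t) `^ ((p + 1) / m).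
Proof.
move=> m0 k0 p0 fd f0 H fC C0 Ck t tT.
set q := (p + 1) / m.
have q0 : 0 <= q by rewrite divr_ge0 ?(ltW m0) ?addr_ge0.
pose g t := - (f t * (1 + t) `^ q).
pose dg t := - (df t * (1 + t) `^ q + f t * (q / (1 + t) * (1 + t) `^ q)).
rewrite -lerN2 -/(g t); move: t tT.
apply: (@barrier _ g dg).
- move=> t tT; apply: isder_opp; apply: isder_mul; first exact: fd.
  by apply: isder_1powR; case/andP: tT.
- by rewrite /g addr0 powR1 mulr1 lerN2.
move=> t tT; rewrite /g lerN2 => Cg.
have t0 : 0 <= t by case/andP: tT.
have t1 : 0 < 1 + t by rewrite ltr_pwDl.
have E0 : 0 < (1 + t) `^ q by rewrite powR_gt0.
have ft0 := f0 _ tT.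
rewrite /dg; set e := (1 + t) `^ q in Cg E0 *.
have em : e `^ m = (1 + t) `^ p * (1 + t).
  by rewrite /e -powRrM /q divfK ?gt_eqF// powR_succ.
have key : k * (f t `^ m * ((1 + t) `^ p * (1 + t))) <= q.
  rewrite -em -(powRM _ (ltW ft0) (ltW E0)); apply: le_trans Ck; rewrite ler_pM2l//.
  by rewrite powR_mono ?(ltW m0) ?(ltW (mulr_gt0 ft0 E0)).
have -> : df t * e + f t * (q / (1 + t) * e) = e * (df t + f t * q / (1 + t)).
  by ring.
rewrite oppr_le0 pmulr_rge0//; apply: le_trans (lerD (H _ tT) (lexx _)).
rewrite mulNr mulNr addrC subr_ge0 ler_pdivlMr//.
apply: le_trans (ler_wpM2l (ltW ft0) key).
rewrite le_eqVlt; apply/orP; left; apply/eqP; ring.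
Qed.

End DifferentialInequalities.

(** * Decay of a hyperbolic energy at the parabolic rate *)

Section HyperbolicDecay.
Context {R : realType}.

Lemma normr_bounds (x y : R) : `|x| <= y -> - y <= x /\ x <= y.
Proof. by rewrite ler_norml => /andP[]. Qed.

(** The algebra behind [hyperbolic_decay]: the left-hand side is the derivative
of [F + F * (eps * y / (b * x))]. In the dimensionless quantities of the proof
it is [- 2 zeta - G] up to terms whose coefficients are at most 1/8; the mixed
term [theta] is absorbed because [theta ^ 2 <= zeta G]. *)
Lemma modified_energy_ineq (eps b db c kc x dx y z q F dF : R) :
  0 < eps -> 0 < b -> 0 < c -> 0 < x -> 0 <= z -> 0 <= q ->
  F = eps * z / c + q -> dF = - (z / c) * (2 * b + eps * kc) ->
  eps * `|kc| <= b / 8 -> eps * `|dx| <= b * x / 8 ->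
  eps * `|db| <= b ^+ 2 / 8 -> eps * `|y| <= b * x / 8 ->
  eps * c * F <= b ^+ 2 * x / 8 -> y ^+ 2 <= x * z ->
  dF + (dF * (eps * y / (b * x)) + F * (eps * (z - (b * y + c * q) / eps) / (b * x)
     - eps * y * (db * x + b * dx) / (b * x) ^+ 2))
  <= - (1 / 4) * (c * F ^+ 2 / (b * x)).
Proof.
move=> e0 b0 c0 x0 z0 q0 FE dFE kcb dxb dbb yb cF yxz.
have F0 : 0 <= F.
  by rewrite FE addr_ge0// divr_ge0 ?mulr_ge0 ?(ltW e0) ?(ltW c0).
pose zeta := b * z / c; pose G := c * F ^+ 2 / (b * x).
pose eta := eps * y / (b * x); pose nu := eps * kc / b.
pose mu := eps * c * F / (b ^+ 2 * x); pose theta := F * y / x.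
pose om1 := eps * db / b ^+ 2; pose om2 := eps * dx / (b * x).
have bx0 : 0 < b * x by rewrite mulr_gt0.
have zeta0 : 0 <= zeta by rewrite divr_ge0 ?mulr_ge0 ?(ltW b0) ?(ltW c0).
have G0 : 0 <= G by rewrite divr_ge0// ?(ltW bx0)// mulr_ge0 ?sqr_ge0 ?(ltW c0).
have normeps (u v : R) : 0 < v -> eps * `|u| <= v / 8 -> `|eps * u / v| <= 1 / 8.
  move=> v0 H; rewrite !normrM normfV (gtr0_norm e0) (gtr0_norm v0).
  rewrite ler_pdivrMr//. lra.
have eta8 : `|eta| <= 1 / 8 by apply: normeps.
have nu8 : `|nu| <= 1 / 8 by apply: normeps.
have om18 : `|om1| <= 1 / 8 by apply: normeps => //; rewrite exprn_gt0.
have om28 : `|om2| <= 1 / 8 by apply: normeps.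
have mu0 : 0 <= mu.
  rewrite /mu divr_ge0 ?(mulr_ge0 _ (ltW x0)) ?sqr_ge0//.
  by rewrite mulr_ge0// mulr_ge0 ?(ltW e0) ?(ltW c0).
have mu8 : mu <= 1 / 8.
  by rewrite /mu ler_pdivrMr ?mulr_gt0 ?exprn_gt0//; lra.
have theta2 : theta ^+ 2 <= zeta * G.
  have -> : zeta * G = F ^+ 2 * (x * z) / x ^+ 2.
    by rewrite /zeta /G; field; rewrite !gt_eqF.
  rewrite /theta !exprMn exprVn ler_pM2r ?invr_gt0 ?exprn_gt0//.
  by rewrite ler_wpM2l ?sqr_ge0.
have thetab : `|theta| <= (zeta + G) / 2.
  rewrite -ler_sqr ?nnegrE ?divr_ge0 ?addr_ge0// real_normK ?num_real//.
  apply: le_trans theta2 _.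
  have -> : ((zeta + G) / 2) ^+ 2 = zeta * G + (zeta - G) ^+ 2 / 4 by field.
  by rewrite lerDl divr_ge0 ?sqr_ge0.
have -> : dF + (dF * (eps * y / (b * x)) + F * (eps * (z - (b * y + c * q) / eps) / (b * x)
     - eps * y * (db * x + b * dx) / (b * x) ^+ 2))
  = - zeta * (2 + nu) * (1 + eta) + 2 * mu * zeta - theta - G - theta * (om1 + om2).
  rewrite dFE /zeta /nu /eta /mu /theta /G /om1 /om2 FE.
  by field; rewrite !gt_eqF.
have [e1 e2] := normr_bounds eta8.
have [n1 n2] := normr_bounds nu8.
have [w1 w2] := normr_bounds om18.
have [w3 w4] := normr_bounds om28.
have tho : - (theta * (om1 + om2)) <= `|theta| / 4.
  apply: le_trans (ler_norm _) _; rewrite normrN normrM ler_wpM2l//.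
  by rewrite ler_norml; apply/andP; split; lra.
have thn : - theta <= `|theta| by rewrite -normrN ler_norm.
have h1 : 15 / 8 * (7 / 8) <= (2 + nu) * (1 + eta) by nra.
have h2 : zeta * (15 / 8 * (7 / 8)) <= zeta * ((2 + nu) * (1 + eta)).
  by rewrite ler_wpM2l.
have h3 : mu * zeta <= 1 / 8 * zeta by rewrite ler_wpM2r.
have -> : - zeta * (2 + nu) * (1 + eta) = - (zeta * ((2 + nu) * (1 + eta))) by ring.
rewrite -/G; lra.
Qed.

(** The energy [F = eps z / c + q] alone is only known to decrease through [z].
Adding the small cross term [F * eps * y / (b * x)] converts this into a
decrease proportional to [F ^+ 2]: formally this is the parabolic estimate
[q' <= - 2 c q ^+ 2 / (b x)] for [b u' + c A u = 0]. *)
Lemma hyperbolic_decay (eps T k m p C : R) (b db c kc x dx y z q : R -> R) :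
  let F t := eps * z t / c t + q t in
  0 < eps -> 0 < k -> 0 < m -> 0 <= p ->
  (forall t : R, 0 <= t <= T -> [/\ 0 < b t, 0 < c t, 0 < x t, 0 <= z t & 0 <= q t]) ->
  (forall t : R, 0 <= t <= T ->
    [/\ is_derive t 1 b (db t), is_derive t 1 x (dx t),
        is_derive t 1 y (z t - (b t * y t + c t * q t) / eps) &
        is_derive t 1 F (- (z t / c t) * (2 * b t + eps * kc t))]) ->
  (forall t : R, 0 <= t <= T ->
    [/\ eps * `|kc t| <= b t / 8, eps * `|dx t| <= b t * x t / 8,
        eps * `|db t| <= b t ^+ 2 / 8 & eps * `|y t| <= b t * x t / 8]) ->
  (forall t : R, 0 <= t <= T ->
    eps * c t * F t <= b t ^+ 2 * x t / 8 /\ y t ^+ 2 <= x t * z t) ->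
  (forall t : R, 0 <= t <= T ->
    k * (1 + t) `^ p * (F t `^ m * F t) <= c t * F t ^+ 2 / (b t * x t)) ->
  2 * F 0 <= C -> 0 < C -> (p + 1) / m <= k / 8 * (1 / 2) `^ m * C `^ m ->
  forall t : R, 0 <= t <= T -> F t * (1 + t) `^ ((p + 1) / m) <= 2 * C.
Proof.
move=> F e0 k0 m0 p0 pos der small small2 low FC C0 Cbig.
pose H t := F t + F t * (eps * y t / (b t * x t)).
have F0 (t : R) : 0 <= t <= T -> 0 <= F t.
  move=> /pos[_ /ltW c0 _ z0 q0]; rewrite /F addr_ge0// divr_ge0// mulr_ge0//.
  exact: ltW.
have HF (t : R) : 0 <= t <= T -> F t <= 2 * H t /\ H t <= 2 * F t.
  move=> tT; have [b0 _ x0 _ _] := pos _ tT; have [_ _ _ yb] := small _ tT.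
  have bx0 : 0 < b t * x t by rewrite mulr_gt0.
  have : `|eps * y t / (b t * x t)| <= 1 / 8.
    rewrite !normrM normfV (gtr0_norm e0) (gtr0_norm bx0).
    by rewrite ler_pdivrMr//; lra.
  move=> /normr_bounds[h1 h2]; have := F0 _ tT; rewrite /H.
  by set v := eps * _ / _ in h1 h2 *; move=> Ft; split; nra.
have H0 (t : R) : 0 <= t <= T -> 0 <= H t.
  by move=> tT; have [h _] := HF _ tT; have := F0 _ tT; lra.
pose dH t := - (z t / c t) * (2 * b t + eps * kc t)
  + (- (z t / c t) * (2 * b t + eps * kc t) * (eps * y t / (b t * x t))
  + F t * (eps * (z t - (b t * y t + c t * q t) / eps) / (b t * x t)
     - eps * y t * (db t * x t + b t * dx t) / (b t * x t) ^+ 2)).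
have Hd (t : R) : 0 <= t <= T -> is_derive t 1 H (dH t).
  move=> tT; have [b0 c0 x0 _ _] := pos _ tT; have [bd xd yd Fd] := der _ tT.
  have bx0 : b t * x t != 0 by rewrite mulf_neq0// gt_eqF.
  have h := isder_add Fd (isder_mul Fd (isder_mul (isder_scale eps yd)
    (isder_inv (f := fun s => b s * x s) bx0 (isder_mul bd xd)))).
  apply: (isder_eq h); rewrite /dH; congr (_ + (_ + _ * _)).
  by rewrite mulNr mulrN !mulrA.
have dHle (t : R) : 0 <= t <= T ->
    dH t <= - (k / 8 * (1 / 2) `^ m) * (1 + t) `^ p * (H t `^ m * H t).
  move=> tT; have [b0 c0 x0 z0 q0] := pos _ tT.
  have [s1 s2 s3 s4] := small _ tT; have [s5 s6] := small2 _ tT.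
  apply: (@le_trans _ _ (- (1 / 4) * (c t * F t ^+ 2 / (b t * x t)))).
    exact: modified_energy_ineq.
  rewrite !mulNr lerN2.
  have [_ HF2] := HF _ tT.
  have E0 : 0 <= (1 + t) `^ p by rewrite powR_ge0.
  have Hh : 1 / 2 * H t <= F t by rewrite mul1r mulrC ler_pdivrMr// mulrC.
  have Hh0 : 0 <= 1 / 2 * H t by rewrite mulr_ge0// H0.
  have h1 : (1 / 2) `^ m * H t `^ m * (1 / 2 * H t) <= F t `^ m * F t.
    rewrite -powRM ?H0// ler_pM ?powR_ge0//.
    by rewrite powR_mono// ltW.
  have h2 := low _ tT.
  have h3 : k * (1 + t) `^ p * ((1 / 2) `^ m * H t `^ m * (1 / 2 * H t))
     <= k * (1 + t) `^ p * (F t `^ m * F t).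
    by rewrite ler_wpM2l// mulr_ge0// ltW.
  have -> : k / 8 * (1 / 2) `^ m * (1 + t) `^ p * (H t `^ m * H t)
    = 1 / 4 * (k * (1 + t) `^ p * ((1 / 2) `^ m * H t `^ m * (1 / 2 * H t))).
    by field.
  by rewrite ler_pM2l//; apply: le_trans h3 h2.
move=> t tT.
have T0 : 0 <= (0 : R) <= T.
  by case/andP: tT => t0 tT'; rewrite lexx (le_trans t0 tT').
have H0C : H 0 <= C by apply: le_trans FC; have [] := HF _ T0.
have kk : 0 < k / 8 * (1 / 2) `^ m by rewrite mulr_gt0 ?divr_gt0 ?powR_gt0.
have := power_decay m0 kk p0 Hd H0 dHle H0C C0 Cbig tT.
have [h _] := HF _ tT; have := powR_gt0 ((p + 1) / m) (_ : 0 < 1 + t).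
move=> /(_ ltac:(case/andP: tT => t0 _; lra)).
set e := _ `^ _ => e0' h'.
apply: (le_trans (ler_wpM2r (ltW e0') h)); rewrite -mulrA ler_pM2l//.
Qed.

End HyperbolicDecay.

(** * A priori estimates on a bounded interval *)

(** Here [r] and [s] stand for [K / (x0^g x0)] and [K / x0^g], which bound the
initial values of [|Y| / (c X)] and of [|Y| / c]. *)
Lemma bootstrap_constants (R : realType) (K K1 K2 CF KW L4 L5 N CX r s : R) :
  0 < K -> 0 <= K1 -> 0 < r -> 0 < s -> 2 * K1 + r <= K2 -> 2 * (s + K) <= CF ->
  0 <= KW -> 2 * KW + s <= L4 -> 4 * CF + s <= L5 -> 4 * (2 * K + 3) <= N ->
  2 * (s + K) <= CX ->
  [/\ [/\ 0 < K2, 2 * K1 <= K2 & r <= K2],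
    [/\ 0 < CF, 0 <= L4, 2 * KW <= L4 & s <= L4] &
    [/\ 2 * (2 * CF) <= L5, s <= L5, 1 <= N & 0 < CX]].
Proof. by split; split; lra. Qed.

Section EnergyEstimates.
Context {R : realType}.
Variables (g p eps d T M : R) (U V W X Y Z Q dQ : R -> R).

Let E r t : R := (1 + t) `^ r.
Let b (t : R) : R := E (- p) t.
Let c (t : R) : R := X t `^ g.
Let q : R := (p + 1) / g.
Let a : R := (p + 1) / (g + 1).
Let F (t : R) : R := eps * Z t / c t + Q t.
(* The quotient [Q / X], corrected by the Gram determinant of [A^(1/2) u] and
   [A^(1/2) u']: this is the combination that turns out to be nonincreasing. *)
Let Rf (t : R) : R := eps * (X t * Z t - Y t ^+ 2) / (c t * X t ^+ 2) + Q t / X t.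

Hypothesis g1 : 1 <= g.
Hypothesis p01 : 0 <= p <= 1.
Hypothesis eps0 : 0 < eps.
Hypothesis d0 : 0 < d.
Hypothesis dE : 16 * (g + 2) * d = 1.
Hypothesis epsd : eps <= d.
Hypothesis M1 : 1 <= M.
Hypothesis pos : forall t : R, 0 <= t <= T ->
  [/\ 0 <= U t, 0 <= W t, 0 < X t, 0 <= Z t & 0 <= Q t].
Hypothesis schwarz : forall t : R, 0 <= t <= T ->
  [/\ V t ^+ 2 <= U t * W t, Y t ^+ 2 <= X t * Z t & Y t ^+ 2 <= Q t * W t].
Hypothesis der : forall t : R, 0 <= t <= T ->
  [/\ is_derive t 1 U (2 * V t),
      is_derive t 1 V (W t - (b t * V t + c t * X t) / eps) &
      is_derive t 1 W (- (2 * b t * W t + 2 * c t * Y t) / eps)] /\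
  [/\ is_derive t 1 X (2 * Y t),
      is_derive t 1 Y (Z t - (b t * Y t + c t * Q t) / eps),
      is_derive t 1 Z (- (2 * b t * Z t + c t * dQ t) / eps) &
      is_derive t 1 Q (dQ t)].
(* The bootstrap hypothesis: [X] varies slowly compared with the relaxation time
   [eps / b] of the velocity. *)
Hypothesis slow : forall t : R, 0 <= t <= T -> eps * `|Y t| <= d * b t * X t.

Lemma E_gt0 (r t : R) : 0 <= t -> 0 < E r t.
Proof. by move=> t0; rewrite powR_gt0// ltr_pwDl. Qed.

Lemma E_add (r s t : R) : 0 <= t -> E r t * E s t = E (r + s) t.
Proof. by move=> t0; rewrite /E powR_add// ltr_pwDl. Qed.

Lemma E_le (r s t : R) : 0 <= t -> r <= s -> E r t <= E s t.
Proof. by move=> t0 rs; rewrite /E ler_powR// lerDl. Qed.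

Lemma E_r0 t : E 0 t = 1. Proof. exact: powRr0. Qed.

Lemma E_at0 r : E r 0 = 1. Proof. by rewrite /E addr0 powR1. Qed.

Let b_gt0 t : 0 <= t <= T -> 0 < b t.
Proof. by move=> /andP[t0 _]; exact: E_gt0. Qed.

Let c_gt0 t : 0 <= t <= T -> 0 < c t.
Proof. by move=> /pos[_ _ X0 _ _]; rewrite powR_gt0. Qed.

Let bE (t : R) : 0 <= t -> b t = (E p t)^-1.
Proof. by move=> t0; rewrite /b /E powRN. Qed.

Let bEp (t : R) : 0 <= t -> b t * E p t = 1.
Proof. by move=> t0; rewrite /b E_add// addNr E_r0. Qed.

Let inv1t_le t : 0 <= t -> 0 <= (1 + t)^-1 <= b t.
Proof.
move=> t0; have t1 : 0 < 1 + t by rewrite ltr_pwDl.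
rewrite invr_ge0 (ltW t1)/= -[(1 + t)^-1](powR_inv1 (ltW t1)).
by rewrite -/(E (-1) t) E_le// lerN2; case/andP: p01.
Qed.

Let d_small : d <= 1 / 48 /\ g * d <= 1 / 16.
Proof. by move: g1 d0 dE => *; split; nra. Qed.

Let q02 : 0 <= q <= 2.
Proof.
have g0 : 0 < g by apply: lt_le_trans g1.
move/andP: p01 => [p0 p1].
rewrite divr_ge0 ?addr_ge0 ?(ltW g0)//= ler_pdivrMr//; move: g1; lra.
Qed.

Let rho_small (t : R) : 0 <= t <= T -> eps * `|Y t / X t| <= d * b t.
Proof.
move=> tT; have [_ _ X0 _ _] := pos tT.
by rewrite normrM normfV (gtr0_norm X0) mulrA ler_pdivrMr// slow.
Qed.

Let rho_bounds (t : R) : 0 <= t <= T ->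
  - (d * b t) <= eps * (Y t / X t) /\ eps * (Y t / X t) <= d * b t.
Proof.
move=> tT; apply: normr_bounds.
by rewrite normrM (gtr0_norm eps0) rho_small.
Qed.

Let b_der (t : R) : 0 <= t <= T -> is_derive t 1 b (- p / (1 + t) * b t).
Proof. by move=> /andP[t0 _]; exact: isder_1powR. Qed.

Let c_der (t : R) : 0 <= t <= T -> is_derive t 1 c (g * (2 * Y t / X t) * c t).
Proof.
move=> tT; have [_ _ X0 _ _] := pos tT; have [_ [dX _ _ _]] := der tT.
exact: isder_powR.
Qed.

(** [Rf' = - (D / (c X^2)) (2 b + 2 (g + 2) eps Y / X)] with the Gram
determinant [D = X Z - Y^2], and slowness makes the last factor positive. *)
Lemma dirichlet_quotient_bound K : Rf 0 <= K ->
  forall t : R, 0 <= t <= T -> Rf t <= K.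
Proof.
move=> R0 t /andP[t0 tT]; apply: le_trans R0.
pose D s := X s * Z s - Y s ^+ 2.
pose dR s := - (D s / (c s * X s ^+ 2)) *
  (2 * b s + 2 * (g + 2) * (eps * (Y s / X s))).
apply: (@derive_le0_nonincreasing _ Rf dR) => // s /andP[s0 st].
  have sT : 0 <= s <= T by rewrite s0 (le_trans st tT).
  have [_ _ X0 _ _] := pos sT; have [_ [dX dY dZ dQ']] := der sT.
  have cX0 : c s * X s ^+ 2 != 0.
    by rewrite mulf_neq0 ?gt_eqF ?exprn_gt0// c_gt0.
  have h := isder_add (isder_mul (isder_scale eps
     (isder_sub (isder_mul dX dZ) (isder_sqr dY)))
    (isder_inv (f := fun s => c s * X s ^+ 2) cX0
      (isder_mul (c_der sT) (isder_sqr dX))))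
    (isder_mul dQ' (isder_inv (lt0r_neq0 X0) dX)).
  apply: (isder_eq h); rewrite /dR /D.
  by field; rewrite !lt0r_neq0// c_gt0.
have sT : 0 <= s <= T by rewrite s0 (le_trans st tT).
have [_ _ X0 _ _] := pos sT; have [_ D0 _] := schwarz sT.
rewrite /dR mulNr oppr_le0 mulr_ge0//.
  by rewrite divr_ge0 ?subr_ge0// mulr_ge0 ?sqr_ge0// ltW// c_gt0.
have [h _] := rho_bounds sT; have := b_gt0 sT.
have gd : 2 * (g + 2) * d = 1 / 8 by move: dE; lra.
have g20 : 0 <= 2 * (g + 2) by move: g1; lra.
have := ler_wpM2l g20 h.
have -> : 2 * (g + 2) * - (d * b s) = - (2 * (g + 2) * d * b s) by ring.
rewrite gd; lra.
Qed.

(** The logarithmic derivative [Y / X] solves a relaxation equation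
whose source is at most [c * Rf]. The weight [w] has to vary slowly compared
with the damping. *)
Lemma log_derivative_bound (w kw : R -> R) (K L : R) : 0 <= K -> 2 * K <= L ->
  (forall t : R, 0 <= t <= T -> 0 < w t) ->
  (forall t : R, 0 <= t <= T -> is_derive t 1 w (kw t * w t)) ->
  (forall t : R, 0 <= t <= T -> eps * kw t <= b t / 4) ->
  (forall t : R, 0 <= t <= T -> c t * Rf t * w t <= K * b t) ->
  `|Y 0 / X 0| * w 0 <= L ->
  forall t : R, 0 <= t <= T -> `|Y t / X t| * w t <= L.
Proof.
move=> K0 KL w0 wd kwb src init t tT.
have L0 : 0 <= L by apply: le_trans KL; rewrite mulr_ge0.
pose s t := (Y t / X t * w t) ^+ 2.
pose dr t := (Z t - (b t * Y t + c t * Q t) / eps) / X t - 2 * (Y t / X t) ^+ 2.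
pose ds t := 2 * (Y t / X t * w t) * (dr t * w t + Y t / X t * (kw t * w t)).
have sd (r : R) : 0 <= r <= T -> is_derive r 1 s (ds r).
  move=> rT; have [_ _ X0 _ _] := pos rT; have [_ [dX dY _ _]] := der rT.
  apply: (isder_eq (isder_sqr (isder_mul (isder_mul dY
    (isder_inv (lt0r_neq0 X0) dX)) (wd _ rT)))).
  by rewrite /ds /dr; field; rewrite !lt0r_neq0.
have sqs (r : R) : 0 <= r <= T -> Num.sqrt (s r) = `|Y r / X r * w r|.
  by move=> _; rewrite /s sqrtr_sqr.
have step (r : R) : 0 <= r <= T ->
    eps * ds r <= b r * (2 * K * Num.sqrt (s r) - s r).
  move=> rT; have [_ _ X0 Z0 Q0] := pos rT; have [_ D0 _] := schwarz rT.
  have wr := w0 _ rT; have cr := c_gt0 rT; have br := b_gt0 rT.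
  rewrite sqs//.
  pose G := eps * (X r * Z r - Y r ^+ 2) / X r ^+ 2 - c r * Q r / X r.
  have Gb : `|G| <= c r * Rf r.
    have A0 : 0 <= eps * (X r * Z r - Y r ^+ 2) / X r ^+ 2.
      by rewrite divr_ge0 ?sqr_ge0// mulr_ge0 ?subr_ge0// ltW.
    have B0 : 0 <= c r * Q r / X r.
      by rewrite divr_ge0 ?mulr_ge0// ltW.
    have -> : c r * Rf r = eps * (X r * Z r - Y r ^+ 2) / X r ^+ 2 + c r * Q r / X r.
      by rewrite /Rf; field; rewrite !lt0r_neq0.
    by rewrite /G ler_norml; apply/andP; split; lra.
  set f := Y r / X r * w r.
  have -> : eps * ds r = - 2 * (b r + eps * (Y r / X r) - eps * kw r) * f ^+ 2
    + 2 * f * (G * w r).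
    by rewrite /ds /dr /f /G; field; rewrite !lt0r_neq0.
  have h1 := kwb _ rT.
  have [h2 _] := rho_bounds rT.
  have h3 : f * (G * w r) <= `|f| * (K * b r).
    apply: le_trans (ler_norm _) _; rewrite normrM ler_wpM2l//.
    rewrite normrM (gtr0_norm wr); apply: le_trans (src _ rT).
    by rewrite ler_wpM2r// ltW.
  have h4 : d * b r <= 1 / 48 * b r by rewrite ler_pM2r//; case: d_small.
  have h5 : b r <= 2 * (b r + eps * (Y r / X r) - eps * kw r) by lra.
  have := ler_wpM2r (sqr_ge0 f) h5.
  have -> : s r = f ^+ 2 by [].
  move: h3; lra.
have s0 (r : R) : 0 <= r <= T -> 0 <= s r by move=> _; exact: sqr_ge0.
have b0 (r : R) : 0 <= r <= T -> 0 <= b r by move=> /b_gt0/ltW.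
have T0 : 0 <= (0 : R) <= T.
  by case/andP: tT => t0 tT'; rewrite lexx (le_trans t0 tT').
have sL : s 0 <= L ^+ 2.
  rewrite /s -real_normK ?num_real// ler_sqr ?nnegrE//.
  by rewrite normrM (gtr0_norm (w0 _ T0)).
have := relaxation eps0 K0 sd b0 s0 step KL sL tT.
rewrite /s -real_normK ?num_real// ler_sqr ?nnegrE//.
by rewrite normrM (gtr0_norm (w0 _ tT)).
Qed.

Let XRf_le (t : R) : 0 <= t <= T -> X t * Rf t <= F t.
Proof.
move=> tT; have [_ _ X0 _ _] := pos tT; have ct := c_gt0 tT.
have -> : F t = X t * Rf t + eps * Y t ^+ 2 / (c t * X t).
  by rewrite /F /Rf; field; rewrite !lt0r_neq0.
rewrite lerDl divr_ge0 ?(mulr_ge0 (ltW ct) (ltW X0))//.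
by rewrite mulr_ge0 ?sqr_ge0 ?(ltW eps0).
Qed.

Let F_ge0 t : 0 <= t <= T -> 0 <= F t.
Proof.
move=> tT; have [_ _ _ Z0 Q0] := pos tT.
by rewrite addr_ge0// divr_ge0 ?(ltW (c_gt0 tT))// mulr_ge0// ltW.
Qed.

(** The part of [F] that [X * Rf] does not cover is quadratic in [Y / X]; one of
these factors is bounded by slowness and the other one by [K2]. *)
Lemma energy_le_X K1 K2 :
  (forall t : R, 0 <= t <= T -> Rf t <= K1) ->
  (forall t : R, 0 <= t <= T -> `|Y t / X t| * (b t / c t) <= K2) ->
  forall t : R, 0 <= t <= T -> F t <= (K1 + K2) * X t.
Proof.
move=> H1 H2 t tT; have [_ _ X0 _ _] := pos tT; have ct := c_gt0 tT.
have bt := b_gt0 tT.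
have -> : F t = (Rf t + eps * (Y t / X t) ^+ 2 / c t) * X t.
  by rewrite /F /Rf; field; rewrite !lt0r_neq0.
rewrite ler_pM2r// lerD ?H1//; apply: le_trans (H2 _ tT).
rewrite -[X in eps * X]real_normK ?num_real// expr2 mulrA !mulrA.
rewrite -[X in _ <= X / _]mulrC ler_pM2r ?invr_gt0// ler_wpM2r//.
apply: le_trans (rho_small tT) _; rewrite ler_piMl ?(ltW bt)//.
by case: d_small => h _; apply: le_trans h _; lra.
Qed.

(** The logarithmic derivative of [X] is of the order of [c / b], which is that of
the limit equation with [eps = 0]. *)
Lemma X_lower_bound K2 C : 0 < K2 ->
  (forall t : R, 0 <= t <= T -> `|Y t / X t| * (b t / c t) <= K2) ->
  C <= X 0 -> 0 < C -> 2 * K2 * C `^ g <= q ->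
  forall t : R, 0 <= t <= T -> C <= X t * E q t.
Proof.
move=> K20 H2 XC C0 Cq; have g0 : 0 < g by apply: lt_le_trans g1.
have p0 : 0 <= p by case/andP: p01.
apply: (@power_lower_bound _ X (fun t => 2 * Y t) (2 * K2)) => //.
- by rewrite mulr_gt0.
- by move=> t tT; have [_ []] := der tT.
- by move=> t /pos[].
move=> t tT; have [_ _ X0 _ _] := pos tT; have ct := c_gt0 tT.
have bt := b_gt0 tT; have t0 : 0 <= t by case/andP: tT.
have := H2 _ tT; rewrite normrM normfV (gtr0_norm X0) mulrA ler_pdivrMr//.
rewrite mulrAC ler_pdivrMr// => h.
have Et := E_gt0 p t0.
have {}h : `|Y t| <= K2 * E p t * (c t * X t).
  rewrite -(ler_pM2r bt); apply: le_trans h _.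
  rewrite le_eqVlt; apply/orP; left; apply/eqP.
  have -> : K2 * E p t * (c t * X t) * b t = K2 * (c t * X t) * (b t * E p t) by ring.
  by rewrite bEp// mulr1 mulrA.
have [h1 _] := normr_bounds h.
by rewrite -/(E p t) -/(c t); lra.
Qed.

Hypothesis pcond : 2 * p <= q + a * (g - 1).
(* The constant [M] is larger than all the bounds that are derived below, and
   [eps] is small in terms of [M]. *)
Hypothesis XM : forall t : R, 0 <= t <= T -> X t * E a t <= M.
Hypothesis FM : forall t : R, 0 <= t <= T -> F t * E q t <= M.
Hypothesis UM : forall t : R, 0 <= t <= T -> U t <= M.

(** Here the admissible range of [p] enters: the decay of [X] pays for the
weight [(1 + t)^(2 p)] of [b ^ (- 2)]. *)
Lemma X_power_le (t : R) : 0 <= t <= T ->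
  X t `^ (g - 1) * E (2 * p) t <= M `^ (g - 1) * E q t.
Proof.
move=> tT; have [_ _ X0 _ _] := pos tT; have t0 : 0 <= t by case/andP: tT.
have g10 : 0 <= g - 1 by rewrite subr_ge0.
apply: (@le_trans _ _ (X t `^ (g - 1) * (E (a * (g - 1)) t * E q t))).
  by rewrite ler_wpM2l ?powR_ge0// E_add// E_le// addrC.
rewrite mulrA ler_pM2r ?E_gt0// /E powRrM -powRM ?(ltW X0) ?powR_ge0//.
by rewrite powR_mono// ?XM// mulr_ge0 ?powR_ge0// ltW.
Qed.

Let c_split (t : R) : 0 <= t <= T -> c t = X t `^ (g - 1) * X t.
Proof. by move=> /pos[_ _ X0 _ _]; rewrite /c -powR_pred. Qed.

Let c_weight (t : R) : 0 <= t <= T ->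
  c t * E (2 * p) t <= M `^ (g - 1) * E q t * X t.
Proof.
move=> tT; have [_ _ X0 _ _] := pos tT.
by rewrite c_split// mulrAC ler_pM2r// X_power_le.
Qed.

Let bb (t : R) : 0 <= t -> b t ^+ 2 * E (2 * p) t = 1.
Proof.
move=> t0; rewrite expr2 [2 * p]mulrDl mul1r -E_add//.
by rewrite mulrACA !bEp// mulr1.
Qed.

Let le_bb t x y : 0 <= t -> (x * E (2 * p) t <= y) -> x <= b t ^+ 2 * y.
Proof.
move=> t0 h; rewrite -[x]mulr1 -(bb t0) mulrCA ler_wpM2l ?sqr_ge0//.
Qed.

Let X_sqr_weight (t : R) : 0 <= t <= T -> E q t * X t ^+ 2 <= M ^+ 2.
Proof.
move=> tT; have t0 : 0 <= t by case/andP: tT.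
have [_ _ X0 _ _] := pos tT; have g0 : 0 < g by apply: lt_le_trans g1.
have /andP[p0 _] := p01.
apply: (@le_trans _ _ ((X t * E a t) ^+ 2)); last first.
  rewrite ler_sqr ?nnegrE ?XM ?(mulr_ge0 (ltW X0)) ?(ltW (E_gt0 _ _))//.
  exact: le_trans M1.
rewrite exprMn mulrC ler_wpM2l ?sqr_ge0// [E a t ^+ 2]powR_sqr ?ltr_pwDl//.
rewrite -/(E (2 * a) t) E_le// /q /a.
rewrite mulrCA ler_wpM2l ?addr_ge0// ler_pdivlMr ?addr_gt0// mulrC.
by rewrite ler_pdivrMr//; move: g1; lra.
Qed.

Let velocity_weight K (t : R) : 0 <= t <= T ->
  W t * (b t ^+ 2 * E q t) <= K * c t ^+ 2 ->
  W t * E q t <= K * (c t * E (2 * p) t) * c t.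
Proof.
move=> tT WK; have t0 : 0 <= t by case/andP: tT.
have := ler_wpM2r (ltW (E_gt0 (2 * p) t0)) WK.
have -> : W t * (b t ^+ 2 * E q t) * E (2 * p) t
  = W t * E q t * (b t ^+ 2 * E (2 * p) t) by ring.
by rewrite bb// mulr1 expr2; congr (_ <= _); ring.
Qed.

(** Of the parabolic size [c^2 / b^2] of [W], the factor [c / b^2] is at most a
multiple of [X], up to the weight [E q]; this leaves [c X]. *)
Lemma kinetic_le_potential K (t : R) : 0 <= K -> 0 <= t <= T ->
  W t * (b t ^+ 2 * E q t) <= K * c t ^+ 2 ->
  eps * (K * M `^ (g - 1)) <= 1 -> eps * W t <= c t * X t.
Proof.
move=> K0 tT WK eK; have t0 : 0 <= t by case/andP: tT.
have ct := c_gt0 tT; have [_ _ X0 _ _] := pos tT.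
rewrite -(ler_pM2r (E_gt0 q t0)) -mulrA.
apply: le_trans (ler_wpM2l (ltW eps0) (velocity_weight tT WK)) _.
apply: (@le_trans _ _ (eps * (K * (M `^ (g - 1) * E q t * X t) * c t))).
  by rewrite ler_wpM2l ?(ltW eps0)// ler_wpM2r ?(ltW ct)// ler_wpM2l// c_weight.
have -> : eps * (K * (M `^ (g - 1) * E q t * X t) * c t)
  = eps * (K * M `^ (g - 1)) * (c t * X t * E q t) by ring.
by rewrite ler_piMl// !mulr_ge0 ?(ltW ct) ?(ltW X0) ?(ltW (E_gt0 _ _)).
Qed.

Let kappa (t : R) := g * (2 * Y t / X t).

Let kappa_small (t : R) : 0 <= t <= T -> eps * `|kappa t| <= b t / 8.
Proof.
move=> tT; have g0 : 0 <= g by apply: le_trans g1.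
have -> : eps * `|kappa t| = 2 * g * (eps * `|Y t / X t|).
  by rewrite /kappa -mulrA normrM (ger0_norm g0) normrM (@ger0_norm _ 2)//; ring.
have h := rho_small tT; have bt := b_gt0 tT; case: d_small => _ gd.
apply: (@le_trans _ _ (2 * g * (d * b t))).
  by rewrite ler_wpM2l// mulr_ge0.
have -> : 2 * g * (d * b t) = 2 * (g * d) * b t by ring.
by rewrite [leRHS]mulrC ler_pM2r//; lra.
Qed.

Let db_small (t : R) : 0 <= t <= T -> eps * `|- p / (1 + t) * b t| <= b t ^+ 2 / 8.
Proof.
move=> tT; have bt := b_gt0 tT; have /andP[t0 _] := tT.
have /andP[i0 ib] := inv1t_le t0; have /andP[p0 p1] := p01.
rewrite !normrM normrN (ger0_norm p0) (ger0_norm i0) (gtr0_norm bt).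
apply: (@le_trans _ _ (d * (1 * b t * b t))).
  rewrite ler_pM ?mulr_ge0 ?(ltW eps0) ?(ltW bt)//.
  by rewrite ler_pM ?mulr_ge0 ?(ltW bt)// ler_pM.
rewrite mul1r -expr2 [leRHS]mulrC ler_pM2r ?exprn_gt0//.
by case: d_small => h _; apply: le_trans h _; lra.
Qed.

(** [hyperbolic_decay] for the energy [F], with [x = X]. The bound of [F] by [X]
makes the rate [c / X = X^(g - 1)] at least of the order of [F^(g - 1)]. *)
Lemma energy_decay K3 C : 0 < K3 ->
  (forall t : R, 0 <= t <= T -> F t <= K3 * X t) ->
  8 * eps * (M `^ (g - 1) * M) <= 1 ->
  2 * F 0 <= C -> 0 < C -> q <= K3 `^ (1 - g) / 8 * (1 / 2) `^ g * C `^ g ->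
  forall t : R, 0 <= t <= T -> F t * E q t <= 2 * C.
Proof.
move=> K30 H3 eM FC C0 Cq.
have g0 : 0 < g by apply: lt_le_trans g1.
apply: (@hyperbolic_decay _ eps T (K3 `^ (1 - g)) g p C b
  (fun t => - p / (1 + t) * b t) c kappa X (fun t => 2 * Y t) Y Z Q) => //.
- by rewrite powR_gt0.
- by case/andP: p01.
- by move=> t tT; have [_ _ X0 Z0 Q0] := pos tT; split=> //;
    [exact: b_gt0|exact: c_gt0].
- move=> t tT; have [_ [dX dY dZ dQ']] := der tT.
  have [_ _ X0 Z0 Q0] := pos tT; split=> //; first exact: b_der.
  have h := isder_add (isder_mul (isder_scale eps dZ)
    (isder_inv (lt0r_neq0 (c_gt0 tT)) (c_der tT))) dQ'.
  apply: (isder_eq h); rewrite -/(kappa t); field.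
  by rewrite !lt0r_neq0// c_gt0.
- move=> t tT; split; [exact: kappa_small| |exact: db_small|].
    rewrite normrM (@ger0_norm _ 2)// mulrCA.
    have := slow tT; have [_ _ X0 _ _] := pos tT; have bt := b_gt0 tT.
    have : d * (b t * X t) <= 1 / 48 * (b t * X t).
      by rewrite ler_pM2r ?mulr_gt0//; case: d_small.
    by rewrite mulrA; have := mulr_gt0 bt X0; lra.
  have := slow tT; have [_ _ X0 _ _] := pos tT; have bt := b_gt0 tT.
  have : d * (b t * X t) <= 1 / 48 * (b t * X t).
    by rewrite ler_pM2r ?mulr_gt0//; case: d_small.
  by rewrite mulrA; have := mulr_gt0 bt X0; lra.
- move=> t tT; have [_ D0 _] := schwarz tT; split=> //.
  have [_ _ X0 _ _] := pos tT; have t0 : 0 <= t by case/andP: tT.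
  rewrite -[leRHS]mulrA; apply: le_bb => //.
  have -> : eps * c t * F t * E (2 * p) t = eps * F t * (c t * E (2 * p) t) by ring.
  apply: (@le_trans _ _ (eps * F t * (M `^ (g - 1) * E q t * X t))).
    by rewrite ler_wpM2l ?c_weight// mulr_ge0 ?F_ge0// ltW.
  have -> : eps * F t * (M `^ (g - 1) * E q t * X t)
    = eps * M `^ (g - 1) * X t * (F t * E q t) by ring.
  apply: (@le_trans _ _ (eps * M `^ (g - 1) * X t * M)).
    by rewrite ler_wpM2l ?FM// !mulr_ge0 ?powR_ge0 ?(ltW eps0) ?(ltW X0).
  have -> : eps * M `^ (g - 1) * X t * M = eps * (M `^ (g - 1) * M) * X t by ring.
  by rewrite [leRHS]mulrC ler_pM2r//; lra.
move=> t tT; have [_ _ X0 _ _] := pos tT; have t0 : 0 <= t by case/andP: tT.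
have bt := b_gt0 tT; have F0 := F_ge0 tT; have Et := E_gt0 p t0.
change (K3 `^ (1 - g) * E p t * (F t `^ g * F t)
  <= c t * F t ^+ 2 / (b t * X t)).
rewrite le_eqVlt in F0; case/orP: F0 => [/eqP F0|Fp].
  have {}F0 : F t = 0 :> R by rewrite -F0.
  by rewrite F0 expr2 !mulr0 mul0r.
have -> : c t * F t ^+ 2 / (b t * X t) = E p t * (X t `^ (g - 1) * F t * F t).
  by rewrite c_split// bE//; field; rewrite !lt0r_neq0.
have key : K3 `^ (1 - g) * F t `^ (g - 1) <= X t `^ (g - 1).
  rewrite -(ler_pM2r (_ : 0 < K3 `^ (g - 1))) ?powR_gt0// mulrAC powR_add//.
  rewrite addrA subrK subrr powRr0 mul1r -powRM ?(ltW X0) ?(ltW K30)//.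
  by rewrite powR_mono ?subr_ge0 ?(ltW Fp)// mulrC H3.
have -> : K3 `^ (1 - g) * E p t * (F t `^ g * F t)
  = E p t * (K3 `^ (1 - g) * F t `^ (g - 1) * F t * F t).
  by rewrite (powR_pred g Fp); ring.
by rewrite ler_pM2l// ler_pM2r// ler_pM2r.
Qed.

Let inv1t_pos (t : R) : 0 <= t -> 0 < 1 + t.
Proof. by move=> t0; rewrite ltr_pwDl. Qed.

Let eps_inv1t (t : R) : 0 <= t -> 0 <= eps * (1 + t)^-1 <= 1 / 48 * b t.
Proof.
move=> t0; have /andP[i0 ib] := inv1t_le t0.
rewrite mulr_ge0 ?(ltW eps0)//=; apply: (@le_trans _ _ (d * b t)).
  by rewrite ler_pM ?(ltW eps0).
by rewrite ler_pM2r ?E_gt0//; case: d_small.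
Qed.

(** In the parabolic regime [b u' = - c A u]; up to a constant, this identity
survives for the norm of [u']. *)
Lemma velocity_bound K L : 0 <= K -> 2 * K <= L ->
  (forall t : R, 0 <= t <= T -> Q t * E q t <= K ^+ 2) ->
  W 0 <= L ^+ 2 * c 0 ^+ 2 ->
  forall t : R, 0 <= t <= T -> W t * (b t ^+ 2 * E q t) <= L ^+ 2 * c t ^+ 2.
Proof.
move=> K0 KL QK W0 t tT.
pose w s := b s ^+ 2 * E q s / c s ^+ 2.
pose kw s := - 2 * p / (1 + s) + q / (1 + s) - 2 * kappa s.
have wd (r : R) : 0 <= r <= T -> is_derive r 1 w (kw r * w r).
  move=> rT; have cr := c_gt0 rT; have r0 : 0 <= r by case/andP: rT.
  have c20 : c r ^+ 2 != 0 by rewrite lt0r_neq0// exprn_gt0.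
  have [_ _ X0 _ _] := pos rT; have r1 := inv1t_pos r0.
  have h := isder_mul (isder_mul (isder_sqr (b_der rT)) (isder_1powR q r0))
    (isder_inv (f := fun s => c s ^+ 2) c20 (isder_sqr (c_der rT))).
  apply: (isder_eq h); rewrite /kw /w /kappa -/(E q r).
  by field; rewrite !lt0r_neq0.
have w0 (r : R) : 0 <= r <= T -> 0 < w r.
  move=> rT; have r0 : 0 <= r by case/andP: rT.
  by rewrite divr_gt0 ?exprn_gt0 ?c_gt0// mulr_gt0 ?exprn_gt0 ?b_gt0 ?E_gt0.
pose s r := W r * w r.
pose ds r := - (2 * b r * W r + 2 * c r * Y r) / eps * w r
  + W r * (kw r * w r).
have sd (r : R) : 0 <= r <= T -> is_derive r 1 s (ds r).
  by move=> rT; have [[_ _ dW] _] := der rT; exact: isder_mul (wd _ rT).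
have s0 (r : R) : 0 <= r <= T -> 0 <= s r.
  by move=> rT; have [_ W0' _ _ _] := pos rT; rewrite mulr_ge0// ltW// w0.
have step (r : R) : 0 <= r <= T ->
    eps * ds r <= b r * (2 * K * Num.sqrt (s r) - s r).
  move=> rT; have [_ _ X0 Z0 Q0] := pos rT; have [_ _ D0] := schwarz rT.
  have r0 : 0 <= r by case/andP: rT.
  have br := b_gt0 rT; have sr := s0 _ rT; have wr := w0 _ rT.
  have cr := c_gt0 rT.
  have ub : - (c r * Y r * w r) <= b r * K * Num.sqrt (s r).
    apply: le_trans (ler_norm _) _; rewrite normrN.
    rewrite -ler_sqr ?nnegrE ?mulr_ge0 ?sqrtr_ge0 ?(ltW br)//.
    rewrite real_normK ?num_real//.
    have -> : (b r * K * Num.sqrt (s r)) ^+ 2 = b r ^+ 2 * K ^+ 2 * s r.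
      by rewrite !exprMn sqr_sqrtr.
    have -> : (c r * Y r * w r) ^+ 2 = b r ^+ 2 * E q r * w r * Y r ^+ 2.
      by rewrite /w; field; rewrite lt0r_neq0.
    apply: (@le_trans _ _ (b r ^+ 2 * E q r * w r * (Q r * W r))).
      rewrite ler_wpM2l// mulr_ge0 ?(ltW wr)// mulr_ge0 ?sqr_ge0//.
      by rewrite ltW// E_gt0.
    have -> : b r ^+ 2 * E q r * w r * (Q r * W r)
      = b r ^+ 2 * s r * (Q r * E q r) by rewrite /s; ring.
    have -> : b r ^+ 2 * K ^+ 2 * s r = b r ^+ 2 * s r * K ^+ 2 by ring.
    by rewrite ler_wpM2l ?QK// mulr_ge0 ?sqr_ge0.
  have kb : eps * kw r <= b r.
    have /andP[i0 ib] := eps_inv1t r0.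
    have := kappa_small rT.
    rewrite -{1}(gtr0_norm eps0) -normrM => /normr_bounds[h1 _].
    have /andP[q0 q2] := q02; have /andP[p0 p1] := p01.
    have -> : eps * kw r = (q - 2 * p) * (eps * (1 + r)^-1) - 2 * (eps * kappa r).
      by rewrite /kw; field; rewrite lt0r_neq0// inv1t_pos.
    have : (q - 2 * p) * (eps * (1 + r)^-1) <= 2 * (eps * (1 + r)^-1).
      by rewrite ler_wpM2r//; lra.
    lra.
  have -> : eps * ds r = - 2 * b r * s r + 2 * (- (c r * Y r * w r))
     + eps * kw r * s r by rewrite /ds /s; field; rewrite lt0r_neq0.
  have := ler_wpM2r sr kb; lra.
have b0 (r : R) : 0 <= r <= T -> 0 <= b r by move=> /b_gt0/ltW.
have T0 : 0 <= (0 : R) <= T.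
  by case/andP: tT => t0 tT'; rewrite lexx (le_trans t0 tT').
have sL : s 0 <= L ^+ 2.
  rewrite /s /w /b !E_at0 expr1n !mul1r ler_pdivrMr ?exprn_gt0 ?c_gt0//.
have := relaxation eps0 K0 sd b0 s0 step KL sL tT.
by rewrite /s /w mulrA ler_pdivrMr// exprn_gt0// c_gt0.
Qed.

(** The weighted cross term [eps (1 + t)^p <u, u'>] replaces [eps u''] in the
equation tested with [u]. The corrections by [(1 + t)^(p - 1)] leave an error
with the sign of [U - M]. *)
Lemma norm_bound K : 0 <= K ->
  (forall t : R, 0 <= t <= T -> W t * (b t ^+ 2 * E q t) <= K * c t ^+ 2) ->
  eps * (K * M `^ (g - 1)) <= 1 ->
  eps * (M `^ (g - 1) * M ^+ 2) <= 1 ->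
  eps * M <= 1 ->
  forall t : R, 0 <= t <= T -> U t <= 4 * (U 0 + `|V 0| + 3).
Proof.
move=> K0 WK eK eM2 eM t tT.
have /andP[p0 p1] := p01.
have WE (r : R) (rT : 0 <= r <= T) := velocity_weight rT (WK r rT).
have eW (r : R) (rT : 0 <= r <= T) := kinetic_le_potential K0 rT (WK r rT) eK.
pose G r := eps * (E p r * V r) + 1 / 2 * U r
   - eps * p / 2 * (E (p - 1) r * U r) + eps * p * M / 2 * E (p - 1) r.
pose dG r := E p r * (eps * W r - c r * X r)
   - eps * p * (1 - p) / 2 * (E p r / (1 + r) ^+ 2) * (M - U r).
have Gt : G t <= G 0.
  apply: (@derive_le0_nonincreasing _ G dG); first by case/andP: tT.
    move=> r /andP[r0 rt].
    have rT : 0 <= r <= T by rewrite r0 (le_trans rt)//; case/andP: tT.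
    have [[dU dV _] _] := der rT; have r1 := inv1t_pos r0.
    have h := isder_add (isder_sub (isder_add
      (isder_scale eps (isder_mul (isder_1powR p r0) dV))
      (isder_scale (1 / 2) dU))
      (isder_scale (eps * p / 2) (isder_mul (isder_1powR (p - 1) r0) dU)))
      (isder_scale (eps * p * M / 2) (isder_1powR (p - 1) r0)).
    apply: (isder_eq h); rewrite /dG -/(E p r) -/(E (p - 1) r).
    have -> : E (p - 1) r = E p r / (1 + r) by rewrite /E (powR_pred p r1) mulfK ?lt0r_neq0.
    rewrite bE//; field; rewrite !lt0r_neq0//; exact: E_gt0.
  move=> r /andP[r0 rt].
  have rT : 0 <= r <= T by rewrite r0 (le_trans rt)//; case/andP: tT.
  have Er := E_gt0 p r0; have r1 := inv1t_pos r0.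
  rewrite /dG subr_le0; apply: (@le_trans _ _ 0).
    by rewrite mulr_ge0_le0 ?(ltW Er)// subr_le0 eW.
  rewrite mulr_ge0 ?subr_ge0 ?UM// mulr_ge0//.
    by rewrite !mulr_ge0 ?subr_ge0 ?(ltW eps0)//.
  by rewrite divr_ge0 ?sqr_ge0 ?(ltW Er).
have t0 : 0 <= t by case/andP: tT.
have [U0 W0 X0 _ _] := pos tT; have [VUW _ _] := schwarz tT.
have Et := E_gt0 p t0.
have e48 : eps <= 1 / 48 by case: d_small => h _; exact: le_trans epsd h.
have cross : eps * (E p t * `|V t|) <= U t / 8 + 2.
  have S : (eps * (E p t * `|V t|)) ^+ 2 <= U t * (eps ^+ 2 * E (2 * p) t * W t).
    rewrite !exprMn real_normK ?num_real//.
    rewrite [E p t ^+ 2]powR_sqr ?inv1t_pos// -/(E (2 * p) t).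
    have -> : U t * (eps ^+ 2 * E (2 * p) t * W t)
      = eps ^+ 2 * (E (2 * p) t * (U t * W t)) by ring.
    by rewrite ler_wpM2l ?sqr_ge0// ler_wpM2l// ltW// E_gt0.
  have S2 : eps ^+ 2 * E (2 * p) t * W t <= 1.
    have h1 := WE _ tT; have h2 := c_weight tT.
    have c0 := c_gt0 tT.
    have X2 := X_sqr_weight tT.
    have E2 := E_gt0 (2 * p) t0; have Eq := E_gt0 q t0.
    rewrite -(ler_pM2r Eq) mul1r -[leLHS]mulrA.
    apply: (@le_trans _ _ (eps ^+ 2 * E (2 * p) t *
       (K * (c t * E (2 * p) t) * c t))).
      by rewrite ler_wpM2l// mulr_ge0 ?sqr_ge0 ?(ltW E2).
    have -> : eps ^+ 2 * E (2 * p) t * (K * (c t * E (2 * p) t) * c t)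
      = eps ^+ 2 * K * (c t * E (2 * p) t) ^+ 2 by ring.
    apply: (@le_trans _ _ (eps ^+ 2 * K * (M `^ (g - 1) * E q t * X t) ^+ 2)).
      rewrite ler_wpM2l ?(mulr_ge0 (sqr_ge0 _))//.
      by rewrite ler_sqr ?nnegrE ?mulr_ge0 ?powR_ge0 ?(ltW c0) ?(ltW X0).
    have -> : eps ^+ 2 * K * (M `^ (g - 1) * E q t * X t) ^+ 2
      = eps * (K * M `^ (g - 1)) *
        (eps * (M `^ (g - 1) * (E q t * X t ^+ 2))) * E q t by ring.
    rewrite ler_piMl ?(ltW Eq)// mulr_ile1//.
    - by rewrite mulr_ge0 ?(ltW eps0)// mulr_ge0 ?powR_ge0.
    - by rewrite mulr_ge0 ?(ltW eps0)// mulr_ge0 ?powR_ge0// mulr_ge0 ?sqr_ge0 ?(ltW Eq).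
    - apply: le_trans eM2; rewrite ler_wpM2l ?(ltW eps0)//.
      by rewrite ler_wpM2l ?powR_ge0.
  have n0 : 0 <= eps * (E p t * `|V t|).
    by rewrite mulr_ge0 ?(ltW eps0)// mulr_ge0 ?(ltW Et).
  rewrite -ler_sqr ?nnegrE ?addr_ge0 ?divr_ge0//.
  apply: (le_trans S); apply: (@le_trans _ _ (U t)).
    by rewrite ler_piMr.
  have := sqr_ge0 (U t / 8 - 2).
  have -> : (U t / 8 + 2) ^+ 2 = (U t / 8 - 2) ^+ 2 + U t by field.
  lra.
have /andP[E10 E11] : 0 <= E (p - 1) t <= 1.
  by rewrite (ltW (E_gt0 _ _))//= powR_neg_le1 ?subr_le0// lerDl.
move: Gt; rewrite /G !E_at0 !mulr1 !mul1r => Gt.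
have ep0 : 0 <= eps * p by rewrite mulr_ge0 ?(ltW eps0).
have ep1 : eps * p <= eps by rewrite ler_piMr ?(ltW eps0).
have U00 : 0 <= U 0.
  by have [] := pos (_ : 0 <= 0 <= T) => //; rewrite lexx; case/andP: tT; exact: le_trans.
have h1 : eps * p / 2 * (E (p - 1) t * U t) <= 1 / 96 * U t.
  have : E (p - 1) t * U t <= U t by rewrite ler_piMl.
  have := mulr_ge0 E10 U0; set y := E _ _ * _ => y0 yU.
  have : eps * p * y <= 1 / 48 * y by rewrite ler_wpM2r//; lra.
  lra.
have h2 : 0 <= eps * p * M / 2 * E (p - 1) t.
  by rewrite mulr_ge0// divr_ge0// mulr_ge0// (le_trans _ M1).
have h3 : eps * p * M <= 1.
  apply: le_trans eM; rewrite -mulrA ler_wpM2l ?(ltW eps0)//.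
  by rewrite ler_piMl// (le_trans _ M1).
have h4 : eps * V 0 <= `|V 0|.
  apply: (@le_trans _ _ (eps * `|V 0|)).
    by rewrite ler_wpM2l ?(ltW eps0)// ler_norm.
  by rewrite ler_piMl//; lra.
have h5 : - (eps * (E p t * V t)) <= U t / 8 + 2.
  apply: le_trans cross; apply: le_trans (ler_norm _) _.
  by rewrite normrN !normrM (gtr0_norm eps0) (gtr0_norm Et).
have h6 : 0 <= eps * p / 2 * U 0 by rewrite mulr_ge0// divr_ge0.
have := normr_ge0 (V 0).
lra.
Qed.

(** [hyperbolic_decay] one order below, for the energy [eps W / c + X], with the
constant bound [N] of [|u|^2] as [x]. *)
Lemma X_decay K N C : 0 <= K -> 1 <= N ->
  (forall t : R, 0 <= t <= T -> W t * (b t ^+ 2 * E q t) <= K * c t ^+ 2) ->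
  (forall t : R, 0 <= t <= T -> U t <= N) ->
  eps * (K * M `^ (g - 1)) <= 1 ->
  64 * (eps * (M `^ (g - 1) * M ^+ 2)) <= 1 ->
  2 * (eps * W 0 / c 0 + X 0) <= C -> 0 < C ->
  (p + 1) / (g + 1) <= (1 / 2) `^ g / N / 8 * (1 / 2) `^ (g + 1) * C `^ (g + 1) ->
  forall t : R, 0 <= t <= T -> X t * E a t <= 2 * C.
Proof.
move=> K0 N1 WK UN eK eM2 FC C0 Cq t tT.
have g0 : 0 < g by apply: lt_le_trans g1.
have N0 : 0 < N by apply: lt_le_trans N1.
have /andP[p0 p1] := p01.
have eW (r : R) (rT : 0 <= r <= T) := kinetic_le_potential K0 rT (WK r rT) eK.
pose F0 r := eps * W r / c r + X r.
have F0X (r : R) : 0 <= r <= T -> X r <= F0 r /\ F0 r <= 2 * X r.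
  move=> rT; have cr := c_gt0 rT; have [_ W0 X0 _ _] := pos rT.
  have h1 : 0 <= eps * W r / c r.
    by rewrite divr_ge0 ?(ltW cr)// mulr_ge0 ?(ltW eps0).
  have h2 : eps * W r / c r <= X r by rewrite ler_pdivrMr// [leRHS]mulrC eW.
  by rewrite /F0; split; lra.
have XX (r : R) : 0 <= r <= T ->
    c r * E (2 * p) r * X r <= M `^ (g - 1) * M ^+ 2.
  move=> rT; have r0 : 0 <= r by case/andP: rT.
  have cr := c_gt0 rT; have [_ _ X0 _ _] := pos rT.
  apply: (le_trans (ler_wpM2r (ltW X0) (c_weight rT))).
  rewrite -!mulrA ler_wpM2l ?powR_ge0//.
  by rewrite -expr2 X_sqr_weight.
have sqle (r : R) x : 0 <= r -> 0 <= x -> x ^+ 2 * E (2 * p) r <= 1 / 64 * N ^+ 2 ->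
    x <= b r * N / 8.
  move=> r0 x0 h; rewrite -ler_sqr ?nnegrE//; last first.
    by rewrite divr_ge0// mulr_ge0 ?(ltW N0)// ltW// E_gt0.
  apply: le_trans (le_bb r0 h) _; rewrite le_eqVlt; apply/orP; left.
  by apply/eqP; field.
have MMp : 0 <= M `^ (g - 1) * M ^+ 2 by rewrite mulr_ge0 ?powR_ge0 ?sqr_ge0.
have h : F0 t * (1 + t) `^ ((p + 1) / (g + 1)) <= 2 * C; last first.
  apply: le_trans h; rewrite ler_wpM2r ?powR_ge0//.
  by have [] := F0X _ tT.
move: t tT.
apply: (@hyperbolic_decay _ eps T ((1 / 2) `^ g / N) (g + 1) p C b
  (fun t => - p / (1 + t) * b t) c kappa (fun=> N) (fun=> 0) V W X) => //.
- by rewrite divr_gt0 ?powR_gt0.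
- by rewrite addr_gt0.
- move=> t tT; have [_ W0 X0 _ _] := pos tT.
  by split=> //; [exact: b_gt0|exact: c_gt0|exact: ltW].
- move=> t tT; have [[dU dV dW] [dX _ _ _]] := der tT.
  have [_ _ X0 _ _] := pos tT.
  split=> //; [exact: b_der|exact: isder_cst|].
  have h := isder_add (isder_mul (isder_scale eps dW)
    (isder_inv (lt0r_neq0 (c_gt0 tT)) (c_der tT))) dX.
  apply: (isder_eq h); rewrite /kappa; field.
  by rewrite !lt0r_neq0// c_gt0.
- move=> t tT; have t0 : 0 <= t by case/andP: tT.
  have [U0 W0 X0 _ _] := pos tT; have [VUW _ _] := schwarz tT.
  have ct := c_gt0 tT.
  split; [exact: kappa_small| |exact: db_small|].
    by rewrite normr0 mulr0 divr_ge0// mulr_ge0 ?(ltW N0)// ltW// E_gt0.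
  apply: sqle => //; first by rewrite mulr_ge0 ?(ltW eps0).
  rewrite exprMn real_normK ?num_real//.
  apply: (@le_trans _ _ (eps ^+ 2 * (N * W t) * E (2 * p) t)).
    rewrite ler_wpM2r ?(ltW (E_gt0 _ _))// ler_wpM2l ?sqr_ge0//.
    by apply: le_trans VUW _; rewrite ler_wpM2r// UN.
  have -> : eps ^+ 2 * (N * W t) * E (2 * p) t
    = N * (eps * (eps * W t * E (2 * p) t)) by ring.
  have : eps * (eps * W t * E (2 * p) t) <= 1 / 64.
    apply: (@le_trans _ _ (eps * (M `^ (g - 1) * M ^+ 2))).
      rewrite ler_wpM2l ?(ltW eps0)//; apply: le_trans (XX _ tT).
      by rewrite [leRHS]mulrAC ler_wpM2r ?eW// ltW// E_gt0.
    lra.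
  move=> /(ler_wpM2l (ltW N0)) h; apply: (le_trans h).
  have : N <= N * N by rewrite ler_peMl ?(ltW N0).
  by rewrite expr2; lra.
- move=> t tT; have t0 : 0 <= t by case/andP: tT.
  have [U0 W0 X0 _ _] := pos tT; have [VUW _ _] := schwarz tT.
  have ct := c_gt0 tT; have [F1 F2] := F0X _ tT.
  split; last by apply: le_trans VUW _; rewrite ler_wpM2r// UN.
  rewrite -/(F0 t) -[leRHS]mulrA; apply: le_bb => //.
  apply: (@le_trans _ _ (2 * (eps * (M `^ (g - 1) * M ^+ 2)))); last lra.
  have -> : eps * c t * F0 t * E (2 * p) t
    = eps * (c t * E (2 * p) t * F0 t) by ring.
  rewrite [leRHS]mulrCA ler_wpM2l ?(ltW eps0)//.
  apply: le_trans (ler_wpM2l (ler0n _ 2) (XX _ tT)); rewrite [leRHS]mulrCA.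
  by rewrite ler_wpM2l// mulr_ge0 ?(ltW ct)// ltW// E_gt0.
move=> t tT; have t0 : 0 <= t by case/andP: tT.
have [U0 W0 X0 _ _] := pos tT; have ct := c_gt0 tT; have [F1 F2] := F0X _ tT.
change ((1 / 2) `^ g / N * E p t * (F0 t `^ (g + 1) * F0 t)
  <= c t * F0 t ^+ 2 / (b t * N)).
have Fp : 0 < F0 t by apply: lt_le_trans F1.
have Ep := E_gt0 p t0.
have -> : c t * F0 t ^+ 2 / (b t * N) = E p t / N * F0 t ^+ 2 * c t.
  by rewrite bE//; field; rewrite !lt0r_neq0.
have -> : (1 / 2) `^ g / N * E p t * (F0 t `^ (g + 1) * F0 t)
  = E p t / N * F0 t ^+ 2 * ((1 / 2) `^ g * F0 t `^ g).
  by rewrite (powR_succ _ Fp); ring.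
rewrite ler_wpM2l ?mulr_ge0 ?invr_ge0 ?(ltW Ep) ?(ltW N0) ?(ltW Fp)//.
rewrite -powRM ?(ltW Fp)// powR_mono ?(ltW g0) ?mulr_ge0 ?(ltW Fp)//.
by rewrite mul1r mulrC ler_pdivrMr// mulrC.
Qed.

(** Closing the bootstrap: the decay of the energy turns the a priori
slowness of [X] into a bound that carries a factor [eps]. *)
Lemma slow_improved K L : 0 <= K -> 2 * K <= L ->
  (forall t : R, 0 <= t <= T -> F t * E q t <= K) ->
  `|Y 0| <= L * c 0 -> eps * (L * M `^ (g - 1)) <= d / 2 ->
  forall t : R, 0 <= t <= T -> eps * `|Y t| <= d / 2 * b t * X t.
Proof.
move=> K0 KL FK Y0 eL t tT.
pose w s := b s * X s * E q s / c s.
pose kw s := - p / (1 + s) + q / (1 + s) + 2 * (Y s / X s) - kappa s.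
have w0 (r : R) : 0 <= r <= T -> 0 < w r.
  move=> rT; have r0 : 0 <= r by case/andP: rT.
  have [_ _ X0 _ _] := pos rT.
  by rewrite divr_gt0 ?c_gt0// !mulr_gt0// ?E_gt0// b_gt0.
have T0 : 0 <= (0 : R) <= T.
  by case/andP: tT => t0 tT'; rewrite lexx (le_trans t0 tT').
have h : `|Y t / X t| * w t <= L.
  apply: (@log_derivative_bound w kw K) => //.
  - move=> r rT; have r0 : 0 <= r by case/andP: rT.
    have [_ _ X0 _ _] := pos rT; have r1 := inv1t_pos r0.
    have cr := c_gt0 rT; have [_ [dX _ _ _]] := der rT.
    have h := isder_mul (isder_mul (isder_mul (b_der rT) dX)
      (isder_1powR q r0)) (isder_inv (lt0r_neq0 cr) (c_der rT)).
    apply: (isder_eq h); rewrite /kw /w /kappa -/(E q r).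
    by field; rewrite !lt0r_neq0.
  - move=> r rT; have r0 : 0 <= r by case/andP: rT.
    have /andP[i0 ib] := eps_inv1t r0.
    have := kappa_small rT.
    rewrite -{1}(gtr0_norm eps0) -normrM => /normr_bounds[h1 _].
    have [_ h2] := rho_bounds rT; have br := b_gt0 rT.
    have h3 : d * b r <= 1 / 48 * b r by rewrite ler_pM2r//; case: d_small.
    have /andP[q0 q2] := q02; have /andP[p0 p1] := p01.
    have [_ _ X0 _ _] := pos rT.
    have -> : eps * kw r = (q - p) * (eps * (1 + r)^-1)
       + 2 * (eps * (Y r / X r)) - (eps * kappa r).
      by rewrite /kw; field; rewrite !lt0r_neq0// inv1t_pos.
    have : (q - p) * (eps * (1 + r)^-1) <= 2 * (eps * (1 + r)^-1).
      by rewrite ler_wpM2r//; lra.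
    lra.
  - move=> r rT; have r0 : 0 <= r by case/andP: rT.
    have cr := c_gt0 rT; have br := b_gt0 rT; have Er := E_gt0 q r0.
    have -> : c r * Rf r * w r = X r * Rf r * E q r * b r.
      by rewrite /w; field; rewrite lt0r_neq0.
    rewrite ler_pM2r//; apply: le_trans (FK _ rT).
    by rewrite ler_pM2r// XRf_le.
  have [_ _ X0 _ _] := pos T0.
  rewrite /w /b !E_at0 mul1r mulr1 normrM normfV (gtr0_norm X0).
  rewrite mulrA divfK ?lt0r_neq0// ler_pdivrMr ?c_gt0//.
have [_ _ X0 _ _] := pos tT; have t0 : 0 <= t by case/andP: tT.
have ct := c_gt0 tT; have bt := b_gt0 tT; have Et := E_gt0 q t0.
move: h; rewrite normrM normfV (gtr0_norm X0) /w.
have -> : `|Y t| / X t * (b t * X t * E q t / c t) = `|Y t| * (b t * E q t) / c t.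
  by field; rewrite !lt0r_neq0.
rewrite ler_pdivrMr// => h.
rewrite -(ler_pM2r (mulr_gt0 bt Et)).
apply: (@le_trans _ _ (eps * (L * c t))).
  by rewrite -mulrA ler_wpM2l ?(ltW eps0).
have L0 : 0 <= L by apply: le_trans KL; rewrite mulr_ge0.
have cw : c t <= b t ^+ 2 * (M `^ (g - 1) * E q t * X t).
  by apply: le_bb => //; exact: c_weight.
apply: (@le_trans _ _ (eps * (L * (b t ^+ 2 * (M `^ (g - 1) * E q t * X t))))).
  by rewrite ler_wpM2l ?(ltW eps0)// ler_wpM2l.
have -> : eps * (L * (b t ^+ 2 * (M `^ (g - 1) * E q t * X t)))
  = eps * (L * M `^ (g - 1)) * (b t ^+ 2 * E q t * X t) by ring.
have -> : d / 2 * b t * X t * (b t * E q t) = d / 2 * (b t ^+ 2 * E q t * X t).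
  by ring.
by rewrite ler_wpM2r// !mulr_ge0 ?sqr_ge0 ?(ltW Et) ?(ltW X0) ?(ltW bt).
Qed.

(** The bounds that come out depend on the data only; [M] enters through products
with [eps], which are assumed to be small. *)
Lemma bootstrap_improvement (x0 K K1 K2 C1 CF KW L4 L5 N CX : R) :
  0 < x0 -> 1 <= K -> x0 <= X 0 -> 0 <= T ->
  [/\ U 0 <= K, W 0 <= K, X 0 <= K, Z 0 <= K & Q 0 <= K] ->
  K ^+ 2 / (x0 `^ g * x0 ^+ 2) + K / x0 <= K1 ->
  2 * K1 + K / (x0 `^ g * x0) <= K2 ->
  [/\ 0 < C1, C1 <= x0 & 2 * K2 * C1 `^ g <= q] ->
  2 * (K / x0 `^ g + K) <= CF ->
  q <= (K1 + K2) `^ (1 - g) / 8 * (1 / 2) `^ g * CF `^ g ->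
  0 <= KW -> 2 * CF <= KW ^+ 2 -> 2 * KW + K / x0 `^ g <= L4 ->
  4 * CF + K / x0 `^ g <= L5 -> 4 * (2 * K + 3) <= N ->
  2 * (K / x0 `^ g + K) <= CX ->
  (p + 1) / (g + 1) <= (1 / 2) `^ g / N / 8 * (1 / 2) `^ (g + 1) * CX `^ (g + 1) ->
  64 * (eps * (M `^ (g - 1) * M ^+ 2)) <= 1 ->
  eps * (L4 ^+ 2 * M `^ (g - 1)) <= 1 ->
  eps * (L5 * M `^ (g - 1)) <= d / 2 ->
  [/\ eps * `|Y T| <= d / 2 * b T * X T, C1 <= X T * E q T,
      X T * E a T <= 2 * CX, F T * E q T <= 2 * CF & U T <= N] /\
  W T * (b T ^+ 2 * E q T) <= L4 ^+ 2 * c T ^+ 2.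
Proof.
move=> x00 K_1 x0X T0 [U0K W0K X0K Z0K Q0K] HK1 HK2 [C10 C1x C1q] HCF HCF2 KW0
  HKW HL4 HL5 HN HCX HCX2 e1 e2 e3.
have g0 : 0 < g by apply: lt_le_trans g1.
have K0 : 0 < K by apply: lt_le_trans K_1.
have II : 0 <= (0 : R) <= T by rewrite lexx.
have TT : 0 <= T <= T by rewrite lexx T0.
have cx0 : 0 < x0 `^ g by rewrite powR_gt0.
have ccx : x0 `^ g <= c 0 by rewrite powR_mono ?(ltW g0) ?(ltW x00).
have [U0 W0 X0 Z0 Q0] := pos II; have [VUW YXZ _] := schwarz II.
have c0 := c_gt0 II.
have eps1 : eps <= 1.
  by case: d_small => h _; apply: (le_trans epsd); apply: (le_trans h); lra.
have sqK (y z w : R) : 0 <= z <= K -> 0 <= w <= K -> y ^+ 2 <= z * w -> `|y| <= K.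
  move=> /andP[z0 zK] /andP[w0 wK] h.
  rewrite -ler_sqr ?nnegrE ?(ltW K0)// real_normK ?num_real//.
  by apply: (le_trans h); rewrite expr2 ler_pM.
have VK : `|V 0| <= K by apply: (sqK _ (U 0) (W 0)) => //; apply/andP.
have YK : `|Y 0| <= K.
  by apply: (sqK _ (X 0) (Z 0)) => //; apply/andP; split=> //; exact: ltW.
have Kc : K / c 0 <= K / x0 `^ g by rewrite ler_pM2l// lef_pV2.
have A1 : 0 <= K ^+ 2 / (x0 `^ g * x0 ^+ 2) + K / x0.
  rewrite addr_ge0// divr_ge0 ?sqr_ge0 ?(ltW K0) ?(ltW x00)//.
  by rewrite mulr_ge0 ?sqr_ge0 ?(ltW cx0).
have K10 : 0 <= K1 by exact: le_trans HK1.
have A2 : 0 < K / (x0 `^ g * x0) by rewrite divr_gt0 ?mulr_gt0.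
have A3 : 0 < K / x0 `^ g by rewrite divr_gt0.
have [[K20 KK2 A2K] [CF0 L40 KWL A3L] [CFL A3L5 N1 CX0]] :=
  bootstrap_constants K0 K10 A2 A3 HK2 HCF KW0 HL4 HL5 HN HCX.
have R0 : Rf 0 <= K1.
  apply: le_trans HK1; rewrite lerD//.
    rewrite ler_pM ?invr_ge0//.
    - by rewrite mulr_ge0 ?(ltW eps0)// subr_ge0.
    - by rewrite mulr_ge0 ?sqr_ge0 ?(ltW c0).
    - have D0 : 0 <= X 0 * Z 0 - Y 0 ^+ 2 by rewrite subr_ge0.
      apply: (@le_trans _ _ (X 0 * Z 0 - Y 0 ^+ 2)); first by rewrite ler_piMl.
      apply: (@le_trans _ _ (X 0 * Z 0)); first by rewrite gerBl sqr_ge0.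
      by rewrite expr2 ler_pM ?(ltW X0).
    rewrite lef_pV2 ?posrE ?mulr_gt0 ?exprn_gt0// ler_pM ?(ltW cx0) ?sqr_ge0//.
    by rewrite ler_sqr ?nnegrE ?(ltW x00) ?(ltW X0).
  by rewrite ler_pM ?invr_ge0 ?(ltW X0)// lef_pV2.
have HR := dirichlet_quotient_bound R0.
have K12 : 0 < K1 + K2 by rewrite ltr_wpDl.
have Hrho : forall t : R, 0 <= t <= T -> `|Y t / X t| * (b t / c t) <= K2.
  apply: (@log_derivative_bound _ (fun t => - p / (1 + t) - kappa t) K1) => //.
  - by move=> t tT; rewrite divr_gt0 ?b_gt0 ?c_gt0.
  - move=> t tT; have t0 : 0 <= t by case/andP: tT.
    have ct := c_gt0 tT; have [_ _ Xt _ _] := pos tT.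
    have h := isder_mul (b_der tT) (isder_inv (lt0r_neq0 ct) (c_der tT)).
    apply: (isder_eq h); rewrite /kappa.
    by field; rewrite !lt0r_neq0// inv1t_pos.
  - move=> t tT; have t0 : 0 <= t by case/andP: tT.
    have /andP[i0 ib] := eps_inv1t t0; have bt := b_gt0 tT.
    have := kappa_small tT.
    rewrite -{1}(gtr0_norm eps0) -normrM => /normr_bounds[h1 _].
    have -> : eps * (- p / (1 + t) - kappa t)
      = - (p * (eps * (1 + t)^-1)) - eps * kappa t.
      by field; rewrite lt0r_neq0// inv1t_pos.
    have : 0 <= p * (eps * (1 + t)^-1) by rewrite mulr_ge0//; case/andP: p01.
    lra.
  - move=> t tT; have ct := c_gt0 tT; have bt := b_gt0 tT.
    have -> : c t * Rf t * (b t / c t) = Rf t * b t by field; rewrite lt0r_neq0.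
    by rewrite ler_pM2r// HR.
  - rewrite /b !E_at0 mul1r normrM normfV (gtr0_norm X0).
    apply: (@le_trans _ _ (K / (x0 `^ g * x0))); last exact: A2K.
    rewrite -mulrA -invfM ler_pM ?invr_ge0 ?mulr_ge0 ?(ltW X0) ?(ltW c0)//.
    rewrite lef_pV2 ?posrE ?mulr_gt0// mulrC ler_pM ?(ltW cx0) ?(ltW x00)//.
have HFX := energy_le_X HR Hrho.
have F0le : F 0 <= K / x0 `^ g + K.
  rewrite /F lerD// ler_pM ?invr_ge0 ?mulr_ge0 ?(ltW eps0) ?(ltW c0)//.
    by rewrite -[leRHS]mul1r ler_pM ?(ltW eps0).
  by rewrite lef_pV2.
have e4 : 8 * eps * (M `^ (g - 1) * M) <= 1.
  apply: le_trans e1; rewrite -mulrA.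
  have h : eps * (M `^ (g - 1) * M) <= eps * (M `^ (g - 1) * M ^+ 2).
    rewrite ler_wpM2l ?(ltW eps0)// ler_wpM2l ?powR_ge0// expr2.
    by rewrite ler_peMl// (le_trans _ M1).
  have h0 : 0 <= eps * (M `^ (g - 1) * M).
    by rewrite !mulr_ge0 ?powR_ge0 ?(ltW eps0) ?(le_trans _ M1).
  by apply: ler_pM => //; rewrite ler_nat.
have HF : forall t : R, 0 <= t <= T -> F t * E q t <= 2 * CF.
  apply: (energy_decay K12 HFX e4) => //.
  by apply: le_trans HCF; rewrite ler_pM2l.
have HQ (t : R) : 0 <= t <= T -> Q t * E q t <= KW ^+ 2.
  move=> tT; apply: le_trans HKW; apply: le_trans (HF _ tT).
  have t0 : 0 <= t by case/andP: tT.
  rewrite ler_pM2r ?E_gt0// /F lerDr divr_ge0 ?(ltW (c_gt0 tT))//.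
  by have [_ _ _ Zt _] := pos tT; rewrite mulr_ge0 ?(ltW eps0).
have HW : forall t : R, 0 <= t <= T -> W t * (b t ^+ 2 * E q t) <= L4 ^+ 2 * c t ^+ 2.
  apply: (velocity_bound KW0) => //.
  rewrite -exprMn.
  apply: (@le_trans _ _ (K ^+ 2)).
    by apply: (le_trans W0K); rewrite expr2 ler_peMl// ltW.
  rewrite ler_sqr ?nnegrE ?(ltW K0) ?mulr_ge0 ?(ltW c0)//.
  apply: (@le_trans _ _ (K / x0 `^ g * x0 `^ g)).
    by rewrite divfK// lt0r_neq0.
  exact: ler_pM (ltW A3) (ltW cx0) A3L ccx.
have e5 : eps * (M `^ (g - 1) * M ^+ 2) <= 1.
  have h0 : 0 <= eps * (M `^ (g - 1) * M ^+ 2).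
    by rewrite mulr_ge0 ?(ltW eps0)// mulr_ge0 ?powR_ge0 ?sqr_ge0.
  by apply: le_trans e1; rewrite ler_peMl// ler1n.
have e6 : eps * M <= 1.
  apply: le_trans e5; rewrite ler_wpM2l ?(ltW eps0)//.
  apply: (@le_trans _ _ (1 * M ^+ 2)).
    by rewrite mul1r expr2 ler_peMl// (le_trans _ M1).
  by rewrite ler_wpM2r ?sqr_ge0// powR_ge1// subr_ge0.
have HU (t : R) : 0 <= t <= T -> U t <= N.
  move=> tT; apply: (le_trans (norm_bound (sqr_ge0 L4) HW e2 e5 e6 tT)).
  apply: le_trans HN; rewrite ler_pM2l// lerD2r mulr_natl mulr2n; exact: lerD.
have HX : forall t : R, 0 <= t <= T -> X t * E a t <= 2 * CX.
  apply: (@X_decay (L4 ^+ 2) N) => //.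
  - exact: sqr_ge0.
  - have h : eps * W 0 / c 0 <= K / x0 `^ g.
      apply: le_trans Kc; rewrite ler_pM2r ?invr_gt0//.
      by rewrite -[leRHS]mul1r ler_pM ?(ltW eps0).
    by apply: le_trans HCX; rewrite ler_pM2l// lerD.
split; last exact: HW.
split.
- apply: (@slow_improved (2 * CF) L5) => //.
  + by rewrite mulr_ge0 ?(ltW CF0).
  + apply: (le_trans YK); apply: (@le_trans _ _ (K / x0 `^ g * x0 `^ g)).
      by rewrite divfK// lt0r_neq0.
    exact: ler_pM (ltW A3) (ltW cx0) A3L5 ccx.
- by apply: (X_lower_bound K20 Hrho) => //; exact: le_trans x0X.
- exact: HX.
- exact: HF.
- exact: HU.
Qed.

End EnergyEstimates.

(** * Global a priori estimates *)

Section Bootstrap.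
Context {R : realType}.

(** The quadratic quantities of a solution: [U, V, W] stand for [|u|^2],
[<u, u'>], [|u'|^2], and [X, Y, Z, Q] for [|A^(1/2) u|^2], [<A u, u'>],
[|A^(1/2) u'|^2], [|A u|^2]. They obey a closed differential system. *)
Record energy_system (p eps : R) (c U V W X Y Z Q dQ : R -> R) : Prop := {
  es_pos : forall t : R, 0 <= t ->
    [/\ 0 <= U t, 0 <= W t, 0 <= X t, 0 <= Z t & 0 <= Q t];
  es_schwarz : forall t : R, 0 <= t ->
    [/\ V t ^+ 2 <= U t * W t, Y t ^+ 2 <= X t * Z t & Y t ^+ 2 <= Q t * W t];
  es_der : forall t : R, 0 <= t ->
    [/\ is_derive t 1 U (2 * V t),
        is_derive t 1 V (W t - ((1 + t) `^ (- p) * V t + c t * X t) / eps) &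
        is_derive t 1 W (- (2 * (1 + t) `^ (- p) * W t + 2 * c t * Y t) / eps)] /\
    [/\ is_derive t 1 X (2 * Y t),
        is_derive t 1 Y (Z t - ((1 + t) `^ (- p) * Y t + c t * Q t) / eps),
        is_derive t 1 Z (- (2 * (1 + t) `^ (- p) * Z t + c t * dQ t) / eps) &
        is_derive t 1 Q (dQ t)] }.

Lemma power_threshold (y k m : R) : 0 <= y -> 0 < k -> 0 < m ->
  exists2 C : R, 0 < C & forall D, C <= D -> y <= k * D `^ m.
Proof.
move=> y0 k0 m0; exists (((y + 1) / k) `^ m^-1).
  by rewrite powR_gt0// divr_gt0// ltr_wpDl.
move=> D CD.
have h : 0 <= (y + 1) / k by rewrite divr_ge0 ?addr_ge0 ?(ltW k0).
apply: (@le_trans _ _ (k * (((y + 1) / k) `^ m^-1) `^ m)); last first.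
  by rewrite ler_wpM2l ?(ltW k0)// powR_mono ?(ltW m0) ?powR_ge0.
rewrite -powRrM mulVf ?gt_eqF// powRr1// mulrC divfK ?gt_eqF//.
by rewrite lerDl.
Qed.

Lemma power_threshold_small (y k m x : R) : 0 < y -> 0 < k -> 0 < m -> 0 < x ->
  exists C : R, [/\ 0 < C, C <= x & k * C `^ m <= y].
Proof.
move=> y0 k0 m0 x0; exists (Num.min x ((y / k) `^ m^-1)).
have h : 0 < (y / k) `^ m^-1 by rewrite powR_gt0// divr_gt0.
split; [by rewrite lt_min x0|by rewrite ge_min lexx|].
apply: (@le_trans _ _ (k * ((y / k) `^ m^-1) `^ m)).
  rewrite ler_wpM2l ?(ltW k0)// powR_mono ?(ltW m0)//.
    by rewrite le_min (ltW x0) (ltW h).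
  by rewrite ge_min lexx orbT.
rewrite -powRrM mulVf ?gt_eqF// powRr1 ?divr_ge0 ?(ltW y0) ?(ltW k0)//.
by rewrite mulrC divfK ?gt_eqF.
Qed.

Lemma continuous_powR_at (f : R -> R) (a t : R) : 0 < f t ->
  {for t, continuous f} -> {for t, continuous (fun s => f s `^ a)}.
Proof.
move=> ft0 fc.
apply: (@continuous_comp _ _ _ f (fun x : R => x `^ a)) => //.
exact: is_derive_continuous (is_derive1_powR a ft0).
Qed.

(** By the continuity method, since [bootstrap_improvement] improves each of the
five bounds in [good]. All constants are fixed before [eps]. Asking for
[c = X^g] only while [X <= M] admits coefficients that are cut off at a high
level. *)
Theorem uniform_energy_estimates (g p x0 K : R) : 1 <= g -> 0 <= p <= 1 ->
  2 * p <= (p + 1) / g + (p + 1) / (g + 1) * (g - 1) -> 0 < x0 -> 1 <= K ->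
  exists eps0 M C1 C2 : R, [/\ 0 < eps0, 1 <= M, 0 < C1 & 0 < C2] /\
  forall (eps : R) (c U V W X Y Z Q dQ : R -> R), 0 < eps < eps0 ->
  energy_system p eps c U V W X Y Z Q dQ ->
  (forall t : R, 0 <= t -> X t <= M -> c t = X t `^ g) ->
  x0 <= X 0 -> [/\ U 0 <= K, W 0 <= K, X 0 <= K, Z 0 <= K & Q 0 <= K] ->
  forall t : R, 0 <= t ->
  [/\ X t <= M, C1 <= X t * (1 + t) `^ ((p + 1) / g),
      X t * (1 + t) `^ ((p + 1) / (g + 1)) <= C2,
      (eps * Z t / c t + Q t) * (1 + t) `^ ((p + 1) / g) <= C2 &
      W t * (1 + t) `^ ((p + 1) / g + 2 * ((p + 1) / (g + 1)) * g - 2 * p) <= C2].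
Proof.
move=> g1 p01 pc x00 K1'; have /andP[p0 p1] := p01.
have g0 : 0 < g by apply: lt_le_trans g1.
have K0 : 0 < K by apply: lt_le_trans K1'.
have cx0 : 0 < x0 `^ g by rewrite powR_gt0.
set q := (p + 1) / g; set a := (p + 1) / (g + 1).
have q0 : 0 < q by rewrite divr_gt0// ltr_wpDl.
have a0 : 0 < a by rewrite divr_gt0 ?(addr_gt0 g0)// ltr_wpDl.
pose K1 := K ^+ 2 / (x0 `^ g * x0 ^+ 2) + K / x0.
have K1p : 0 < K1 by rewrite addr_gt0 ?divr_gt0 ?mulr_gt0 ?exprn_gt0.
pose K2 := 2 * K1 + K / (x0 `^ g * x0).
have K2p : 0 < K2 by rewrite addr_gt0 ?divr_gt0 ?mulr_gt0.
have Kcp : 0 < K / x0 `^ g by rewrite divr_gt0.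
have [C1 C1P] : exists C : R, [/\ 0 < C, C <= x0 & 2 * K2 * C `^ g <= q].
  by apply: power_threshold_small => //; rewrite mulr_gt0.
have C10 : 0 < C1 by case: C1P.
have kF : 0 < (K1 + K2) `^ (1 - g) / 8 * (1 / 2) `^ g.
  by rewrite mulr_gt0 ?powR_gt0// divr_gt0// powR_gt0// addr_gt0.
have [CF0 _ HCF0] := power_threshold (ltW q0) kF g0.
pose CF := Num.max CF0 (2 * (K / x0 `^ g + K)).
have CFp : 0 < CF by rewrite lt_max mulr_gt0 ?orbT// addr_gt0.
pose KW := Num.sqrt (2 * CF).
have KW2 : KW ^+ 2 = 2 * CF by rewrite sqr_sqrtr// mulr_ge0 ?(ltW CFp).
have KW0 : 0 <= KW by exact: sqrtr_ge0.
pose L4 := 2 * KW + K / x0 `^ g.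
have L4p : 0 < L4 by rewrite ltr_wpDl// mulr_ge0.
pose L5 := 4 * CF + K / x0 `^ g.
have L5p : 0 < L5 by rewrite addr_gt0// mulr_gt0.
pose N := 4 * (2 * K + 3).
have Np : 0 < N by rewrite mulr_gt0// addr_gt0// mulr_gt0.
have kX : 0 < (1 / 2) `^ g / N / 8 * (1 / 2) `^ (g + 1).
  by rewrite mulr_gt0 ?powR_gt0// !divr_gt0// powR_gt0.
have g10 : 0 < g + 1 by rewrite addr_gt0.
have [CX0 _ HCX0] := power_threshold (ltW a0) kX g10.
pose CX := Num.max CX0 (2 * (K / x0 `^ g + K)).
have CXp : 0 < CX by rewrite lt_max mulr_gt0 ?orbT// addr_gt0.
pose M := 1 + 2 * CF + 2 * CX + N.
have [M1 MCF MCX MN] : [/\ 1 <= M, 2 * CF < M, 2 * CX < M & N < M].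
  by clear -CFp CXp Np; rewrite /M; split; lra.
have C12 : C1 / 2 < C1 by clear -C10; lra.
have HK : 2 * (K / x0 `^ g + K) <= CF by rewrite le_max lexx orbT.
have HK' : 2 * (K / x0 `^ g + K) <= CX by rewrite le_max lexx orbT.
have KCF : K / x0 `^ g + K <= 2 * CF by clear -HK K0 Kcp; lra.
have KCX : K <= 2 * CX by clear -HK' K0 Kcp; lra.
have KN : K <= N by clear -K0; rewrite /N; lra.
pose d := (16 * (g + 2))^-1.
have g2 : 0 < 16 * (g + 2) by rewrite mulr_gt0// addr_gt0.
have d0 : 0 < d by rewrite invr_gt0.
have dE : 16 * (g + 2) * d = 1 by rewrite mulfV// gt_eqF.
have d1 : d <= 1.
  by rewrite invf_le1//; clear -g1; lra.
have d2 : d / 2 < d by clear -d0; lra.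
pose Mg := M `^ (g - 1).
have Mg0 : 0 < Mg by rewrite powR_gt0// (lt_le_trans ltr01).
pose S1 := 64 * (Mg * M ^+ 2).
have M0 : 0 < M by apply: lt_le_trans M1.
have S1p : 0 < S1 by rewrite mulr_gt0// mulr_gt0// exprn_gt0.
pose S2 := L4 ^+ 2 * Mg.
have S2p : 0 < S2 by rewrite mulr_gt0// exprn_gt0.
pose S3 := L5 * Mg * (2 / d).
have S3p : 0 < S3 by rewrite !mulr_gt0// invr_gt0.
pose S4 := 2 * K / (d * x0).
have S4p : 0 < S4 by rewrite divr_gt0 ?mulr_gt0.
pose S := d^-1 + S1 + S2 + S3 + S4.
have dV : 0 < d^-1 by rewrite invr_gt0.
have Sp : 0 < S by rewrite !addr_gt0.
have [dS S1S S2S S3S S4S] : [/\ d^-1 <= S, S1 <= S, S2 <= S, S3 <= S & S4 <= S].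
  by clear -dV S1p S2p S3p S4p; rewrite /S; split; lra.
pose C2 := 2 * CF + 2 * CX + L4 ^+ 2 * ((2 * CX) `^ g) ^+ 2.
have L0 : 0 <= L4 ^+ 2 * ((2 * CX) `^ g) ^+ 2 by rewrite mulr_ge0 ?sqr_ge0.
have C2p : 0 < C2.
  by clear -L0 CFp CXp; rewrite /C2; lra.
have [C2CF C2CX C2L] : [/\ 2 * CF <= C2, 2 * CX <= C2 &
    L4 ^+ 2 * ((2 * CX) `^ g) ^+ 2 <= C2].
  by clear -L0 CFp CXp; rewrite /C2; split; lra.
exists S^-1, M, C1, C2; split; first by rewrite invr_gt0.
move=> eps c U V W X Y Z Q dQ /andP[eps0 epsS] sys cX x0X0 init.
have eS : eps * S <= 1 by rewrite -ler_pdivlMr// div1r ltW.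
have part s : 0 < s -> s <= S -> eps * s <= 1.
  by move=> _ sS; apply: le_trans eS; rewrite ler_wpM2l ?(ltW eps0).
have ed : eps <= d.
  by have := part _ dV dS; rewrite ler_pdivrMr// mul1r.
have e1 : 64 * (eps * (M `^ (g - 1) * M ^+ 2)) <= 1.
  by rewrite mulrCA; exact: part S1S.
have e2 : eps * (L4 ^+ 2 * M `^ (g - 1)) <= 1.
  exact: part S2S.
have e3 : eps * (L5 * M `^ (g - 1)) <= d / 2.
  have h : eps * S3 <= 1 by exact: part S3S.
  have -> : eps * (L5 * M `^ (g - 1)) = eps * S3 * (d / 2).
    by rewrite /S3 /Mg; field; rewrite gt_eqF.
  by rewrite ler_piMl// divr_ge0 ?(ltW d0).
have e4 : 2 * (eps * K) <= d * x0.
  have h : eps * S4 <= 1 by exact: part S4S.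
  move: h; rewrite /S4 mulrA ler_pdivrMr ?mulr_gt0// mul1r.
  by apply: le_trans; rewrite mulrCA.
pose b t : R := (1 + t) `^ (- p); pose E r t : R := (1 + t) `^ r.
have Ep r (t : R) : 0 <= t -> 0 < E r t by move=> t0; rewrite powR_gt0// ltr_pwDl.
pose good t := [/\ eps * `|Y t| <= d * b t * X t, 0 < X t, X t * E a t <= M,
  (eps * Z t / X t `^ g + Q t) * E q t <= M & U t <= M].
have improve (T : R) : 0 <= T -> (forall t : R, 0 <= t <= T -> good t) ->
  [/\ eps * `|Y T| <= d / 2 * b T * X T, C1 <= X T * E q T,
      X T * E a T <= 2 * CX, (eps * Z T / X T `^ g + Q T) * E q T <= 2 * CF & U T <= N] /\
  W T * (b T ^+ 2 * E q T) <= L4 ^+ 2 * (X T `^ g) ^+ 2.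
  move=> T0 G.
  apply: (@bootstrap_improvement _ g p eps d T M U V W X Y Z Q dQ
    _ _ _ _ _ _ _ _ _ _ _ _ _ _ _ x0 K K1 K2 C1 CF KW L4 L5 N CX) => //.
  - by move=> t tT; have [_ ? _ _ _] := G _ tT; case/andP: tT => t0 _;
      have [] := es_pos sys t0.
  - by move=> t /andP[t0 _]; exact: es_schwarz sys _ t0.
  - move=> t tT; have [_ X0 XM _ _] := G _ tT; case/andP: tT => t0 _.
    rewrite -cX//; first exact: es_der sys _ t0.
    apply: le_trans XM; rewrite ler_peMr ?(ltW X0)// powR_ge1 ?(ltW a0)//.
    by rewrite lerDl.
  - by move=> t tT; have [] := G _ tT.
  - by move=> t tT; have [] := G _ tT.
  - by move=> t tT; have [] := G _ tT.
  - by move=> t tT; have [] := G _ tT.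
  - by apply: HCF0; rewrite le_max lexx.
  - by rewrite KW2.
  - by apply: HCX0; rewrite le_max lexx.
(* [m] agrees with [X] as long as the defect [f5] is nonpositive; it keeps the
   quotient in [f3] continuous also where [X] might vanish. *)
pose m t := Num.max (X t) (C1 / 2 * E (- q) t).
pose f1 t := eps * `|Y t| - d * b t * X t.
pose f2 t := X t * E a t - M.
pose f3 t := (eps * Z t / m t `^ g + Q t) * E q t - M.
pose f4 t := U t - M.
pose f5 t := C1 / 2 - X t * E q t.
pose f t := Num.max (f1 t) (Num.max (f2 t) (Num.max (f3 t) (Num.max (f4 t) (f5 t)))).
have f5X (t : R) : 0 <= t -> f5 t <= 0 -> m t = X t /\ 0 < X t.
  move=> t0; rewrite subr_le0 => h; have Eq := Ep q _ t0.
  have h' : C1 / 2 * E (- q) t <= X t.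
    have EE : E (- q) t * E q t = 1.
      by rewrite /E powR_add ?ltr_pwDl// addNr powRr0.
    by rewrite -(ler_pM2r Eq) -[leLHS]mulrA EE mulr1.
  split; first exact/max_idPl.
  by apply: lt_le_trans h'; rewrite mulr_gt0 ?Ep ?divr_gt0.
have goodf (t : R) : 0 <= t -> f t <= 0 -> good t.
  move=> t0; rewrite /f !ge_max => /and5P[h1 h2 h3 h4 h5].
  have [mX X0] := f5X _ t0 h5.
  move: h1 h2 h3 h4; rewrite /f1 /f2 /f3 /f4 mX !subr_le0 => h1 h2 h3 h4.
  exact: And5.
have fgood (t : R) : 0 <= t -> 0 < X t ->
    [/\ eps * `|Y t| <= d / 2 * b t * X t, C1 <= X t * E q t,
      X t * E a t <= 2 * CX, (eps * Z t / X t `^ g + Q t) * E q t <= 2 * CF & U t <= N] ->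
    f t < 0.
  move=> t0 X0 [h1 h2 h3 h4 h5].
  have f50 : f5 t < 0 by rewrite subr_lt0; exact: lt_le_trans h2.
  have [mX _] := f5X _ t0 (ltW f50).
  rewrite /f !gt_max f50 /f1 /f2 /f3 /f4 mX !subr_lt0 andbT.
  apply/and4P; split.
  - apply: le_lt_trans h1 _; rewrite -[ltLHS]mulrA -[ltRHS]mulrA.
    by rewrite ltr_pM2r ?(mulr_gt0 (Ep _ _ t0) X0).
  - exact: le_lt_trans h3 MCX.
  - exact: le_lt_trans h4 MCF.
  - exact: le_lt_trans h5 MN.
have fc (t : R) : 0 <= t -> {for t, continuous f}.
  move=> t0; have [[dU _ _] [dX dY dZ dQ']] := es_der sys t0.
  have cE r : {for t, continuous (E r)} := is_derive_continuous (isder_1powR r t0).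
  have cst k : {for t, continuous (fun=> k : R)} by exact: cst_continuous.
  have cX' := is_derive_continuous dX; have cY := is_derive_continuous dY.
  have cZ := is_derive_continuous dZ; have cQ := is_derive_continuous dQ'.
  have cU := is_derive_continuous dU.
  have m0 : 0 < m t by rewrite lt_max mulr_gt0 ?orbT ?Ep// divr_gt0.
  have cm : {for t, continuous m}.
    apply: continuous_max; first exact: cX'.
    by apply: continuousM; [exact: cst|exact: cE].
  have cmg : {for t, continuous (fun s => (m s `^ g)^-1)}.
    apply: continuousV; first by rewrite gt_eqF// powR_gt0.
    exact: continuous_powR_at.
  apply: continuous_max.
    apply: continuousB.
      apply: continuousM; first exact: cst.
      by apply: continuous_comp; [exact: cY|exact: norm_continuous].
    apply: continuousM; last exact: cX'.
    by apply: continuousM; [exact: cst|exact: cE].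
  apply: continuous_max.
    apply: continuousB; last exact: cst.
    by apply: continuousM; [exact: cX'|exact: cE].
  apply: continuous_max.
    apply: continuousB; last exact: cst.
    apply: continuousM; last exact: cE.
    apply: continuousD; last exact: cQ.
    apply: continuousM; last exact: cmg.
    by apply: continuousM; [exact: cst|exact: cZ].
  apply: continuous_max.
    by apply: continuousB; [exact: cU|exact: cst].
  apply: continuousB; first exact: cst.
  by apply: continuousM; [exact: cX'|exact: cE].
have E0 r : E r 0 = 1 by rewrite /E addr0 powR1.
have f0 : f 0 <= 0.
  have X00 : 0 < X 0 by apply: lt_le_trans x0X0.
  have [U0K W0K X0K Z0K Q0K] := init.
  have [_ Wp _ Zp _] := es_pos sys (lexx 0).
  have [_ YXZ _] := es_schwarz sys (lexx 0).
  apply/ltW/fgood => //; rewrite !E0 /b addr0 powR1 !mulr1; split.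
  - have YK : `|Y 0| <= K.
      rewrite -ler_sqr ?nnegrE ?(ltW K0)// real_normK ?num_real//.
      by apply: (le_trans YXZ); rewrite expr2 ler_pM ?(ltW X00).
    have h1 : eps * `|Y 0| <= eps * K by rewrite ler_wpM2l ?(ltW eps0).
    have h2 : d * x0 <= d * X 0 by rewrite ler_wpM2l ?(ltW d0).
    by clear -h1 h2 e4; lra.
  - by case: C1P => _ h _; exact: le_trans x0X0.
  - exact: le_trans KCX.
  - apply: le_trans KCF; rewrite lerD//.
      have e1' : eps <= 1 by exact: le_trans d1.
      rewrite ler_pM ?invr_ge0 ?mulr_ge0 ?powR_ge0 ?(ltW eps0)//.
        by rewrite -[leRHS]mul1r ler_pM ?(ltW eps0).
      by rewrite lef_pV2 ?posrE ?powR_gt0// powR_mono ?(ltW g0) ?(ltW x00).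
  - exact: le_trans KN.
have fneg : forall t : R, 0 <= t -> f t < 0.
  apply: (continuity_method fc f0) => T T0 HT.
  have GT (t : R) : 0 <= t <= T -> good t.
    by move=> tT; apply: goodf; [case/andP: tT|exact: HT].
  have [h _] := improve _ T0 GT.
  have [_ X0 _ _ _] : good T by apply: GT; rewrite T0 lexx.
  exact: fgood.
move=> t t0.
have GT (s : R) : 0 <= s <= t -> good s.
  by move=> /andP[s0 _]; apply: goodf => //; exact/ltW/fneg.
have [[h1 h2 h3 h4 h5] h6] := improve _ t0 GT.
have [_ X0 _ _ _] : good t by apply: GT; rewrite t0 lexx.
have XCX : X t <= 2 * CX.
  apply: le_trans h3; rewrite ler_peMr ?(ltW X0)// powR_ge1 ?(ltW a0)//.
  by rewrite lerDl.
have XM : X t <= M by exact: le_trans XCX (ltW MCX).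
split => //; first exact: le_trans h3 C2CX.
  by rewrite cX//; exact: le_trans h4 C2CF.
apply: le_trans C2L.
have t1 : 0 < 1 + t by rewrite ltr_pwDl.
have -> : (1 + t) `^ (q + 2 * a * g - 2 * p) = b t ^+ 2 * E q t * E (a * g) t ^+ 2.
  by rewrite /b /E !powR_sqr// !powR_add//; congr (_ `^ _); ring.
apply: (@le_trans _ _ (L4 ^+ 2 * (X t `^ g) ^+ 2 * E (a * g) t ^+ 2)).
  by rewrite mulrA; apply: ler_wpM2r; [exact: sqr_ge0|exact: h6].
rewrite -mulrA ler_wpM2l ?sqr_ge0// -exprMn ler_sqr ?nnegrE ?mulr_ge0 ?powR_ge0//.
by rewrite /E powRrM -powRM ?powR_ge0 ?(ltW X0)// powR_mono ?(ltW g0) ?mulr_ge0 ?powR_ge0 ?(ltW X0).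
Qed.

End Bootstrap.

(** * Differential calculus for curves in a Hilbert space *)

Section OneSidedDerivative.
Context {R : realType}.

(** Derivatives along the half-line in epsilon-delta form; at [t = 0] they are
one-sided. *)
Definition hasd (V : normedModType R) (u : R -> V) (t : R) (v : V) : Prop :=
  forall e : R, 0 < e -> exists2 d : R, 0 < d &
    forall s : R, 0 <= s -> `|s - t| < d ->
      `|u s - u t - (s - t) *: v| <= e * `|s - t|.

Definition hcont (V : normedModType R) (u : R -> V) (t : R) : Prop :=
  forall e : R, 0 < e -> exists2 d : R, 0 < d &
    forall s : R, 0 <= s -> `|s - t| < d -> `|u s - u t| <= e.

Section Rules.
Variable V : normedModType R.
Implicit Types (u w : R -> V) (t : R).

Lemma hasd_cont u t v : hasd u t v -> hcont u t.
Proof.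
move=> h e e0; have [d d0 H] := h 1 ltr01.
have n0 : 0 < 1 + `|v| by rewrite ltr_pwDl.
exists (Num.min d (e / (1 + `|v|))); first by rewrite lt_min d0 divr_gt0.
move=> s s0; rewrite lt_min => /andP[sd se].
have := H _ s0 sd; rewrite mul1r => h1.
rewrite -[u s - u t](subrK ((s - t) *: v)).
apply: le_trans (ler_normD _ _) _; rewrite normrZ.
apply: le_trans (lerD h1 (lexx _)) _.
rewrite -{1}[`|s - t|]mulr1 -mulrDr -ler_pdivlMr//; exact: ltW.
Qed.

Lemma hasd_ext u w t v : (forall s : R, 0 <= s -> u s = w s) -> 0 <= t ->
  hasd u t v -> hasd w t v.
Proof.
move=> E t0 h e e0; have [d d0 H] := h e e0; exists d => // s s0 sd.
by rewrite -!E//; exact: H.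
Qed.

Lemma hcont_ext u w t : (forall s : R, 0 <= s -> u s = w s) -> 0 <= t ->
  hcont u t -> hcont w t.
Proof.
move=> E t0 h e e0; have [d d0 H] := h e e0; exists d => // s s0 sd.
by rewrite -!E//; exact: H.
Qed.

Lemma hasdD u w t v x : hasd u t v -> hasd w t x ->
  hasd (fun s => u s + w s) t (v + x).
Proof.
move=> h k e e0; have e2 : 0 < e / 2 by rewrite divr_gt0.
have [d d0 H] := h _ e2; have [d' d0' H'] := k _ e2.
exists (Num.min d d'); first by rewrite lt_min d0.
move=> s s0; rewrite lt_min => /andP[sd sd'].
have -> : u s + w s - (u t + w t) - (s - t) *: (v + x) =
  (u s - u t - (s - t) *: v) + (w s - w t - (s - t) *: x).
  by rewrite scalerDr !opprD [u s + w s + _]addrACA [LHS]addrACA.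
apply: le_trans (ler_normD _ _) _.
apply: le_trans (lerD (H _ s0 sd) (H' _ s0 sd')) _.
by rewrite -mulrDl -splitr.
Qed.

Lemma hasdZ u t v a : hasd u t v -> hasd (fun s => a *: u s) t (a *: v).
Proof.
move=> h e e0; have n0 : 0 < 1 + `|a| by rewrite ltr_pwDl.
have [d d0 H] := h (e / (1 + `|a|)) (divr_gt0 e0 n0).
exists d => // s s0 sd.
rewrite scalerA mulrC -scalerA -!scalerBr normrZ.
apply: (@le_trans _ _ ((1 + `|a|) * (e / (1 + `|a|) * `|s - t|))).
  by rewrite ler_pM ?H// lerDr.
by rewrite mulrA mulrCA divff ?gt_eqF// mulr1.
Qed.

Lemma hasdN u t v : hasd u t v -> hasd (fun s => - u s) t (- v).
Proof.
move=> h; rewrite -scaleN1r; have := @hasdZ _ _ _ (- 1) h.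
by move=> k e e0; have [d d0 H] := k e e0; exists d => // s s0 sd;
  rewrite -[- u s]scaleN1r -[- u t]scaleN1r; exact: H.
Qed.

Lemma hasdB u w t v x : hasd u t v -> hasd w t x ->
  hasd (fun s => u s - w s) t (v - x).
Proof. by move=> h k; apply: hasdD => //; exact: hasdN. Qed.

Lemma hasd_cst (c : V) t : hasd (fun=> c) t 0.
Proof.
move=> e e0; exists 1 => // s s0 _.
by rewrite subrr sub0r scaler0 normrN normr0 mulr_ge0// ltW.
Qed.

Lemma hcontD u w t : hcont u t -> hcont w t -> hcont (fun s => u s + w s) t.
Proof.
move=> h k e e0; have e2 : 0 < e / 2 by rewrite divr_gt0.
have [d d0 H] := h _ e2; have [d' d0' H'] := k _ e2.
exists (Num.min d d'); first by rewrite lt_min d0.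
move=> s s0; rewrite lt_min => /andP[sd sd'].
rewrite opprD addrACA; apply: le_trans (ler_normD _ _) _.
by apply: le_trans (lerD (H _ s0 sd) (H' _ s0 sd')) _; rewrite -splitr.
Qed.

Lemma hcontZ (f : R -> R) u t : hcont (f : R -> R^o) t -> hcont u t ->
  hcont (fun s => f s *: u s) t.
Proof.
move=> h k e e0.
have n0 : 0 < 1 + `|u t| by rewrite ltr_pwDl.
have m0 : 0 < 1 + `|f t| by rewrite ltr_pwDl.
have [d1 d10 H1] := h 1 ltr01.
have [d2 d20 H2] := h (e / 2 / (1 + `|u t|)) ltac:(by rewrite !divr_gt0).
have [d3 d30 H3] := k (e / 2 / (1 + `|f t|)) ltac:(by rewrite !divr_gt0).
exists (Num.min d1 (Num.min d2 d3)); first by rewrite !lt_min d10 d20.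
move=> s s0; rewrite !lt_min => /and3P[s1 s2 s3].
have -> : f s *: u s - f t *: u t = f s *: (u s - u t) + (f s - f t) *: u t.
  by rewrite scalerBr scalerBl addrA subrK.
apply: le_trans (ler_normD _ _) _; rewrite !normrZ (splitr e); apply: lerD.
  have fs : `|f s| <= 1 + `|f t|.
    rewrite -[f s](subrK (f t)); apply: le_trans (ler_normD _ _) _.
    by rewrite lerD2r; exact: H1.
  apply: (@le_trans _ _ ((1 + `|f t|) * (e / 2 / (1 + `|f t|)))).
    by rewrite ler_pM ?H3.
  by rewrite mulrCA divff ?mulr1// gt_eqF.
apply: (@le_trans _ _ (e / 2 / (1 + `|u t|) * (1 + `|u t|))).
  by rewrite ler_pM ?lerDr//; exact: H2.
by rewrite divfK// gt_eqF.
Qed.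

End Rules.

Lemma homogeneous_of_linear (V W : lmodType R) (L : V -> W) :
  (forall (a : R) x y, L (a *: x + y) = a *: L x + L y) ->
  forall (a : R) x, L (a *: x) = a *: L x.
Proof.
move=> Ll a x; have L0 : L 0 = 0.
  by have := Ll 1 0 0; rewrite !scale1r addr0 => h; apply: (@addrI _ (L 0)); rewrite addr0 -h.
by rewrite -[a *: x]addr0 Ll L0 addr0.
Qed.

Lemma hasd_map (V W : normedModType R) (L : V -> W) (K : R) (u : R -> V) t v :
  (forall (a : R) x y, L (a *: x + y) = a *: L x + L y) ->
  (forall x, `|L x| <= K * `|x|) ->
  hasd u t v -> hasd (fun s => L (u s)) t (L v).
Proof.
move=> Ll LK h e e0.
have n0 : 0 < 1 + `|K| by rewrite ltr_pwDl.
have [d d0 H] := h (e / (1 + `|K|)) (divr_gt0 e0 n0).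
exists d => // s s0 sd.
have LZ := homogeneous_of_linear Ll.
have LD x y : L (x + y) = L x + L y by rewrite -[x]scale1r Ll !scale1r.
have LN x : L (- x) = - L x by rewrite -scaleN1r LZ scaleN1r.
rewrite -LZ -!LN -!LD.
have K1 : K <= 1 + `|K| by apply: le_trans (ler_norm K) _; rewrite lerDr.
apply: le_trans (LK _) _; apply: le_trans (ler_wpM2r (normr_ge0 _) K1) _.
apply: (@le_trans _ _ ((1 + `|K|) * (e / (1 + `|K|) * `|s - t|))).
  by rewrite ler_wpM2l ?(ltW n0)// H.
by rewrite mulrA mulrCA divff ?gt_eqF// mulr1.
Qed.

Lemma hcont_map (V W : normedModType R) (L : V -> W) (K : R) (u : R -> V) t :
  (forall x y, `|L x - L y| <= K * `|x - y|) ->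
  hcont u t -> hcont (fun s => L (u s)) t.
Proof.
move=> LK h e e0.
have n0 : 0 < 1 + `|K| by rewrite ltr_pwDl.
have [d d0 H] := h (e / (1 + `|K|)) (divr_gt0 e0 n0).
exists d => // s s0 sd.
have K1 : K <= 1 + `|K| by apply: le_trans (ler_norm K) _; rewrite lerDr.
apply: le_trans (LK _ _) _; apply: le_trans (ler_wpM2r (normr_ge0 _) K1) _.
apply: (@le_trans _ _ ((1 + `|K|) * (e / (1 + `|K|)))).
  by rewrite ler_wpM2l ?(ltW n0)// H.
by rewrite mulrCA divff ?mulr1// gt_eqF.
Qed.

End OneSidedDerivative.

Section ScalarExtension.
Context {R : realType}.

Lemma is_derive_dist (f : R -> R) (t d : R) :
  (forall e : R, 0 < e -> exists2 r : R, 0 < r &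
     forall s : R, `|s - t| < r -> `|f s - f t - (s - t) * d| <= e * `|s - t|) ->
  is_derive t 1 f d.
Proof.
move=> H.
have C : h^-1 *: (f (h *: 1 + t) - f t) @[h --> 0^'] --> d.
  apply/cvgrPdist_le => e e0; have [r r0 Hr] := H e e0.
  near=> h.
  have h0 : h != 0 by near: h; exact: nbhs_dnbhs_neq.
  have hr : `|h| < r.
    near: h; apply: (@dnbhs0_lt _ R^o); exact: r0.
  have := Hr (h + t); rewrite addrK => /(_ hr) k.
  rewrite /GRing.scale/= mulr1.
  have -> : d - h^-1 * (f (h + t) - f t) = - h^-1 * (f (h + t) - f t - h * d).
    by field.
  rewrite normrM normrN normfV mulrC ler_pdivrMr ?normr_gt0//.
apply: DeriveDef; first by apply/cvg_ex; exists d.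
exact/cvg_lim.
Unshelve. all: by end_near. Qed.

(** A function that is differentiable on the half-line extends to a
differentiable function on the line, so that the usual two-sided calculus
applies. *)
Lemma two_sided_extension (f df : R -> R) :
  (forall t : R, 0 <= t -> hasd (f : R -> R^o) t (df t)) ->
  exists2 g : R -> R, (forall t : R, 0 <= t -> g t = f t) &
    forall t : R, 0 <= t -> is_derive t 1 g (df t).
Proof.
move=> fd; exists (fun t => if 0 <= t then f t else f 0 + t * df 0).
  by move=> t ->.
move=> t t0; apply: is_derive_dist => e e0.
have [d d0 H] := fd _ t0 e e0; rewrite t0.
move: t0; rewrite le_eqVlt => /predU1P[t0|t0]; last first.
  exists (Num.min d t); first by rewrite lt_min d0.
  move=> s; rewrite lt_min => /andP[sd st].
  have s0 : 0 <= s.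
    by move: st; rewrite ltr_norml => /andP[+ _]; rewrite ltrBrDl subrr => /ltW.
  by rewrite s0; exact: H.
exists d => // s sd; rewrite -t0 in sd H *; case: ifPn => s0; first exact: H.
by rewrite [f 0 + _]addrC addrK subr0 subrr normr0 mulr_ge0// ltW.
Qed.

Lemma hasd_is_derive (f : R -> R) (t d : R) : is_derive t 1 f d ->
  hasd (f : R -> R^o) t d.
Proof.
move=> [/cvg_ex[l fl] fE] e e0.
have {}fE : l = d.
  by rewrite -fE; apply/esym/cvg_lim.
rewrite {}fE in fl.
move/cvgrPdist_le: fl => /(_ _ e0).
move=> /nbhs_ballP[r /= r0 Hr]; exists r => // s _ sr.
have [->|st] := eqVneq s t; first by rewrite !subrr scale0r subrr !normr0 mulr0.
have h0 : s - t != 0 by rewrite subr_eq0.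
have := Hr (s - t); rewrite /ball/= sub0r normrN => /(_ sr h0).
rewrite /GRing.scale/= mulr1 subrK => k.
rewrite -ler_pdivrMr ?normr_gt0// -normfV -normrM.
rewrite distrC in k; apply: le_trans k.
by rewrite le_eqVlt; apply/orP; left; apply/eqP; congr (`|_|); field.
Qed.

Lemma hasd_nonincreasing (f df : R -> R) (a b : R) : 0 <= a -> a <= b ->
  (forall t : R, 0 <= t -> hasd (f : R -> R^o) t (df t)) ->
  (forall t : R, a <= t <= b -> df t <= 0) -> f b <= f a.
Proof.
move=> a0 ab fd df0; have [g gE gd] := two_sided_extension fd.
rewrite -!gE// ?(le_trans a0 ab)//.
by apply: (derive_le0_nonincreasing ab) df0 => t /andP[at_ _];
  apply: gd; exact: le_trans at_.
Qed.

End ScalarExtension.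

Section InnerProduct.
Context {R : realType} {H : completeNormedModType R}.
Variable dot : {dot H for (idfun : R -> R)}.
Hypothesis hp : hilbert_product dot.
Implicit Types (x y z : H) (u w : R -> H) (t : R).

Lemma dotDl x y z : dot (x + y) z = dot x z + dot y z.
Proof. exact: linearDl. Qed.

Lemma dotDr x y z : dot z (x + y) = dot z x + dot z y.
Proof. exact: linearDr. Qed.

Lemma dotZl (a : R) x z : dot (a *: x) z = a * dot x z.
Proof. exact: linearZl_LR. Qed.

Lemma dotZr (a : R) x z : dot z (a *: x) = a * dot z x.
Proof. exact: linearZr. Qed.

Lemma dotNl x z : dot (- x) z = - dot x z.
Proof. by rewrite -scaleN1r dotZl mulN1r. Qed.

Lemma dotNr x z : dot z (- x) = - dot z x.
Proof. by rewrite -scaleN1r dotZr mulN1r. Qed.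

Lemma dotBl x y z : dot (x - y) z = dot x z - dot y z.
Proof. by rewrite dotDl dotNl. Qed.

Lemma dotBr x y z : dot z (x - y) = dot z x - dot z y.
Proof. by rewrite dotDr dotNr. Qed.

Lemma dot0l z : dot 0 z = 0.
Proof. by rewrite -(scale0r z) dotZl mul0r. Qed.

Lemma dot0r z : dot z 0 = 0.
Proof. by rewrite -(scale0r z) dotZr mul0r. Qed.

Lemma dotC x y : dot x y = dot y x.
Proof. by rewrite hermC expr0 mul1r. Qed.

Lemma dot_ge0 x : 0 <= dot x x.
Proof. by rewrite hp sqr_ge0. Qed.

(** Cauchy-Schwarz for any symmetric positive semidefinite form, in the shape
of its discriminant inequality. *)
Lemma discriminant (a b c : R) : (forall s : R, 0 <= a + 2 * s * b + s ^+ 2 * c) ->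
  0 <= c -> b ^+ 2 <= a * c.
Proof.
move=> h; rewrite le_eqVlt => /predU1P[c0|c0]; last first.
  have := h (- b / c).
  have -> : a + 2 * (- b / c) * b + (- b / c) ^+ 2 * c = (a * c - b ^+ 2) / c.
    by field; rewrite gt_eqF.
  by rewrite pmulr_lge0 ?invr_gt0// subr_ge0.
rewrite -c0 mulr0; have [->|b0] := eqVneq b 0; first by rewrite expr0n.
have := h (- (a + 1) / (2 * b)); rewrite -c0.
have -> : a + 2 * (- (a + 1) / (2 * b)) * b + (- (a + 1) / (2 * b)) ^+ 2 * 0 = -1.
  by field.
by rewrite ler0N1.
Qed.

Lemma cauchy_schwarz_sq x y : dot x y ^+ 2 <= dot x x * dot y y.
Proof.
apply: discriminant (dot_ge0 y) => s.
have := dot_ge0 (x + s *: y).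
rewrite dotDl !dotDr !dotZl !dotZr (dotC y x).
by congr (_ <= _); ring.
Qed.

Lemma cauchy_schwarz x y : `|dot x y| <= `|x| * `|y|.
Proof.
rewrite -ler_sqr ?nnegrE ?mulr_ge0// real_normK ?num_real// exprMn -!hp.
exact: cauchy_schwarz_sq.
Qed.

Lemma dot_eq0P x : (forall y, dot x y = 0) -> x = 0.
Proof.
by move=> h; apply/eqP; rewrite -normr_eq0 -sqrf_eq0 -hp h.
Qed.

Lemma normB_sq x y : `|x - y| ^+ 2 = `|x| ^+ 2 - 2 * dot x y + `|y| ^+ 2.
Proof.
by rewrite -!hp dotBl !dotBr (dotC y x); ring.
Qed.

Lemma hasd_dot u w t v x : hasd u t v -> hasd w t x ->
  hasd ((fun s => dot (u s) (w s)) : R -> R^o) t (dot v (w t) + dot (u t) x).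
Proof.
move=> h k e e0.
have c := hasd_cont k.
pose A := 1 + `|v|; pose B := 1 + `|u t|; pose C := 1 + `|w t|.
have A0 : 0 < A by rewrite ltr_pwDl.
have B0 : 0 < B by rewrite ltr_pwDl.
have C0 : 0 < C by rewrite ltr_pwDl.
have e3 : 0 < e / 3 by rewrite divr_gt0.
have c1 : 0 < Num.min 1 (e / 3 / A) by rewrite lt_min ltr01 divr_gt0.
have c2 : 0 < e / 3 / B by rewrite divr_gt0.
have c3 : 0 < e / 3 / (1 + C) by rewrite divr_gt0// addr_gt0.
have [d1 d10 H1] := c _ c1; have [d2 d20 H2] := k _ c2.
have [d3 d30 H3] := h _ c3.
exists (Num.min d1 (Num.min d2 d3)); first by rewrite !lt_min d10 d20.
move=> s s0; rewrite !lt_min => /and3P[s1 s2 s3].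
have -> : dot (u s) (w s) - dot (u t) (w t)
    - (s - t) *: ((dot v (w t) + dot (u t) x) : R^o)
  = dot (u s - u t - (s - t) *: v) (w s) + (s - t) * dot v (w s - w t)
    + dot (u t) (w s - w t - (s - t) *: x).
  rewrite !(dotBl, dotBr, dotZl, dotZr) /GRing.scale/=; ring.
have {}H1 := H1 _ s0 s1.
have ws : `|w s| <= 1 + C.
  rewrite -[w s](subrK (w t)); apply: le_trans (ler_normD _ _) _.
  rewrite /C; apply: lerD.
    by apply: (le_trans H1); rewrite ge_min lexx.
  by rewrite lerDr.
have ws2 : `|w s - w t| <= e / 3 / A.
  by apply: (le_trans H1); rewrite ge_min lexx orbT.
apply: le_trans (ler_normD _ _) _.
apply: le_trans (lerD (ler_normD _ _) (lexx _)) _.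
have -> : e * `|s - t| = e / 3 * `|s - t| + e / 3 * `|s - t| + e / 3 * `|s - t|.
  by field.
apply: lerD; [apply: lerD|].
- apply: le_trans (cauchy_schwarz _ _) _.
  apply: (@le_trans _ _ (e / 3 / (1 + C) * `|s - t| * (1 + C))).
    by rewrite ler_pM ?H3.
  by rewrite mulrAC divfK// gt_eqF// addr_gt0.
- rewrite normrM mulrC ler_wpM2r//; apply: le_trans (cauchy_schwarz _ _) _.
  apply: (@le_trans _ _ (A * (e / 3 / A))).
    by rewrite ler_pM// /A lerDr.
  by rewrite mulrC divfK// gt_eqF.
- apply: le_trans (cauchy_schwarz _ _) _.
  apply: (@le_trans _ _ (B * (e / 3 / B * `|s - t|))).
    by rewrite ler_pM ?H2// /B lerDr.
  by rewrite mulrA [B * _]mulrC divfK// gt_eqF.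
Qed.

(** The mean value inequality: test with the increment itself and apply the
scalar theorem. *)
Lemma mean_value_ineq u v (phi dphi : R -> R) (a b : R) : 0 <= a -> a <= b ->
  (forall t, 0 <= t -> hasd u t (v t)) ->
  (forall t, 0 <= t -> hasd (phi : R -> R^o) t (dphi t)) ->
  (forall t, a <= t <= b -> `|v t| <= dphi t) ->
  `|u b - u a| <= phi b - phi a.
Proof.
move=> a0 ab ud pd vp; set y := u b - u a.
have [y0|y0] := eqVneq y 0.
  rewrite y0 normr0 subr_ge0.
  have := @hasd_nonincreasing R (fun t => - phi t) (fun t => - dphi t) a b a0 ab.
  rewrite lerN2; apply.
    by move=> t t0; apply: (@hasdN _ R^o); exact: pd.
  by move=> t tab; rewrite oppr_le0; exact: le_trans (vp _ tab).
have yp : 0 < `|y| by rewrite normr_gt0.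
rewrite -(ler_pM2l yp) -expr2 -hp {1}/y dotBl lerBlDr mulrBr.
have := @hasd_nonincreasing R (fun t => dot (u t) y - `|y| * phi t)
  (fun t => dot (v t) y + dot (u t) 0 - `|y| * dphi t) a b a0 ab.
suff -> : forall P1 P2 Q1 Q2 : R, (P1 - Q1 <= P2 - Q2) = (P1 <= Q1 - Q2 + P2).
  apply; first move=> t t0.
    apply: (@hasdB _ R^o); last by apply: (@hasdZ _ R^o); exact: pd.
    by apply: hasd_dot; [exact: ud|exact: hasd_cst].
  move=> t tab; rewrite dot0r addr0 subr_le0.
  apply: le_trans (ler_norm _) _; apply: le_trans (cauchy_schwarz _ _) _.
  by rewrite mulrC ler_wpM2l// vp.
by move=> P1 P2 Q1 Q2; apply/idP/idP; lra.
Qed.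

Lemma mean_value_cst u v (k a b : R) : 0 <= a -> a <= b ->
  (forall t, 0 <= t -> hasd u t (v t)) ->
  (forall t, a <= t <= b -> `|v t| <= k) ->
  `|u b - u a| <= k * (b - a).
Proof.
move=> a0 ab ud vk.
have := @mean_value_ineq u v (fun t => k * t) (fun=> k) a b a0 ab ud.
rewrite mulrBr; apply=> // t t0.
apply: hasd_is_derive; apply: (isder_eq (isder_scale k (isder_id t))).
by rewrite mulr1.
Qed.

End InnerProduct.

Section LocallyUniformConvergence.
Context {R : realType}.

(** Locally uniform convergence on the half-line. *)
Definition luc (V : normedModType R) (u_ : nat -> R -> V) (u : R -> V) : Prop :=
  forall T e : R, 0 < e -> exists N : nat, forall n, (N <= n)%N ->
    forall t : R, 0 <= t <= T -> `|u_ n t - u t| <= e.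

Definition luc_cauchy (V : normedModType R) (u_ : nat -> R -> V) : Prop :=
  forall T e : R, 0 < e -> exists N : nat, forall m n, (N <= m)%N -> (N <= n)%N ->
    forall t : R, 0 <= t <= T -> `|u_ m t - u_ n t| <= e.

Lemma luc_cont (V : normedModType R) (u_ : nat -> R -> V) (u : R -> V) :
  luc u_ u -> (forall n t, 0 <= t -> hcont (u_ n) t) ->
  forall t : R, 0 <= t -> hcont u t.
Proof.
move=> h c t t0 e e0; have e3 : 0 < e / 3 by rewrite divr_gt0.
have [N HN] := h (t + 1) _ e3; have [d d0 Hd] := c N t t0 _ e3.
exists (Num.min d 1); first by rewrite lt_min d0 ltr01.
move=> s s0; rewrite lt_min => /andP[sd s1].
have sT : 0 <= s <= t + 1.
  by rewrite s0/= -lerBlDl; apply: le_trans (ler_norm _) (ltW s1).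
have tT : 0 <= t <= t + 1 by rewrite t0 lerDl ler01.
have -> : u s - u t = - (u_ N s - u s) + (u_ N s - u_ N t) + (u_ N t - u t).
  by rewrite opprB !subrKA.
apply: le_trans (ler_normD _ _) _.
apply: le_trans (lerD (ler_normD _ _) (lexx _)) _; rewrite normrN.
have := HN _ (leqnn N) _ sT; have := HN _ (leqnn N) _ tT; have := Hd _ s0 sd.
by move=> h1 h2 h3; have := lerD (lerD h3 h1) h2; lra.
Qed.

Lemma luc_complete (V : completeNormedModType R) (u_ : nat -> R -> V) :
  luc_cauchy u_ -> exists u : R -> V, luc u_ u.
Proof.
move=> h.
have C t : 0 <= t -> cvgn (fun n => u_ n t).
  move=> t0; apply/cauchy_cvgP/cauchy_exP => e e0.
  have e2 : 0 < e / 2 by rewrite divr_gt0.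
  have [N HN] := h t _ e2; exists (u_ N t); exists N => // n /= Nn.
  rewrite -ball_normE /ball_/=; apply: (@le_lt_trans _ _ (e / 2)).
    by apply: HN => //; rewrite t0 lexx.
  by rewrite ltr_pdivrMr// ltr_pMr// ltr1n.
exists (fun t => limn (fun n => u_ n t)) => T e e0.
have e2 : 0 < e / 2 by rewrite divr_gt0.
have [N HN] := h T _ e2; exists N => n Nn t tT.
have t0 : 0 <= t by case/andP: tT.
move: (C t t0) => /cvgrPdist_le/(_ _ e2)[N' _ HN'].
set l := limn _ in HN' *.
have k1 := HN n (maxn N N') Nn (leq_maxl _ _) t tT.
have k2 := HN' (maxn N N') (leq_maxr _ _).
rewrite -[u_ n t](subrK (u_ (maxn N N') t)) -addrA.
apply: le_trans (ler_normD _ _) _; rewrite [leRHS](splitr e) lerD//.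
by rewrite distrC.
Qed.

Lemma luc_unique (V : normedModType R) (u_ : nat -> R -> V) (u w : R -> V) :
  luc u_ u -> luc u_ w -> forall t : R, 0 <= t -> u t = w t.
Proof.
move=> h k t t0; apply/eqP; rewrite -subr_eq0 -normr_eq0 eq_le normr_ge0 andbT.
apply/ler_addgt0Pl => e e0; rewrite addr0.
have e2 : 0 < e / 2 by rewrite divr_gt0.
have tt : 0 <= t <= t by rewrite t0 lexx.
have [N HN] := h t _ e2; have [N' HN'] := k t _ e2.
have h1 := HN (maxn N N') (leq_maxl _ _) t tt.
have h2 := HN' (maxn N N') (leq_maxr _ _) t tt.
rewrite -[u t](subrK (u_ (maxn N N') t)) -addrA.
apply: le_trans (ler_normD _ _) _; rewrite (splitr e) lerD//.
by rewrite distrC.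
Qed.

Lemma le_of_luc (V : normedModType R) (u_ : nat -> R -> V) (u : R -> V) (t k : R) :
  luc u_ u -> 0 <= t -> (exists N, forall n, (N <= n)%N -> `|u_ n t| <= k) ->
  `|u t| <= k.
Proof.
move=> h t0 [N0 uk]; apply/ler_addgt0Pr => e e0.
have tt : 0 <= t <= t by rewrite t0 lexx.
have [N HN] := h t _ e0.
have := HN (maxn N0 N) (leq_maxr _ _) t tt; have := uk (maxn N0 N) (leq_maxl _ _).
move=> h1 h2; rewrite -[u t](subrK (u_ (maxn N0 N) t)).
apply: le_trans (ler_normD _ _) _; rewrite addrC lerD//.
by rewrite distrC.
Qed.

(** The mean value inequality for [u_ n r - r *: v t]: for large [n] its velocity
[v_ n r - v t] is small, since [v_ n] is close to [v] and [v] varies little near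
[t]. *)
Lemma luc_derivative (H : completeNormedModType R)
    (dot : {dot H for (idfun : R -> R)}) (u_ v_ : nat -> R -> H) (u v : R -> H) :
  hilbert_product dot ->
  (forall n t, 0 <= t -> hasd (u_ n) t (v_ n t)) ->
  luc u_ u -> luc v_ v -> (forall n t, 0 <= t -> hcont (v_ n) t) ->
  forall t : R, 0 <= t -> hasd u t (v t).
Proof.
move=> hp ud uu vv vc t t0 e e0.
have e4 : 0 < e / 4 by rewrite divr_gt0.
have [d d0 Hd] := luc_cont vv vc t0 e4.
exists (Num.min d 1); first by rewrite lt_min d0 ltr01.
move=> s s0; rewrite lt_min => /andP[sd s1].
have [->|st] := eqVneq s t.
  by rewrite !subrr scale0r subrr !normr0 mulr0.
have n0 : 0 < `|s - t| by rewrite normr_gt0 subr_eq0.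
have en : 0 < e / 4 * `|s - t| by rewrite mulr_gt0.
have sT : s <= t + 1.
  by rewrite -lerBlDl; apply: le_trans (ler_norm _) (ltW s1).
have [N1 HN1] := uu (t + 1) _ en; have [N2 HN2] := vv (t + 1) _ e4.
pose n := maxn N1 N2.
have h1 := HN1 n (leq_maxl _ _); have h2 := HN2 n (leq_maxr _ _).
have tT : 0 <= t <= t + 1 by rewrite t0 lerDl ler01.
have sT' : 0 <= s <= t + 1 by rewrite s0.
pose w r := u_ n r - r *: v t.
have wd r : 0 <= r -> hasd w r (v_ n r - v t).
  move=> r0; apply: hasdB; first exact: ud.
  move=> k k0; exists 1 => // q q0 _.
  by rewrite -scalerBl subrr normr0 mulr_ge0// ltW.
have near r : 0 <= r -> `|r - t| <= `|s - t| -> `|v_ n r - v t| <= e / 2.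
  move=> r0 rt; have rd : `|r - t| < d by exact: le_lt_trans sd.
  have rT : 0 <= r <= t + 1.
    rewrite r0/= -lerBlDl; apply: le_trans (ler_norm _) _.
    exact: le_trans rt (ltW s1).
  rewrite -[v_ n r](subrK (v r)) -addrA.
  apply: le_trans (ler_normD _ _) _.
  by apply: le_trans (lerD (h2 _ rT) (Hd _ r0 rd)) _; lra.
have W : `|w s - w t| <= e / 2 * `|s - t|.
  have [le_st|lt_ts] := leP s t.
    rewrite distrC [`|s - t|]distrC [`|t - s|]ger0_norm ?subr_ge0//.
    apply: (mean_value_cst hp s0 le_st wd) => r /andP[sr rt].
    apply: near; first exact: le_trans sr.
    rewrite distrC [leRHS]distrC !ger0_norm ?subr_ge0// lerB//.
  rewrite [`|s - t|]gtr0_norm ?subr_gt0//.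
  apply: (mean_value_cst hp t0 (ltW lt_ts) wd) => r /andP[tr rs].
  apply: near; first exact: le_trans tr.
  by rewrite !ger0_norm ?subr_ge0 ?(ltW lt_ts)// lerB.
have -> : u s - u t - (s - t) *: v t
  = - (u_ n s - u s) + (w s - w t) + (u_ n t - u t).
  have -> : w s - w t = u_ n s - u_ n t - (s - t) *: v t.
    by rewrite /w scalerBl !opprD !opprK addrACA.
  by rewrite opprB [u s - u_ n s + _]addrA subrKA [in RHS]addrAC subrKA.
apply: le_trans (ler_normD _ _) _.
apply: le_trans (lerD (ler_normD _ _) (lexx _)) _; rewrite normrN.
apply: le_trans (lerD (lerD (h1 _ sT') W) (h1 _ tT)) _; lra.
Qed.

End LocallyUniformConvergence.

(** * Primitives and the Picard iteration *)

Section Primitive.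
Context {R : realType} {H : completeNormedModType R}.
Variable dot : {dot H for (idfun : R -> R)}.
Hypothesis hp : hilbert_product dot.

Definition loc_lip (f : R -> H) : Prop := forall T : R, exists2 K : R, 0 <= K &
  forall s t : R, 0 <= s <= T -> 0 <= t <= T -> `|f s - f t| <= K * `|s - t|.

Lemma loc_lip_cont f t : 0 <= t -> loc_lip f -> hcont f t.
Proof.
move=> t0 h e e0; have [K K0 HK] := h (t + 1).
have K1 : 0 < 1 + K by rewrite ltr_pwDl.
exists (Num.min 1 (e / (1 + K))); first by rewrite lt_min ltr01 divr_gt0.
move=> s s0; rewrite lt_min => /andP[s1 se].
have sT : s <= t + 1 by rewrite -lerBlDl; apply: le_trans (ler_norm _) (ltW s1).
apply: le_trans (HK _ _ _ _) _; [by rewrite s0|by rewrite t0 lerDl ler01|].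
apply: (@le_trans _ _ ((1 + K) * (e / (1 + K)))).
  by rewrite ler_pM ?(ltW se)// lerDr.
by rewrite mulrC divfK// gt_eqF.
Qed.

Lemma geometric_luc_cauchy (u_ : nat -> R -> H) :
  (forall T : R, exists2 C : R, 0 <= C & forall n (t : R), 0 <= t <= T ->
     `|u_ n.+1 t - u_ n t| <= C / 2 ^+ n) -> luc_cauchy u_.
Proof.
move=> h T e e0; have [C C0 HC] := h T.
have step n k (t : R) : 0 <= t <= T ->
    `|u_ (n + k)%N t - u_ n t| <= 2 * C / 2 ^+ n - 2 * C / 2 ^+ (n + k).
  move=> tT; elim: k => [|k IH]; first by rewrite addn0 !subrr normr0.
  rewrite -[u_ (n + k.+1)%N t](subrK (u_ (n + k)%N t)) -addrA.
  apply: le_trans (ler_normD _ _) _; rewrite addnS.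
  apply: le_trans (lerD (HC _ _ tT) IH) _.
  have p0 : (2 : R) ^+ (n + k) != 0 by rewrite expf_neq0.
  rewrite exprS invfM; set a := _ / 2 ^+ n; set b := (2 ^+ (n + k))^-1.
  lra.
have [N HN] : exists N : nat, 2 * C / 2 ^+ N <= e / 2.
  exists (Num.bound (4 * C / e)).
  set N := Num.bound _.
  have h1 : 4 * C / e < N%:R.
    by apply: archi_boundP; rewrite divr_ge0 ?(ltW e0)// mulr_ge0.
  have h2 : (N%:R : R) <= 2 ^+ N by rewrite -natrX ler_nat ltnW// ltn_expl.
  have p0 : 0 < (2 : R) ^+ N by rewrite exprn_gt0.
  rewrite ler_pdivrMr//.
  have h3 : 4 * C / e <= 2 ^+ N by exact: le_trans (ltW h1) h2.
  rewrite ler_pdivrMr// in h3; lra.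
have B n (t : R) : 0 <= t <= T -> (N <= n)%N -> `|u_ n t - u_ N t| <= e / 2.
  move=> tT /subnKC <-; apply: le_trans (step _ _ _ tT) _.
  apply: le_trans HN; rewrite gerBl divr_ge0 ?exprn_ge0// mulr_ge0//.
exists N => m n Nm Nn t tT.
rewrite -[u_ m t](subrK (u_ N t)) -addrA; apply: le_trans (ler_normD _ _) _.
rewrite (splitr e) lerD ?B// distrC B//.
Qed.

(** The integral over [0, t] of the step function with the values of [f] at the
points of the grid of mesh [dl]; the weight of [f (k dl)] is the length of
[[0, t]] inside the [k]-th cell. *)
Definition cell (dl t : R) (k : nat) : R :=
  Num.min t (k.+1%:R * dl) - Num.min t (k%:R * dl).

Definition step_integral (f : R -> H) (dl t : R) (N : nat) : H :=
  \sum_(k < N) cell dl t k *: f (k%:R * dl).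

Lemma cell_ge0 dl t k : 0 <= dl -> 0 <= cell dl t k.
Proof.
move=> d0; rewrite subr_ge0 le_min ge_min lexx /= ge_min.
by rewrite ler_wpM2r ?ler_nat// orbT.
Qed.

Lemma cell_incr dl s t k : 0 <= dl -> s <= t -> cell dl s k <= cell dl t k.
Proof.
move=> d0 st; rewrite /cell.
have : k%:R * dl <= k.+1%:R * dl by rewrite ler_wpM2r ?ler_nat.
set a := _ * dl; set b := k.+1%:R * dl => ab.
by case: (leP t a) => ?; case: (leP t b) => ?; case: (leP s a) => ?;
  case: (leP s b) => ?; lra.
Qed.

Lemma cell_eq dl s t k : s <= t -> (t <= k%:R * dl) || (k.+1%:R * dl <= s) ->
  0 <= dl -> cell dl s k = cell dl t k.
Proof.
move=> st + d0; rewrite /cell.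
have : k%:R * dl <= k.+1%:R * dl by rewrite ler_wpM2r ?ler_nat.
set a := _ * dl; set b := k.+1%:R * dl => ab.
by case/orP=> ?; case: (leP t a) => ?; case: (leP t b) => ?;
  case: (leP s a) => ?; case: (leP s b) => ?; lra.
Qed.

Lemma sum_cell dl t N : 0 <= t -> t <= N%:R * dl ->
  \sum_(k < N) cell dl t k = t.
Proof.
move=> t0 tN; rewrite -(big_mkord xpredT (cell dl t)).
rewrite (telescope_sumr (fun k => Num.min t (k%:R * dl)))//.
by rewrite mul0r (min_idPr t0) subr0; apply/min_idPl.
Qed.

Lemma cell_pos dl t k : 0 <= dl -> cell dl t k != 0 -> k%:R * dl < t.
Proof.
move=> d0; apply: contraNT; rewrite -leNgt /cell => h; apply/eqP.
have : k%:R * dl <= k.+1%:R * dl by rewrite ler_wpM2r ?ler_nat.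
move: h; set a := _ * dl; set b := k.+1%:R * dl => h ab.
by rewrite (min_idPl h) (min_idPl (le_trans h ab)) subrr.
Qed.

Lemma step_integral_stable f dl t N N' : 0 <= dl -> t <= N%:R * dl ->
  (N <= N')%N -> step_integral f dl t N' = step_integral f dl t N.
Proof.
move=> d0 tN /subnKC <-; rewrite /step_integral big_split_ord/=.
rewrite [X in _ + X]big1 ?addr0// => i _.
have [->|/(cell_pos d0)] := eqVneq (cell dl t (N + i)) 0; first by rewrite scale0r.
rewrite ltNge (le_trans tN)//; by rewrite ler_wpM2r// ler_nat leq_addr.
Qed.

(** With [v = f s] and a small oscillation [eta], this is the differentiability of
the integral at [s], uniformly in the mesh. *)
Lemma step_integral_increment f dl s t N (v : H) (eta : R) : 0 <= dl ->
  0 <= s -> s <= t -> t <= N%:R * dl ->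
  (forall k : nat, k%:R * dl < t -> s < k.+1%:R * dl ->
     `|f (k%:R * dl) - v| <= eta) ->
  `|step_integral f dl t N - step_integral f dl s N - (t - s) *: v|
  <= eta * (t - s).
Proof.
move=> d0 s0 st tN h.
have -> : t - s = \sum_(k < N) (cell dl t k - cell dl s k).
  by rewrite sumrB !sum_cell// ?(le_trans st)// (le_trans s0).
rewrite scaler_suml -!sumrB mulr_sumr.
apply: le_trans (ler_norm_sum _ _ _) _; apply: ler_sum => k _.
rewrite -scalerBl -scalerBr normrZ ger0_norm ?subr_ge0 ?cell_incr// mulrC.
have [kt|kt] := leP t (k%:R * dl).
  by rewrite (@cell_eq _ s t) ?kt// subrr !mulr0.
have [ks|ks] := leP (k.+1%:R * dl) s.
  by rewrite (@cell_eq _ s t) ?ks ?orbT// subrr !mulr0.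
by rewrite ler_wpM2r ?subr_ge0 ?cell_incr// h.
Qed.

Lemma step_integral_refine f dl t N K T : 0 <= dl -> 0 <= t <= T ->
  t <= N%:R * dl -> 0 <= K ->
  (forall s t : R, 0 <= s <= T -> 0 <= t <= T -> `|f s - f t| <= K * `|s - t|) ->
  `|step_integral f (dl / 2) t (2 * N) - step_integral f dl t N|
  <= K * dl * t.
Proof.
move=> d0 tT tN K0 HK; have t0 : 0 <= t by case/andP: tT.
have d20 : 0 <= dl / 2 by rewrite divr_ge0.
have split_sum (F : nat -> H) n :
    \sum_(k < 2 * n) F k = \sum_(k < n) (F (2 * k)%N + F (2 * k).+1).
  elim: n => [|n IH]; first by rewrite muln0 !big_ord0.
  by rewrite mulnS !addSn add0n !big_ord_recr/= IH addrA.
rewrite /step_integral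
  (split_sum (fun k => cell (dl / 2) t k *: f (k%:R * (dl / 2)))) -sumrB.
have tE : t = \sum_(k < N) cell dl t k by rewrite sum_cell.
rewrite [X in _ <= _ * X]tE mulr_sumr.
apply: le_trans (ler_norm_sum _ _ _) _; apply: ler_sum => k _.
have E1 : (2 * k)%:R * (dl / 2) = k%:R * dl by rewrite natrM; field.
have E2 : (2 * k).+2%:R * (dl / 2) = k.+1%:R * dl.
  by rewrite -[(2 * k).+2]addn2 natrD natrM -[k.+1]addn1 natrD; field.
rewrite E1.
have -> : cell (dl / 2) t (2 * k) *: f (k%:R * dl) +
   cell (dl / 2) t (2 * k).+1 *: f ((2 * k).+1%:R * (dl / 2)) -
   cell dl t k *: f (k%:R * dl)
  = cell (dl / 2) t (2 * k).+1 *: (f ((2 * k).+1%:R * (dl / 2)) - f (k%:R * dl)).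
  have -> : cell dl t k = cell (dl / 2) t (2 * k) + cell (dl / 2) t (2 * k).+1.
    by rewrite /cell E1 E2; ring.
  move: (cell (dl / 2) t (2 * k)) (cell (dl / 2) t (2 * k).+1) => x y.
  by rewrite scalerDl scalerBr opprD addrACA subrr add0r.
have c0 := cell_ge0 t (2 * k).+1 d20.
have cle : cell (dl / 2) t (2 * k).+1 <= cell dl t k.
  rewrite -subr_ge0.
  have -> : cell dl t k - cell (dl / 2) t (2 * k).+1 = cell (dl / 2) t (2 * k).
    by rewrite /cell E1 E2; ring.
  exact: cell_ge0.
have [->|/(cell_pos d20) kt] := eqVneq (cell (dl / 2) t (2 * k).+1) 0.
  by rewrite scale0r normr0 !mulr_ge0// cell_ge0.
rewrite normrZ ger0_norm// mulrC; apply: ler_pM => //.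
have E3 : (2 * k).+1%:R * (dl / 2) - k%:R * dl = dl / 2.
  by rewrite -[(2 * k).+1]addn1 natrD natrM; field.
apply: le_trans (HK _ _ _ _) _.
- by rewrite mulr_ge0//=; apply: le_trans (ltW kt) _; case/andP: tT.
- rewrite mulr_ge0//=; apply: le_trans (_ : t <= T); last by case/andP: tT.
  by apply: le_trans (ltW kt); rewrite -subr_ge0 E3.
by rewrite E3 ger0_norm// ler_wpM2l// ler_pdivrMr// ler_peMr// ler1n.
Qed.

(** Halving the mesh changes the step integral by at most a multiple of the mesh,
so the dyadic step integrals converge geometrically. *)
Lemma primitive_exists f : loc_lip f ->
  exists2 F : R -> H, F 0 = 0 & forall t : R, 0 <= t -> hasd F t (f t).
Proof.
move=> fl.
pose dl n : R := (2 ^+ n)^-1.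
have dl0 n : 0 <= dl n by rewrite invr_ge0 exprn_ge0.
pose NN n (t : R) := (2 ^ n * Num.bound t)%N.
have NNle n (t : R) : 0 <= t -> t <= (NN n t)%:R * dl n.
  move=> t0; rewrite /NN natrM natrX mulrAC divff ?expf_neq0// mul1r.
  exact/ltW/archi_boundP.
pose F_ n t := step_integral f (dl n) t (NN n t).
have F_E n t N : 0 <= t -> t <= N%:R * dl n -> F_ n t = step_integral f (dl n) t N.
  move=> t0 tN; rewrite /F_ -(step_integral_stable f (dl0 n) (NNle n t t0) (leq_maxl _ N)).
  by rewrite (step_integral_stable f (dl0 n) tN (leq_maxr _ _)).
have dlS n : dl n.+1 = dl n / 2 by rewrite /dl exprS invfM mulrC.
have Fc : luc_cauchy F_.
  apply: geometric_luc_cauchy => T; have [K K0 HK] := fl T.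
  exists (K * `|T|); first by rewrite mulr_ge0.
  move=> n t tT; have t0 : 0 <= t by case/andP: tT.
  have tN := NNle n t t0.
  rewrite (@F_E n.+1 t (2 * NN n t)%N)//; last first.
    by rewrite dlS natrM; apply: (le_trans tN); rewrite le_eqVlt; apply/orP;
      left; apply/eqP; field.
  rewrite dlS; apply: le_trans (step_integral_refine (dl0 n) tT tN K0 HK) _.
  rewrite mulrAC ler_wpM2r// ler_wpM2l//; apply: le_trans (ler_norm T).
  by case/andP: tT.
have [F HF] := luc_complete Fc.
have F0 : F 0 = 0.
  apply/eqP; rewrite -normr_eq0 eq_le normr_ge0 andbT.
  apply: (le_of_luc HF (lexx 0)); exists 0%N => n _.
  rewrite (@F_E n 0 0%N) ?mul0r// /step_integral big_ord0 normr0//.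
exists F => // t t0 e e0.
have [K K0 HK] := fl (t + 1).
have K1 : 0 < 1 + K by rewrite ltr_pwDl.
exists (Num.min 1 (e / (1 + K))); first by rewrite lt_min ltr01 divr_gt0.
move=> s s0; rewrite lt_min => /andP[s1 se].
have key (a b : R) : 0 <= a -> a <= b -> b <= t + 1 -> a <= t <= b ->
    `|F b - F a - (b - a) *: f t| <= K * (b - a) * (b - a).
  move=> a0 ab bt /andP[at_ tb]; have b0 := le_trans a0 ab.
  have main n : `|F_ n b - F_ n a - (b - a) *: f t| <= K * (b - a + dl n) * (b - a).
    have bN := NNle n b b0; have aN := le_trans ab bN.
    rewrite (F_E n a (NN n b) a0 aN) /F_.
    apply: step_integral_increment => // k kb ka.
    have k0 : 0 <= k%:R * dl n by rewrite mulr_ge0.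
    apply: le_trans (HK _ _ _ _) _.
    - by rewrite k0 (le_trans (ltW kb)).
    - by rewrite t0 lerDl ler01.
    rewrite ler_wpM2l// ler_norml; apply/andP; split.
      have : k.+1%:R * dl n = k%:R * dl n + dl n by rewrite -natr1 mulrDl mul1r.
      by lra.
    by have := dl0 n; lra.
  apply/ler_addgt0Pr => e' e'0.
  have L0 : 0 < 1 + K * (b - a) by rewrite ltr_pwDl// mulr_ge0 ?subr_ge0.
  have e4 : 0 < e' / 4 by rewrite divr_gt0.
  have [N1 HN1] := HF b _ e4.
  pose N2 := Num.bound (2 * (1 + K * (b - a)) / e').
  pose n := maxn N1 N2.
  have h1 := HN1 n (leq_maxl _ _).
  have bb : 0 <= b <= b by rewrite b0 lexx.
  have aa : 0 <= a <= b by rewrite a0.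
  have dn : dl n * (K * (b - a)) <= e' / 2.
    have p0 : 0 < (2 : R) ^+ n by rewrite exprn_gt0.
    rewrite /dl mulrC ler_pdivrMr//.
    have h2 : 2 * (1 + K * (b - a)) / e' < N2%:R.
      by apply: archi_boundP; rewrite divr_ge0 ?(ltW e'0)// mulr_ge0 ?(ltW L0).
    have h3 : (N2%:R : R) <= 2 ^+ n.
      rewrite -natrX ler_nat (leq_trans (leq_maxr N1 N2))// ltnW//.
      by rewrite ltn_expl.
    have := le_trans (ltW h2) h3; rewrite ler_pdivrMr//; lra.
  have -> : F b - F a - (b - a) *: f t = - (F_ n b - F b)
      + (F_ n b - F_ n a - (b - a) *: f t) + (F_ n a - F a).
    rewrite opprB [F b - F_ n b + _]addrA subrKA [in RHS]addrAC subrKA//.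
  apply: le_trans (ler_normD _ _) _.
  apply: le_trans (lerD (ler_normD _ _) (lexx _)) _; rewrite normrN.
  apply: le_trans (lerD (lerD (h1 _ bb) (main n)) (h1 _ aa)) _.
  have -> : K * (b - a + dl n) * (b - a)
    = K * (b - a) * (b - a) + dl n * (K * (b - a)) by ring.
  lra.
have Kse : K * `|s - t| <= e.
  apply: (@le_trans _ _ ((1 + K) * (e / (1 + K)))).
    by rewrite ler_pM ?(ltW se)// lerDr.
  by rewrite mulrC divfK// gt_eqF.
have [st|ts] := leP s t.
  have := key s t s0 st; rewrite lerDl ler01 st lexx => /(_ isT isT).
  have -> : F t - F s - (t - s) *: f t = - (F s - F t - (s - t) *: f t).
    by rewrite opprB -scaleNr !opprB addrC.
  rewrite normrN => h; apply: (le_trans h).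
  have E : `|s - t| = t - s by rewrite distrC ger0_norm ?subr_ge0.
  by rewrite E in Kse *; rewrite ler_wpM2r ?subr_ge0.
have sT : s <= t + 1 by rewrite -lerBlDl; apply: le_trans (ler_norm _) (ltW s1).
have := key t s t0 (ltW ts) sT; rewrite lexx (ltW ts) => /(_ isT) h.
apply: (le_trans h); rewrite gtr0_norm ?subr_gt0// in Kse *.
by rewrite ler_wpM2r ?subr_ge0// ltW.
Qed.

End Primitive.

Section Picard.
Context {R : realType} {H : completeNormedModType R}.
Variable dot : {dot H for (idfun : R -> R)}.
Hypothesis hp : hilbert_product dot.

Lemma loc_lip_bounded (f : R -> H) (T : R) : loc_lip f ->
  exists2 B : R, 0 <= B & forall t : R, 0 <= t <= T -> `|f t| <= B.
Proof.
move=> fl; have [K K0 HK] := fl `|T|.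
exists (`|f 0| + K * `|T|); first by rewrite addr_ge0// mulr_ge0.
move=> t /andP[t0 tT]; rewrite -[f t](subrK (f 0)).
apply: le_trans (ler_normD _ _) _; rewrite addrC lerD2l.
have tT' : t <= `|T| by apply: le_trans tT (ler_norm _).
apply: le_trans (HK _ _ _ _) _; [by rewrite t0|by rewrite lexx/=|].
by rewrite subr0 ger0_norm// ler_wpM2l.
Qed.

Lemma hasd_loc_lip (F f : R -> H) :
  (forall T : R, exists2 B : R, 0 <= B & forall t : R, 0 <= t <= T -> `|f t| <= B) ->
  (forall t : R, 0 <= t -> hasd F t (f t)) -> loc_lip F.
Proof.
move=> fb Fd T; have [B B0 HB] := fb T; exists B => // s t.
wlog st : s t / s <= t.
  move=> W sT tT; have [|/ltW ts] := leP s t; first by move=> h; exact: W.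
  by rewrite distrC [`|s - t|]distrC; exact: W.
move=> /andP[s0 sT] /andP[t0 tT].
rewrite distrC [`|s - t|]distrC ger0_norm ?subr_ge0//.
apply: (mean_value_cst hp s0 st Fd) => r /andP[sr rt].
by apply: HB; rewrite (le_trans s0 sr) (le_trans rt tT).
Qed.

Lemma loc_lip_cst (x : H) : loc_lip (fun=> x).
Proof. by move=> T; exists 0 => // s t _ _; rewrite subrr normr0 mul0r. Qed.

Variables (f : R -> H -> H -> H) (L C0 : R) (x0 y0 : H).
Hypothesis L1 : 1 <= L.
Hypothesis f_lip : forall (t : R) x y x' y', 0 <= t ->
  `|f t x y - f t x' y'| <= L * (`|x - x'| + `|y - y'|).
Hypothesis f_time : forall T : R, exists2 K : R, 0 <= K & forall (s t : R) x y,
  0 <= s <= T -> 0 <= t <= T ->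
  `|f s x y - f t x y| <= K * `|s - t| * (1 + `|x| + `|y|).
Hypothesis f_init : forall t : R, 0 <= t -> `|f t x0 y0| <= C0.

Lemma loc_lip_field (u v : R -> H) : loc_lip u -> loc_lip v ->
  loc_lip (fun t => f t (u t) (v t)).
Proof.
move=> ul vl T; have [K K0 HK] := f_time T.
have [B1 B10 HB1] := loc_lip_bounded T ul.
have [B2 B20 HB2] := loc_lip_bounded T vl.
have [K1 K10 HK1] := ul T; have [K2 K20 HK2] := vl T.
have L0 : 0 <= L by apply: le_trans L1.
exists (K * (1 + B1 + B2) + L * (K1 + K2)).
  by rewrite addr_ge0// mulr_ge0// !addr_ge0.
move=> s t sT tT; have t0 : 0 <= t by case/andP: tT.
rewrite -[f s _ _](subrK (f t (u s) (v s))) -addrA mulrDl.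
apply: le_trans (ler_normD _ _) _; apply: lerD.
  apply: le_trans (HK _ _ _ _ sT tT) _; rewrite mulrAC ler_wpM2r//.
  by rewrite ler_wpM2l// !lerD// ?HB1 ?HB2.
apply: le_trans (f_lip _ _ _ _ t0) _; rewrite -mulrA ler_wpM2l// mulrDl.
by rewrite lerD// ?HK1 ?HK2.
Qed.

Definition primitive (h : R -> H) : R -> H :=
  xget (fun=> 0) [set F | F 0 = 0 /\ forall t : R, 0 <= t -> hasd F t (h t)].

Lemma primitiveP h : loc_lip h -> primitive h 0 = 0 /\
  forall t : R, 0 <= t -> hasd (primitive h) t (h t).
Proof.
move=> hl; rewrite /primitive; case: xgetP => [F _ []//|].
have [F F0 Fd] := primitive_exists hl.
by move=> /(_ F)/=; case.
Qed.

Fixpoint picard (n : nat) : (R -> H) * (R -> H) :=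
  if n is n'.+1 then
    ((fun t => x0 + primitive (picard n').2 t),
     (fun t => y0 + primitive (fun s => f s ((picard n').1 s) ((picard n').2 s)) t))
  else ((fun=> x0), (fun=> y0)).

Lemma picard_lip n : loc_lip (picard n).1 /\ loc_lip (picard n).2.
Proof.
have add_cst (x : H) h : loc_lip h -> loc_lip (fun t => x + primitive h t).
  move=> hl; have [_ Pd] := primitiveP hl.
  apply: (@hasd_loc_lip _ h); first by move=> T; exact: loc_lip_bounded.
  move=> t t0; rewrite -[h t]add0r; apply: hasdD (Pd _ t0); exact: hasd_cst.
elim: n => [|n [IH1 IH2]] /=; first by split; exact: loc_lip_cst.
by split; apply: add_cst => //; exact: loc_lip_field.
Qed.

Lemma picard_der1 n (t : R) : 0 <= t -> hasd (picard n.+1).1 t ((picard n).2 t).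
Proof.
move=> t0; have [_ Pd] := primitiveP (picard_lip n).2.
rewrite -[_.2 t]add0r; apply: hasdD (Pd _ t0); exact: hasd_cst.
Qed.

Lemma picard_der2 n (t : R) : 0 <= t ->
  hasd (picard n.+1).2 t (f t ((picard n).1 t) ((picard n).2 t)).
Proof.
move=> t0; have [_ Pd] := primitiveP (loc_lip_field (picard_lip n).1 (picard_lip n).2).
rewrite -[f t _ _]add0r; apply: hasdD (Pd _ t0); exact: hasd_cst.
Qed.

Lemma picard_init n : (picard n).1 0 = x0 /\ (picard n).2 0 = y0.
Proof.
case: n => [|n] //=.
have [-> _] := primitiveP (picard_lip n).2.
have [-> _] := primitiveP (loc_lip_field (picard_lip n).1 (picard_lip n).2).
by rewrite !addr0.
Qed.

(** With the weight [exp (4 L t)] every Picard step contracts by 1/2. *)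
Lemma picard_step n (t : R) : 0 <= t ->
  `|(picard n.+1).1 t - (picard n).1 t| + `|(picard n.+1).2 t - (picard n).2 t|
  <= (`|y0| + C0) / 2 ^+ n * expR (4 * L * t).
Proof.
have L0 : 0 < L by apply: lt_le_trans L1.
have C00 : 0 <= C0 by apply: le_trans (f_init (lexx 0)).
have ed (c : R) s : 0 <= s -> hasd ((fun r => c / (4 * L) * expR (4 * L * r)) : R -> R^o)
    s (c * expR (4 * L * s)).
  move=> _; apply: hasd_is_derive.
  have h := isder_scale (c / (4 * L)) (@is_derive1_comp R expR (fun r => 4 * L * r) s _ _
    (is_derive_expR _) (isder_scale (4 * L) (isder_id s))).
  by apply: (isder_eq h); field; rewrite gt_eqF.
elim: n t => [|n IH] t t0.
  have [P0 Pd] := primitiveP (loc_lip_cst y0).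
  have [Q0 Qd] := primitiveP (loc_lip_field (loc_lip_cst x0) (loc_lip_cst y0)).
  rewrite /= expr0 divr1 !(addrC _ (primitive _ _)) !addrK mulrDl.
  have te : t <= expR (4 * L * t).
    apply: le_trans (expR_ge1Dx _).
    have : t <= 4 * L * t by rewrite ler_peMl//; move: L1; lra.
    lra.
  apply: lerD.
    have := mean_value_cst hp (lexx 0) t0 Pd (k := `|y0|).
    rewrite P0 !subr0 => h; apply: le_trans (h _) _ => //.
    by rewrite ler_wpM2l.
  have := mean_value_cst hp (lexx 0) t0 Qd (k := C0).
  rewrite Q0 !subr0 => h; apply: le_trans (h _) _.
    by move=> s /andP[s0 _]; exact: f_init.
  by rewrite ler_wpM2l.
set c := (`|y0| + C0) / 2 ^+ n in IH *.
have c0 : 0 <= c by rewrite divr_ge0 ?exprn_ge0// addr_ge0.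
have -> : (`|y0| + C0) / 2 ^+ n.+1 = c / 2.
  by rewrite /c exprS invfM mulrAC mulrA mulrAC.
have [I1 I2] := picard_init n.+1; have [J1 J2] := picard_init n.+2.
have E1 : 1 <= expR (4 * L * 0) :> R by rewrite mulr0 expR0.
have h1 : `|(picard n.+2).1 t - (picard n.+1).1 t| <= c / (4 * L) * expR (4 * L * t).
  have := mean_value_ineq hp (lexx 0) t0
    (fun s s0 => hasdB (picard_der1 n.+1 s0) (picard_der1 n s0)) (ed c).
  rewrite I1 J1 subrr subr0 => h; apply: le_trans (h _) _.
    move=> s /andP[s0 st]; apply: le_trans (IH _ s0).
    by rewrite lerDr.
  by rewrite gerBl mulr_ge0 ?expR_ge0// divr_ge0// mulr_ge0 ?(ltW L0).
have h2 : `|(picard n.+2).2 t - (picard n.+1).2 t|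
    <= (L * c) / (4 * L) * expR (4 * L * t).
  have := mean_value_ineq hp (lexx 0) t0
    (fun s s0 => hasdB (picard_der2 n.+1 s0) (picard_der2 n s0)) (ed (L * c)).
  rewrite I2 J2 subrr subr0 => h; apply: le_trans (h _) _.
    move=> s /andP[s0 st]; apply: le_trans (f_lip _ _ _ _ s0) _.
    by rewrite -mulrA ler_wpM2l ?(ltW L0)// IH.
  have q0 : 0 <= L * c / (4 * L).
    by apply: divr_ge0; apply: mulr_ge0 => //; exact: ltW.
  by rewrite gerBl; apply: mulr_ge0 => //; exact: expR_ge0.
apply: le_trans (lerD h1 h2) _; rewrite -mulrDl ler_wpM2r ?expR_ge0//.
have -> : c / (4 * L) + L * c / (4 * L) = (1 + L) / (4 * L) * c.
  by field; rewrite gt_eqF.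
rewrite [leRHS]mulrC ler_wpM2r// ler_pdivrMr ?mulr_gt0//; move: L1; lra.
Qed.

(** The field is globally Lipschitz in the state, so the iterates converge on the
whole half-line. Its regularity in time keeps the iterates locally Lipschitz,
which provides their primitives. *)
Theorem second_order_picard : exists u v : R -> H,
  [/\ u 0 = x0, v 0 = y0, (forall t : R, 0 <= t -> hasd u t (v t)) &
      forall t : R, 0 <= t -> hasd v t (f t (u t) (v t))].
Proof.
have L0 : 0 < L by apply: lt_le_trans L1.
have C00 : 0 <= C0 by apply: le_trans (f_init (lexx 0)).
have bnd (T t : R) n : 0 <= t <= T ->
    (`|y0| + C0) / 2 ^+ n * expR (4 * L * t)
    <= (`|y0| + C0) * expR (4 * L * T) / 2 ^+ n.
  move=> /andP[_ tT]; rewrite mulrAC ler_wpM2r ?invr_ge0 ?exprn_ge0//.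
  by rewrite ler_wpM2l ?addr_ge0// ler_expR ler_wpM2l// mulr_ge0// ltW.
have Cp T : 0 <= (`|y0| + C0) * expR (4 * L * T).
  by rewrite mulr_ge0 ?expR_ge0 ?addr_ge0.
have c1 : luc_cauchy (fun n => (picard n).1).
  apply: geometric_luc_cauchy => T; exists ((`|y0| + C0) * expR (4 * L * T)) => //.
  move=> n t tT; apply: le_trans (bnd T t n tT); have /andP[t0 _] := tT.
  by apply: le_trans (picard_step n t0); rewrite lerDl.
have c2 : luc_cauchy (fun n => (picard n).2).
  apply: geometric_luc_cauchy => T; exists ((`|y0| + C0) * expR (4 * L * T)) => //.
  move=> n t tT; apply: le_trans (bnd T t n tT); have /andP[t0 _] := tT.
  by apply: le_trans (picard_step n t0); rewrite lerDr.
have [u uu] := luc_complete c1; have [v vv] := luc_complete c2.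
have shift (w_ : nat -> R -> H) w : luc w_ w -> luc (fun n => w_ n.+1) w.
  move=> h T e e0; have [N HN] := h T e e0; exists N => n Nn.
  by apply: HN; exact: leqW.
have contp n (t : R) : 0 <= t -> hcont (picard n).1 t /\ hcont (picard n).2 t.
  by move=> t0; split; apply: loc_lip_cont => //; have [] := picard_lip n.
have cstl (x : H) (w_ : nat -> R -> H) w : luc w_ w -> (forall n, w_ n 0 = x) -> w 0 = x.
  move=> h wx; have k : luc w_ (fun t => if t == 0 then x else w t).
    move=> T e e0; have [N HN] := h T e e0; exists N => n Nn t tT.
    by case: eqP => [->|_]; [rewrite wx subrr normr0 ltW|exact: HN].
  by rewrite (luc_unique h k (lexx 0)) eqxx.
have fl : luc (fun n t => f t ((picard n).1 t) ((picard n).2 t)) (fun t => f t (u t) (v t)).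
  move=> T e e0; have e2 : 0 < e / (2 * L) by rewrite divr_gt0// mulr_gt0.
  have [N1 HN1] := uu T _ e2; have [N2 HN2] := vv T _ e2.
  exists (maxn N1 N2) => n; rewrite geq_max => /andP[n1 n2] t tT.
  have /andP[t0 _] := tT.
  apply: le_trans (f_lip _ _ _ _ t0) _.
  apply: le_trans (ler_wpM2l (ltW L0) (lerD (HN1 _ n1 _ tT) (HN2 _ n2 _ tT))) _.
  by rewrite le_eqVlt; apply/orP; left; apply/eqP; field; rewrite gt_eqF.
exists u, v; split.
- by apply: (cstl _ _ _ uu) => n; have [] := picard_init n.
- by apply: (cstl _ _ _ vv) => n; have [] := picard_init n.
- apply: (luc_derivative hp _ (shift _ _ uu) vv).
    by move=> n t t0; exact: picard_der1.
  by move=> n t t0; have [] := contp n t t0.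
apply: (luc_derivative hp _ (shift _ _ vv) fl).
  by move=> n t t0; exact: picard_der2.
move=> n t t0; apply: loc_lip_cont => //.
by apply: loc_lip_field; have [] := picard_lip n.
Qed.

End Picard.

(** * Integration with respect to a projection-valued measure *)

Section SpectralMeasure.
Context {R : realType} {H : completeNormedModType R}.
Variable dot : {dot H for (idfun : R -> R)}.
Hypothesis hp : hilbert_product dot.
Variable E : set R -> H -> H.
Hypothesis pvm : projection_valued_measure dot E.
Implicit Types (x y z : H) (Q S : set R).

Lemma E_linear Q (a : R) x y : measurable Q -> E Q (a *: x + y) = a *: E Q x + E Q y.
Proof. by case: pvm => h _ _ _ mQ; have [l _ _] := h _ mQ; exact: l. Qed.

Lemma E_sym Q x y : measurable Q -> dot (E Q x) y = dot x (E Q y).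
Proof. by case: pvm => h _ _ _ mQ; have [_ _ s] := h _ mQ; exact: s. Qed.

Lemma E_cap Q S x : measurable Q -> measurable S -> E (Q `&` S) x = E Q (E S x).
Proof. by case: pvm => _ _ h _ mQ mS; exact: h. Qed.

Lemma E_idem Q x : measurable Q -> E Q (E Q x) = E Q x.
Proof. by move=> mQ; rewrite -E_cap// setIid. Qed.

Lemma E_setT x : E setT x = x.
Proof. by case: pvm. Qed.

Lemma mass_sq Q x : measurable Q -> dot (E Q x) x = `|E Q x| ^+ 2.
Proof. by move=> mQ; rewrite -hp -E_sym// E_idem. Qed.

Lemma E_0 Q : measurable Q -> E Q 0 = 0.
Proof. by move=> mQ; have := E_linear (-1) 0 0 mQ; rewrite scaler0 addr0 scaleN1r addNr. Qed.

Lemma E_D Q x y : measurable Q -> E Q (x + y) = E Q x + E Q y.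
Proof. by move=> mQ; rewrite -[x]scale1r E_linear// !scale1r. Qed.

Lemma E_Z Q (a : R) x : measurable Q -> E Q (a *: x) = a *: E Q x.
Proof. by move=> mQ; rewrite -[a *: x]addr0 E_linear// E_0// addr0. Qed.

Lemma E_B Q x y : measurable Q -> E Q (x - y) = E Q x - E Q y.
Proof. by move=> mQ; rewrite E_D// -scaleN1r E_Z// scaleN1r. Qed.

Lemma E_contract Q x : measurable Q -> `|E Q x| <= `|x|.
Proof.
move=> mQ; have [->|x0] := eqVneq (E Q x) 0; first by rewrite normr0.
have p : 0 < `|E Q x| by rewrite normr_gt0.
rewrite -(ler_pM2l p) -expr2 -mass_sq//.
by apply: le_trans (ler_norm _) _; exact: cauchy_schwarz.
Qed.

Let mass Q x : \bar R := if pselect (measurable Q) then spectral_mass dot E x Q else 0%E.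

(** Off the measurable sets the values of [E] are arbitrary, so that the mass
has to be redefined there before it is a measure. *)
Lemma spectral_measure_exists x : exists mu : {measure set R -> \bar R},
  forall Q, measurable Q -> mu Q = (dot (E Q x) x)%:E.
Proof.
pose mu Q := mass Q x.
have muE Q : measurable Q -> mu Q = (dot (E Q x) x)%:E.
  by move=> mQ; rewrite /mu /mass; case: pselect.
have sadd : semi_sigma_additive mu.
  move=> F mF tF mU; rewrite muE//.
  have -> : (fun n => (\sum_(0 <= i < n) mu (F i))%E) =
            (fun n => (\sum_(0 <= i < n) spectral_mass dot E x (F i))%E).
    by apply/funext => n; apply: eq_bigr => i _; rewrite muE.
  by case: pvm => _ _ _ h; exact: h.
have mu00 : mu set0 = 0%E.
  have := sadd (fun=> set0) (fun=> measurable0) (@trivIset_set0 _ _ setT).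
  rewrite bigcup0// => /(_ measurable0) h.
  rewrite muE//; congr (_%:E).
  set c := dot _ _; have c0 : 0 <= c by rewrite /c mass_sq// sqr_ge0.
  have h1 : (fun n => (\sum_(0 <= i < n) mu set0)%E) = (fun n => (n%:R * c)%:E).
    apply/funext => n; rewrite muE// -/c sumEFin; congr (_%:E).
    by rewrite big_const_nat subn0 iter_addr addr0 mulr_natl.
  rewrite h1 muE// -/c in h.
  have /fine_cvg := h; rewrite /comp/= => {h1}h.
  apply/eqP; rewrite eq_le c0 andbT leNgt; apply/negP => cp.
  move/cvgrPdist_lt: h => /(_ _ cp)[N _ HN].
  have := HN (maxn N 2) (leq_maxl _ _); rewrite /= distrC.
  rewrite -{2}[c]mul1r -mulrBl normrM (gtr0_norm cp) -{2}[c]mul1r ltr_pM2r//.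
  have h2 : (2 : R) <= (maxn N 2)%:R by rewrite (ler_nat R 2) leq_maxr.
  by rewrite ger0_norm; lra.
have mu_ge0 Q : (0 <= mu Q)%E.
  rewrite /mu /mass; case: pselect => //= mQ.
  by rewrite lee_fin mass_sq// sqr_ge0.
pose muM : {measure set R -> \bar R} := HB.pack mu (isMeasure.Build _ _ _ mu mu00 mu_ge0 sadd).
by exists muM.
Qed.

(** The spectral measure of the vector [x]. *)
Definition m_ x : {measure set R -> \bar R} := sval (cid (spectral_measure_exists x)).

Lemma m_E x Q : measurable Q -> m_ x Q = (dot (E Q x) x)%:E.
Proof. exact: (svalP (cid (spectral_measure_exists x))). Qed.

Lemma m_T x : m_ x setT = (`|x| ^+ 2)%:E.
Proof. by rewrite m_E// E_setT hp. Qed.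

Import HBNNSimple.

(** The integral evaluates the set function at measurable sets only. *)
Lemma m_integral x (f : R -> \bar R) :
  (\int[spectral_mass dot E x]_l f l = \int[m_ x]_l f l)%E.
Proof.
rewrite /integral.
have s (h : {nnsfun R >-> R}) : sintegral (spectral_mass dot E x) h = sintegral (m_ x) h.
  pose G (g : R -> \bar R) := (\sum_(r \in [set: R]) (r%:E * g r))%E.
  change (G (fun r => spectral_mass dot E x (h @^-1` [set r])) =
    G (fun r => m_ x (h @^-1` [set r]))).
  by congr G; apply/funext => r; rewrite m_E.
have e (g : R -> \bar R) :
    [set sintegral (spectral_mass dot E x) h | h in
      [set h : {nnsfun R >-> R} | forall r : R, ((h r)%:E <= g r)%E]] =
    [set sintegral (m_ x) h | h in
      [set h : {nnsfun R >-> R} | forall r : R, ((h r)%:E <= g r)%E]].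
  by apply/seteqP; split => y [h hg <-]; exists h.
by rewrite /=; congr (_ - _)%E; congr (ereal_sup _); rewrite -e.
Qed.

End SpectralMeasure.

Section SpectralIntegral.
Context {R : realType} {H : completeNormedModType R}.
Variable dot : {dot H for (idfun : R -> R)}.
Hypothesis hp : hilbert_product dot.
Variable E : set R -> H -> H.
Hypothesis pvm : projection_valued_measure dot E.
Implicit Types (x y z : H) (Q S : set R) (f : R -> R).

Local Notation m_ := (m_ hp pvm).

Lemma E_set0 x : E set0 x = 0.
Proof.
apply/eqP; rewrite -normr_eq0 -sqrf_eq0 -(mass_sq hp pvm)//.
by have := m_E hp pvm x measurable0; rewrite measure0 => /(congr1 fine)/= <-.
Qed.

Lemma E_disjoint Q S x : measurable Q -> measurable S -> Q `&` S = set0 ->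
  E Q (E S x) = 0.
Proof. by move=> mQ mS h; rewrite -(E_cap pvm)// h E_set0. Qed.

Lemma m_null Q S x : measurable Q -> measurable S -> E Q x = x -> S `&` Q = set0 ->
  m_ x S = 0%E.
Proof. by move=> mQ mS Qx h; rewrite m_E// -Qx E_disjoint// dot0l. Qed.

Lemma bounded_integral f Q (al be : R) x : measurable_fun setT f -> measurable Q ->
  al <= be -> (forall l, Q l -> al <= f l <= be) -> E Q x = x ->
  exists r : R, (\int[m_ x]_l (f l)%:E)%E = r%:E /\ al * `|x| ^+ 2 <= r <= be * `|x| ^+ 2.
Proof.
move=> mf mQ ab fQ Qx.
pose g l := Num.max al (Num.min be (f l)).
have gb l : al <= g l <= be.
  by rewrite /g le_max lexx/= ge_max ab ge_min lexx.
have mg : measurable_fun setT g.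
  by apply: measurable_maxr => //; apply: measurable_minr.
have mT : measurable (setT : set R) by [].
have fin : (m_ x setT < +oo)%E by rewrite m_T ltry.
have gi : (m_ x).-integrable setT (EFin \o g).
  apply: measurable_bounded_integrable => //.
  exists (Num.max `|al| `|be|); split; first by rewrite num_real.
  move=> M hM l _ /=; apply: le_trans (ltW hM).
  have /andP[g1 g2] := gb l.
  have := ler_norm be; have := ler_norm (- al); rewrite normrN => a1 b1.
  rewrite ler_norml; apply/andP; split.
    by apply: le_trans g1; rewrite lerNl; apply: le_trans a1 _; rewrite le_max lexx.
  by apply: le_trans g2 _; apply: le_trans b1 _; rewrite le_max lexx orbT.
have ci (c : R) : (m_ x).-integrable setT (EFin \o cst c).
  apply: measurable_bounded_integrable => //.
  exists `|c|; split; first by rewrite num_real.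
  by move=> M hM l _ /=; exact: ltW.
have int_c (c : R) : (\int[m_ x]_l (EFin \o cst c) l = (c * `|x| ^+ 2)%:E)%E.
  rewrite (_ : EFin \o cst c = cst c%:E)// integral_cst// m_T//.
have E1 : (\int[m_ x]_l (f l)%:E = \int[m_ x]_l (g l)%:E)%E.
  apply: ae_eq_integral => //; [exact/measurable_EFinP|exact/measurable_EFinP|].
  exists (~` Q); split; first exact: measurableC.
    by apply: (m_null mQ) => //; [exact: measurableC|exact: setICl].
  move=> l /= h Ql; apply: h => _; congr (_%:E).
  have /andP[h1 h2] := fQ _ Ql.
  by rewrite /g (min_idPr h2) (max_idPr h1).
have l1 : (\int[m_ x]_l (EFin \o cst al) l <= \int[m_ x]_l (EFin \o g) l)%E.
  by apply: le_integral => // l _; rewrite lee_fin; case/andP: (gb l).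
have l2 : (\int[m_ x]_l (EFin \o g) l <= \int[m_ x]_l (EFin \o cst be) l)%E.
  by apply: le_integral => // l _; rewrite lee_fin; case/andP: (gb l).
rewrite !int_c in l1 l2.
exists (fine (\int[m_ x]_l (g l)%:E)).
have fing : (\int[m_ x]_l (g l)%:E)%E \is a fin_num by exact: integrable_fin_num.
by rewrite E1 fineK//; split => //; rewrite -!lee_fin fineK// l1 l2.
Qed.

(** Identities between the quadratic forms [<E_S x, x>] are identities between
measures, hence they can be integrated. *)
Lemma integral_of_mass_identity (k : {nonneg R}) x1 x2 x3 y1 y2 y3 f :
  measurable_fun setT f -> (forall l, 0 <= f l) ->
  (forall S, measurable S ->
     dot (E S x1) x1 + k%:num * dot (E S x2) x2 + dot (E S x3) x3 =
     dot (E S y1) y1 + k%:num * dot (E S y2) y2 + dot (E S y3) y3) ->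
  (\int[m_ x1]_l (f l)%:E + k%:num%:E * \int[m_ x2]_l (f l)%:E + \int[m_ x3]_l (f l)%:E =
   \int[m_ y1]_l (f l)%:E + k%:num%:E * \int[m_ y2]_l (f l)%:E + \int[m_ y3]_l (f l)%:E)%E.
Proof.
move=> mf f0 h.
have mF : measurable_fun setT (EFin \o f) by exact/measurable_EFinP.
have f0' l : setT l -> (0 <= (EFin \o f) l)%E by rewrite lee_fin.
have sum z1 z2 z3 : (\int[m_ z1]_l (f l)%:E + k%:num%:E * \int[m_ z2]_l (f l)%:E
    + \int[m_ z3]_l (f l)%:E =
    \int[measure_add (measure_add (m_ z1) (mscale k (m_ z2))) (m_ z3)]_l (f l)%:E)%E.
  rewrite ge0_integral_measure_add// ge0_integral_measure_add//.
  by rewrite ge0_integral_mscale.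
rewrite !sum; apply: eq_measure_integral => S mS _.
have sumS z1 z2 z3 : measure_add (measure_add (m_ z1) (mscale k (m_ z2))) (m_ z3) S =
    (dot (E S z1) z1 + k%:num * dot (E S z2) z2 + dot (E S z3) z3)%:E.
  apply: etrans (measure_addE _ _ _) _.
  apply: etrans (congr1 (fun w => (w + m_ z3 S)%E) (measure_addE _ _ _)) _.
  change ((m_ z1 S + k%:num%:E * m_ z2 S + m_ z3 S)%E =
    (dot (E S z1) z1 + k%:num * dot (E S z2) z2 + dot (E S z3) z3)%:E).
  by rewrite !m_E// -EFinM -!EFinD.
apply: etrans (sumS _ _ _) _; apply: esym; apply: etrans (sumS _ _ _) _.
by rewrite h.
Qed.

End SpectralIntegral.

Section SpectralOperator.
Context {R : realType} {H : completeNormedModType R}.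
Variable dot : {dot H for (idfun : R -> R)}.
Hypothesis hp : hilbert_product dot.
Variable E : set R -> H -> H.
Hypothesis pvm : projection_valued_measure dot E.
Implicit Types (x y z : H) (Q S : set R) (f : R -> R).

Local Notation m_ := (m_ hp pvm).

Lemma E_polar Q x y : measurable Q ->
  dot (E Q x) y = (dot (E Q (x + y)) (x + y) - dot (E Q (x - y)) (x - y)) / 4.
Proof.
move=> mQ; rewrite (E_D pvm)// (E_B pvm)// !(dotDl, dotDr, dotNl, dotNr).
rewrite (E_sym pvm y x mQ) (dotC _ y).
by field.
Qed.

Lemma E_setU Q S x : measurable Q -> measurable S -> Q `&` S = set0 ->
  E (Q `|` S) x = E Q x + E S x.
Proof.
move=> mQ mS QS; have mU := measurableU _ _ mQ mS.
have q z : dot (E (Q `|` S) z) z = dot (E Q z) z + dot (E S z) z.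
  have h : (m_ z (Q `|` S) = m_ z Q + m_ z S)%E by exact: measureU.
  by move: h; rewrite !m_E// -EFinD => -[].
apply/eqP; rewrite -subr_eq0; apply/eqP; apply: (dot_eq0P hp) => y.
by rewrite dotBl dotDl (E_polar x y mU) (E_polar x y mQ) (E_polar x y mS) !q; field.
Qed.

Lemma E_comm Q S x : measurable Q -> measurable S -> E Q (E S x) = E S (E Q x).
Proof. by move=> mQ mS; rewrite -!(E_cap pvm)// setIC. Qed.

Section Operator.
Variables (f : R -> R) (B : operator H).
Hypothesis mf : measurable_fun setT f.
Hypothesis Bf : spectral_integral dot E f B.

Lemma spectral_domP x : opdom B x <-> (\int[m_ x]_l ((f l) ^+ 2)%:E < +oo)%E.
Proof. by case: Bf => -> _; rewrite /= (m_integral hp pvm). Qed.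

Lemma spectral_form x y : opdom B x -> opdom B y -> dot (B x) y =
  (fine (\int[m_ (x + y)%R]_l (f l)%:E) - fine (\int[m_ (x - y)%R]_l (f l)%:E)) / 4.
Proof. by case: Bf => _ h Bx By; rewrite h// !(m_integral hp pvm). Qed.

Let mf2 : measurable_fun setT (fun l => f l ^+ 2).
Proof. exact: measurable_funX. Qed.

Lemma spectral_dom_bounded Q (K : R) x : measurable Q -> 0 <= K ->
  (forall l, Q l -> f l ^+ 2 <= K) -> E Q x = x -> opdom B x.
Proof.
move=> mQ K0 fK Qx; apply/spectral_domP.
have [|r [-> _]] := bounded_integral hp pvm mf2 mQ K0 _ Qx; last by rewrite ltry.
by move=> l Ql; rewrite sqr_ge0 fK.
Qed.

Lemma spectral_form_bounds Q (al be : R) x : measurable Q -> al <= be ->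
  (forall l, Q l -> al <= f l <= be) -> E Q x = x -> opdom B x ->
  al * `|x| ^+ 2 <= dot (B x) x <= be * `|x| ^+ 2.
Proof.
move=> mQ ab fQ Qx Bx; rewrite spectral_form//.
have Q2 : E Q (x + x) = x + x by rewrite (E_D pvm)// Qx.
have [r [-> /andP[r1 r2]]] := bounded_integral hp pvm mf mQ ab fQ Q2.
rewrite subrr; have [s [-> ]] := bounded_integral hp pvm mf mQ ab fQ (E_0 pvm mQ).
rewrite normr0 expr0n/= !mulr0 => /andP[s1 s2] /=.
have s0 : s = 0 by apply/eqP; rewrite eq_le s1 s2.
have nE : `|x + x| ^+ 2 = 4 * `|x| ^+ 2.
  by rewrite -mulr2n normrMn -[_ *+ 2]mulr_natl exprMn; ring.
rewrite nE in r1 r2; rewrite s0 subr0; apply/andP; split; lra.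
Qed.

(** [x + y] and [x - y] have the same spectral measure. *)
Lemma spectral_orthogonal Q x y : measurable Q -> E Q x = x -> E Q y = 0 ->
  opdom B x -> opdom B y -> dot (B x) y = 0.
Proof.
move=> mQ Qx Qy Bx By; rewrite spectral_form//.
suff -> : (\int[m_ (x + y)%R]_l (f l)%:E = \int[m_ (x - y)%R]_l (f l)%:E)%E.
  by rewrite subrr mul0r.
apply: eq_measure_integral => S mS _; rewrite !m_E//; congr (_%:E).
have h : dot (E S x) y = 0.
  by rewrite -Qx E_comm// (E_sym pvm)// Qy dot0r.
rewrite (E_D pvm)// (E_B pvm)// !(dotDl, dotDr, dotNl, dotNr).
by rewrite h (E_sym pvm y x mS) (dotC _ y) h; ring.
Qed.

Lemma spectral_sym x y : opdom B x -> opdom B y -> dot (B x) y = dot x (B y).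
Proof.
move=> Bx By; rewrite [RHS]dotC !spectral_form// [y + x]addrC.
congr ((_ - fine _) / _); apply: eq_measure_integral => S mS _.
rewrite !m_E//; congr (_%:E); rewrite !(E_B pvm)// !(dotDl, dotDr, dotNl, dotNr); ring.
Qed.

Hypothesis Blin : linear_operator B.
Hypothesis Bdense : forall x, (forall y, opdom B y -> dot x y = 0) -> x = 0.

Let B0 : opdom B 0. Proof. by case: Blin. Qed.

Let BD x y : opdom B x -> opdom B y -> opdom B (x + y) /\ B (x + y) = B x + B y.
Proof.
by case: Blin => _ h Bx By; have := h 1 _ _ Bx By; rewrite !scale1r.
Qed.

Let BN x : opdom B x -> opdom B (- x) /\ B (- x) = - B x.
Proof.
case: Blin => _ h Bx; have [] := h (-1) x 0 Bx B0.
have [] := h (-1) 0 0 B0 B0; rewrite scaler0 addr0 scaleN1r addNr => _ e.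
by rewrite addr0 e addr0 !scaleN1r.
Qed.

(** By [spectral_orthogonal], [B (E Q x)] is orthogonal to the range of the
complementary projection; commutation then follows from symmetry. *)
Lemma spectral_commute Q (K : R) : measurable Q -> 0 <= K ->
  (forall l, Q l -> f l ^+ 2 <= K) ->
  (forall x, opdom B (E Q x)) /\ (forall x, E Q (B (E Q x)) = B (E Q x)) /\
  (forall x, opdom B x -> B (E Q x) = E Q (B x)).
Proof.
move=> mQ K0 fK.
have d x : opdom B (E Q x) by apply: spectral_dom_bounded fK _ => //; exact: E_idem pvm _ _ mQ.
have rng x : E Q (B (E Q x)) = B (E Q x).
  apply/eqP; rewrite eq_sym -subr_eq0; apply/eqP; apply: Bdense => y By.
  rewrite dotBl (E_sym pvm)// -dotBr.
  have [dN _] := BN (d y); have [dB _] := BD By dN.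
  apply: (spectral_orthogonal mQ) => //; first exact: E_idem pvm _ _ mQ.
  by rewrite (E_B pvm)// (E_idem pvm)// subrr.
split => //; split => // x Bx.
apply/eqP; rewrite -subr_eq0; apply/eqP; apply: Bdense => y By.
rewrite dotBl -[B (E Q x)]rng !(E_sym pvm)// !spectral_sym//.
by rewrite (E_sym pvm)// rng subrr.
Qed.

End Operator.

(** Cauchy-Schwarz for the positive form of [B] turns a bound of the form into
a bound of the operator. *)
Lemma form_norm_bound (B : H -> H) (D : set H) (be : R) x : 0 <= be ->
  (forall (a : R) x y, D x -> D y -> D (a *: x + y) /\ B (a *: x + y) = a *: B x + B y) ->
  (forall x, D x -> D (B x)) ->
  (forall x y, D x -> D y -> dot (B x) y = dot x (B y)) ->
  (forall x, D x -> 0 <= dot (B x) x <= be * `|x| ^+ 2) -> D x ->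
  `|B x| <= be * `|x|.
Proof.
move=> be0 lin inv sym bnd Dx.
have [->|Bx0] := eqVneq (B x) 0; first by rewrite normr0 mulr_ge0.
have DB := inv _ Dx.
have key : dot (B x) (B x) ^+ 2 <= dot (B x) x * dot (B (B x)) (B x).
  apply: discriminant; last by case/andP: (bnd _ DB).
  move=> s; have [Dy By] := lin s _ _ DB Dx; have /andP[+ _] := bnd _ Dy.
  rewrite By !(dotDl, dotDr, dotZl, dotZr) (sym (B x) x)//.
  by congr (_ <= _); ring.
have /andP[_ b1] := bnd _ Dx; have /andP[b2 b3] := bnd _ DB.
have p : 0 < `|B x| by rewrite normr_gt0.
have : dot (B x) (B x) ^+ 2 <= be * `|x| ^+ 2 * (be * `|B x| ^+ 2).
  apply: le_trans key _; apply: ler_pM => //.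
  by case/andP: (bnd _ Dx).
rewrite hp => h.
rewrite -ler_sqr ?nnegrE ?mulr_ge0// -(ler_pM2r (_ : 0 < `|B x| ^+ 2)) ?exprn_gt0//.
rewrite -expr2; apply: le_trans h _.
by rewrite le_eqVlt; apply/orP; left; apply/eqP; ring.
Qed.

End SpectralOperator.

(** * The square root and the spectral truncations *)

(** Everything that the evolution problem needs from spectral theory: [P n] is
the projection on the part of the spectrum below [n ^ 2], and [S] is the square
root of [A]. *)
Record truncation (R : realType) (H : completeNormedModType R)
    (dot : {dot H for (idfun : R -> R)}) (A S : operator H)
    (P : nat -> H -> H) : Prop := {
  tr_lin : forall n (a : R) x y, P n (a *: x + y) = a *: P n x + P n y;
  tr_mono : forall m n x, (m <= n)%N -> P m (P n x) = P m x /\ P n (P m x) = P m x;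
  tr_contract : forall n x, `|P n x| <= `|x|;
  tr_cvg : forall x (e : R), 0 < e ->
    exists N, forall n, (N <= n)%N -> `|P n x - x| <= e;
  tr_domA : forall n x, opdom A (P n x);
  tr_domS : forall n x, opdom S (P n x);
  tr_rngA : forall n x, P n (A (P n x)) = A (P n x);
  tr_bndA : forall n x, `|A (P n x)| <= n%:R ^+ 2 * `|x|;
  tr_bndS : forall n x, `|S (P n x)| <= n%:R * `|x|;
  tr_comA : forall n x, opdom A x -> A (P n x) = P n (A x);
  tr_comS : forall n x, opdom S x -> S (P n x) = P n (S x);
  tr_linA : linear_operator A;
  tr_linS : linear_operator S;
  tr_domAS : forall x, opdom A x -> opdom S x;
  tr_form : forall x y, opdom A x -> opdom S y -> dot (A x) y = dot (S x) (S y);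
  tr_closedA : forall x y, (forall e : R, 0 < e ->
    exists z, [/\ opdom A z, `|z - x| <= e & `|A z - y| <= e]) ->
    opdom A x /\ A x = y;
  tr_closedS : forall x y, (forall e : R, 0 < e ->
    exists z, [/\ opdom S z, `|z - x| <= e & `|S z - y| <= e]) ->
    opdom S x /\ S x = y }.

Section SquareRoot.
Context {R : realType} {H : completeNormedModType R}.
Variable dot : {dot H for (idfun : R -> R)}.
Hypothesis hp : hilbert_product dot.
Variable E : set R -> H -> H.
Hypothesis pvm : projection_valued_measure dot E.
Implicit Types (x y z : H) (Q : set R).
Variables (A S : operator H).
Hypothesis Alin : linear_operator A.
Hypothesis Adense : densely_defined A.
Hypothesis Asa : selfadjoint dot A.
Hypothesis Ann : nonnegative dot A.
Hypothesis AE : spectral_integral dot E id A.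
Hypothesis SE : spectral_integral dot E (fun l => l `^ (1 / 2)) S.

Local Notation m_ := (m_ hp pvm).
Let rt (l : R) : R := l `^ (1 / 2).

Let mid : measurable_fun setT (id : R -> R). Proof. by []. Qed.
Let mrt : measurable_fun setT rt. Proof. exact: measurable_powR. Qed.
Let rtsq (l : R) : R := rt l ^+ 2.
Let mrt2 : measurable_fun setT rtsq.
Proof. exact: measurable_funX. Qed.
Let rt_ge0 l : 0 <= rt l. Proof. exact: powR_ge0. Qed.

Let rt2 l : 0 <= l -> rt l ^+ 2 = l.
Proof.
move=> l0; rewrite /rt expr2 -powRD.
  by rewrite -splitr powRr1.
by apply/implyP => /eqP h; exfalso; lra.
Qed.

Let rt2_le l : rt l ^+ 2 <= 1 + l ^+ 2.
Proof.
have [l0|l0] := leP 0 l.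
  by rewrite rt2//; have := sqr_ge0 (l - 1); rewrite sqrrB1; lra.
have -> : rt l = 1.
  by rewrite /rt /powR lt_eqF// ln0 ?mulr0 ?expR0// ltW.
by rewrite expr1n lerDl sqr_ge0.
Qed.

Lemma dense_approx x (e : R) : 0 < e -> exists2 y, opdom A y & `|x - y| < e.
Proof.
move=> e0; have : closure (opdom A) x by rewrite Adense.
move=> /(_ (ball x e) (nbhsx_ballx x _ e0)) [y [Ay]].
by rewrite -ball_normE /ball_/= => h; exists y.
Qed.

Lemma dense_test x : (forall y, opdom A y -> dot x y = 0) -> x = 0.
Proof.
move=> h; apply/eqP; apply/negPn/negP => x0.
have p : 0 < `|x| by rewrite normr_gt0.
have [y Ay xy] := dense_approx x p.
have : `|x| ^+ 2 <= `|x| * `|x - y|.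
  rewrite -hp -[X in dot x X](subrK y) dotDr (h _ Ay) addr0.
  by apply: le_trans (ler_norm _) _; exact: cauchy_schwarz.
by rewrite expr2 ler_pM2l// leNgt xy.
Qed.

(** A self-adjoint operator is its own adjoint, and adjoints are closed. *)
Lemma A_closed x y : (forall e : R, 0 < e ->
    exists z, [/\ opdom A z, `|z - x| <= e & `|A z - y| <= e]) ->
  opdom A x /\ A x = y.
Proof.
move=> h; apply/Asa => z Az; apply/eqP; rewrite -subr_eq0 -normr_eq0.
rewrite eq_le normr_ge0 andbT; apply/ler_addgt0Pl => e e0; rewrite addr0.
have C0 : 0 < 1 + `|z| + `|A z| by rewrite ltr_wpDr ?ltr_wpDr ?ltr01.
have [w [Aw w1 w2]] := h (e / (1 + `|z| + `|A z|)) (divr_gt0 e0 C0).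
have adj : dot (A z) w = dot z (A w).
  by have /Asa := conj Aw (erefl (A w)); apply.
have -> : dot (A z) x - dot z y = dot z (A w - y) - dot (A z) (w - x).
  by rewrite !dotBr adj; ring.
apply: le_trans (ler_normB _ _) _.
apply: (@le_trans _ _ (`|z| * (e / (1 + `|z| + `|A z|)) +
    `|A z| * (e / (1 + `|z| + `|A z|)))).
  by apply: lerD; apply: le_trans (cauchy_schwarz hp _ _) _; rewrite ler_wpM2l.
rewrite -mulrDl; apply: (@le_trans _ _ ((1 + `|z| + `|A z|) * (e / (1 + `|z| + `|A z|)))).
  rewrite ler_wpM2r ?divr_ge0 ?(ltW e0) ?(ltW C0)// -addrA lerDr ler01//.
by rewrite mulrC divfK// gt_eqF.
Qed.

(** The half-line is the union of the intervals [[- (k + 1), - 1 / (k + 1)]], and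
[A] would be at most [- 1 / (k + 1)] on the corresponding spectral subspace. *)
Lemma E_negative x : E `]-oo, 0[%classic x = 0.
Proof.
pose Qk (k : nat) : set R := `[- k.+1%:R, - (k.+1%:R)^-1]%classic.
have mQ k : measurable (Qk k) by exact: measurable_itv.
have z0 k : E (Qk k) x = 0.
  set z := E (Qk k) x.
  have Qz : E (Qk k) z = z by exact: E_idem pvm _ _ (mQ k).
  have k0 : 0 < (k.+1%:R : R) by rewrite ltr0n.
  have Az : opdom A z.
    apply: (spectral_dom_bounded hp pvm mid AE (mQ k) (K := k.+1%:R ^+ 2)) => //.
    move=> l; rewrite /Qk/= in_itv/= => /andP[l1 l2].
    have i0 : 0 < (k.+1%:R : R)^-1 by rewrite invr_gt0.
    have nl : 0 <= - l.
      by rewrite oppr_ge0; apply: (le_trans l2); rewrite oppr_le0 ltW.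
    by rewrite -[l ^+ 2]sqrrN ler_sqr ?nnegrE ?(ltW k0)// lerNl.
  have lk : - (k.+1%:R : R) <= - (k.+1%:R)^-1.
    rewrite lerN2; apply: (@le_trans _ _ 1); last by rewrite ler1n.
    by rewrite invf_le1// ler1n.
  have /andP[_ h] := spectral_form_bounds hp pvm mid AE (mQ k) lk
    (fun l h => ltac:(by move: h; rewrite /Qk/= in_itv)) Qz Az.
  have := le_trans (Ann Az) h; rewrite mulNr oppr_ge0.
  rewrite pmulr_rle0 ?invr_gt0// => h2.
  by apply/eqP; rewrite -normr_eq0 -sqrf_eq0 eq_le h2 sqr_ge0.
have U : \bigcup_k Qk k = `]-oo, 0[%classic.
  apply/seteqP; split => l /=; rewrite !in_itv/=.
    case=> k _; rewrite /Qk/= in_itv/= => /andP[_ h].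
    by apply: le_lt_trans h _; rewrite oppr_lt0 invr_gt0.
  move=> l0; pose k := (Num.bound (- l) + Num.bound (- l^-1))%N.
  have h1 : - l < (Num.bound (- l))%:R by apply: archi_boundP; lra.
  have l0' : 0 < - l by lra.
  have h2 : - l^-1 < (Num.bound (- l^-1))%:R.
    by apply: archi_boundP; rewrite -invrN ltW// invr_gt0.
  exists k => //; rewrite /Qk/= in_itv/= /k; apply/andP; split.
    rewrite lerNl; apply: le_trans (ltW h1) _.
    by rewrite ler_nat (leq_trans (leq_addr _ _) (leqnSn _)).
  rewrite lerNr -[- l]invrK lef_pV2 ?posrE ?invr_gt0// ?ltr0n//.
  rewrite invrN; apply: le_trans (ltW h2) _.
  by rewrite ler_nat (leq_trans (leq_addl _ _) (leqnSn _)).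
have mono : {homo Qk : n m / (n <= m)%N >-> (n <= m)%O}.
  move=> n m nm; apply/subsetPset => l; rewrite /Qk/= !in_itv/= => /andP[l1 l2].
  have h : (n.+1%:R : R) <= m.+1%:R by rewrite ler_nat ltnS.
  apply/andP; split; first by apply: le_trans l1; rewrite lerN2.
  by apply: (le_trans l2); rewrite lerN2 lef_pV2 ?posrE ?ltr0n.
have mU : measurable (\bigcup_k Qk k) by rewrite U; exact: measurable_itv.
have := nondecreasing_cvg_mu (mu := m_ x) mQ mU mono.
have -> : (m_ x \o Qk) = cst 0%E.
  by apply/funext => k /=; rewrite m_E// z0 dot0l.
move=> /cvg_lim; rewrite lim_cst// => /(_ (@ereal_hausdorff R)).
rewrite U m_E; last exact: measurable_itv.
move=> /(congr1 fine)/= h; apply/eqP.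
by rewrite -normr_eq0 -sqrf_eq0 -(mass_sq hp pvm)// -h.
Qed.

Let mI (g : R -> R) x : \bar R := (\int[m_ x]_l (g l)%:E)%E.

Let mI_ge0 (g : R -> R) x : (forall l, 0 <= g l) -> (0 <= mI g x)%E.
Proof. by move=> g0; apply: integral_ge0 => l _; rewrite lee_fin. Qed.

Let mI_0 (g : R -> R) : measurable_fun setT g -> (forall l, 0 <= g l) -> mI g 0 = 0%E.
Proof.
move=> mg g0; rewrite /mI.
have := @ge0_negligible_integral _ _ _ (m_ 0) setT setT (EFin \o g).
rewrite setDT integral_set0; apply=> //; first exact/measurable_EFinP.
  by move=> l _; rewrite lee_fin.
by rewrite m_E// dot0r.
Qed.

Let mI_scale (g : R -> R) (c : R) x : measurable_fun setT g -> (forall l, 0 <= g l) ->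
  mI g (c *: x) = ((c ^+ 2)%:E * mI g x)%E.
Proof.
move=> mg g0; have c2 : 0 <= c ^+ 2 by exact: sqr_ge0.
have := integral_of_mass_identity hp pvm (k := NngNum c2) (x1 := c *: x) (x2 := 0)
  (x3 := 0) (y1 := 0) (y2 := x) (y3 := 0) mg g0.
rewrite -![(\int[m_ _]_l _)%E]/(mI g _) !mI_0// mule0 !adde0 add0e; apply.
move=> Q mQ; rewrite (E_Z pvm)// !dotZl !dotZr !(E_0 pvm)// !dot0l/=; ring.
Qed.

Let mI_parallelogram (g : R -> R) x y : measurable_fun setT g -> (forall l, 0 <= g l) ->
  (mI g (x + y)%R + mI g (x - y)%R = 2%:E * mI g x + 2%:E * mI g y)%E.
Proof.
move=> mg g0; pose r : R := Num.sqrt 2.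
have r2 : r ^+ 2 = 2 by rewrite sqr_sqrtr.
have := integral_of_mass_identity hp pvm (k := NngNum (ler01 : 0 <= (1 : R)))
  (x1 := x + y) (x2 := x - y)
  (x3 := 0) (y1 := r *: x) (y2 := r *: y) (y3 := 0) mg g0.
rewrite -![(\int[m_ _]_l _)%E]/(mI g _) !mI_0// !mul1e !adde0 !mI_scale// r2; apply.
move=> Q mQ; rewrite !(E_Z pvm)// (E_D pvm)// (E_B pvm)// !(E_0 pvm)//.
rewrite !(dotDl, dotDr, dotNl, dotNr, dotZl, dotZr) !dot0l /=.
rewrite (E_sym pvm y x mQ) (dotC _ y).
have e d : r * (r * d) = 2 * d by rewrite mulrA -expr2 r2.
by rewrite !e; ring.
Qed.

Let domS x : opdom S x <-> (mI rtsq x < +oo)%E.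
Proof. exact: spectral_domP. Qed.

Let rt2_ge0 l : 0 <= rtsq l. Proof. exact: sqr_ge0. Qed.

Let domS_scale c x : opdom S x -> opdom S (c *: x).
Proof.
move=> /domS h; apply/domS; rewrite mI_scale//.
by rewrite lte_mul_pinfty// lee_fin sqr_ge0.
Qed.

Let domS_add x y : opdom S x -> opdom S y -> opdom S (x + y).
Proof.
move=> /domS hx /domS hy; apply/domS.
apply: (@le_lt_trans _ _ (mI rtsq (x + y)%R + mI rtsq (x - y)%R)%E).
  by rewrite leeDl// mI_ge0.
rewrite mI_parallelogram//.
by rewrite lte_add_pinfty// lte_mul_pinfty.
Qed.

Let mass_fin x : (\int[m_ x]_l (1 : R)%:E < +oo)%E.
Proof.
have -> : (fun=> (1 : R)%:E) = (cst (1 : R)%:E : R -> \bar R) by [].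
by rewrite integral_cst// m_T mul1e ltry.
Qed.

Let fin_rt x : opdom S x -> mI rt x \is a fin_num.
Proof.
move=> /domS h; rewrite ge0_fin_numE ?mI_ge0//.
apply: (@le_lt_trans _ _ (\int[m_ x]_l ((1 : R)%:E + (rtsq l)%:E)))%E.
  apply: ge0_le_integral => //.
  - by move=> l _; rewrite lee_fin.
  - exact/measurable_EFinP.
  - by apply: emeasurable_funD; exact/measurable_EFinP.
  - by move=> l _; rewrite -EFinD lee_fin /rtsq; have := sqr_ge0 (rt l - 1); rewrite sqrrB1;
      have := rt_ge0 l; lra.
rewrite ge0_integralD//; last exact/measurable_EFinP.
  by rewrite lte_add_pinfty// mass_fin.
by move=> l _; rewrite lee_fin.
Qed.

(** [sqrt l ^ 2 <= 1 + l ^ 2]. *)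
Lemma domA_domS x : opdom A x -> opdom S x.
Proof.
move=> /(spectral_domP hp pvm AE) h; apply/domS.
apply: (@le_lt_trans _ _ (\int[m_ x]_l ((1 : R)%:E + ((id l) ^+ 2)%:E)))%E.
  apply: ge0_le_integral => //.
  - by move=> l _; rewrite lee_fin.
  - exact/measurable_EFinP.
  - by apply: emeasurable_funD; apply/measurable_EFinP => //; exact: measurable_funX.
  - by move=> l _; rewrite -EFinD lee_fin rt2_le.
rewrite ge0_integralD//.
- by rewrite lte_add_pinfty.
- by move=> l _; rewrite lee_fin sqr_ge0.
- by apply/measurable_EFinP; exact: measurable_funX.
Qed.

Lemma S_dense x : (forall y, opdom S y -> dot x y = 0) -> x = 0.
Proof. by move=> h; apply: dense_test => y Ay; apply: h; exact: domA_domS. Qed.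

Let I x : R := fine (mI rt x).

Let S_form x y : opdom S x -> opdom S y -> dot (S x) y = (I (x + y) - I (x - y)) / 4.
Proof. exact: spectral_form. Qed.

Let I_identity (k : {nonneg R}) x1 x2 x3 y1 y2 y3 :
  opdom S x1 -> opdom S x2 -> opdom S x3 -> opdom S y1 -> opdom S y2 -> opdom S y3 ->
  (forall Q, measurable Q ->
     dot (E Q x1) x1 + k%:num * dot (E Q x2) x2 + dot (E Q x3) x3 =
     dot (E Q y1) y1 + k%:num * dot (E Q y2) y2 + dot (E Q y3) y3) ->
  I x1 + k%:num * I x2 + I x3 = I y1 + k%:num * I y2 + I y3.
Proof.
move=> d1 d2 d3 e1 e2 e3 h.
have := integral_of_mass_identity hp pvm mrt rt_ge0 h.
rewrite -![(\int[m_ _]_l _)%E]/(mI rt _).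
rewrite -(fineK (fin_rt d1)) -(fineK (fin_rt d2)) -(fineK (fin_rt d3)).
rewrite -(fineK (fin_rt e1)) -(fineK (fin_rt e2)) -(fineK (fin_rt e3)).
by rewrite -!EFinM -!EFinD => -[].
Qed.

(* For [a >= 0] linearity can be written as an identity between spectral measures
   with nonnegative coefficients, so that only integrals of nonnegative functions
   against measures occur. *)
Let S_lin_nonneg (a : R) x y : 0 <= a -> opdom S x -> opdom S y ->
  S (a *: x + y) = a *: S x + S y.
Proof.
move=> a0 Sx Sy; apply/eqP; rewrite -subr_eq0; apply/eqP; apply: S_dense => z Sz.
have dN w : opdom S w -> opdom S (- w) by rewrite -scaleN1r; exact: domS_scale.
have d0 : opdom S (a *: x + y) by apply: domS_add => //; exact: domS_scale.
rewrite dotBl dotDl dotZl !S_form//.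
have := @I_identity (NngNum a0) (a *: x + y + z) (x - z) (y - z)
  (a *: x + y - z) (x + z) (y + z).
rewrite /= => h.
suff : I (a *: x + y + z) + a * I (x - z) + I (y - z) =
  I (a *: x + y - z) + a * I (x + z) + I (y + z) by lra.
apply: h; try by apply: domS_add => //; exact: dN.
move=> Q mQ; rewrite !(E_B pvm)// !(E_D pvm)// !(E_Z pvm)//.
rewrite !(dotDl, dotDr, dotNl, dotNr, dotZl, dotZr).
rewrite (E_sym pvm z x mQ) (E_sym pvm z y mQ) !(dotC _ z).
ring.
Qed.

Lemma S_linear : linear_operator S.
Proof.
have S00 : opdom S 0 by apply: domA_domS; case: Alin.
split => // a x y Sx Sy; split; first by apply: domS_add => //; exact: domS_scale.
have [a0|a0] := leP 0 a; first exact: S_lin_nonneg.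
have dN : opdom S (- x) by rewrite -scaleN1r; exact: domS_scale.
have S0 : S 0 = 0.
  have := S_lin_nonneg ler01 S00 S00; rewrite !scale1r addr0.
  by move=> /eqP; rewrite -subr_eq subrr eq_sym => /eqP.
have SN : S (- x) = - S x.
  have := S_lin_nonneg ler01 Sx dN; rewrite !scale1r subrr S0 => /esym/eqP.
  by rewrite addrC addr_eq0 => /eqP.
have na : 0 <= - a by lra.
by rewrite -[a *: x]opprK -scaleNr -scalerN (S_lin_nonneg na dN Sy) SN scalerN scaleNr opprK.
Qed.

Let Asym x y : opdom A x -> opdom A y -> dot (A x) y = dot x (A y).
Proof. exact: (spectral_sym hp pvm AE). Qed.

Let Ssym x y : opdom S x -> opdom S y -> dot (S x) y = dot x (S y).
Proof. exact: (spectral_sym hp pvm SE). Qed.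

Definition cell_of (a b : R) : set R := `[a ^+ 2, b ^+ 2[%classic.

Let mcell a b : measurable (cell_of a b). Proof. exact: measurable_itv. Qed.

Let cell_rt a b l : 0 <= a -> a <= b -> cell_of a b l ->
  [/\ 0 <= l, a ^+ 2 <= l <= b ^+ 2 & a <= rt l <= b].
Proof.
move=> a0 ab; have b0 := le_trans a0 ab; rewrite /cell_of/= in_itv/= => /andP[l1 l2].
have l0 : 0 <= l by apply: le_trans l1; exact: sqr_ge0.
split => //; first by rewrite l1 ltW.
by rewrite -!(ler_sqr (x := a)) -?(ler_sqr (y := b)) ?nnegrE// rt2// l1 ltW.
Qed.

Let comA a b : 0 <= a -> a <= b ->
  (forall x, opdom A (E (cell_of a b) x)) /\
  (forall x, E (cell_of a b) (A (E (cell_of a b) x)) = A (E (cell_of a b) x)) /\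
  (forall x, opdom A x -> A (E (cell_of a b) x) = E (cell_of a b) (A x)).
Proof.
move=> a0 ab; have b0 := le_trans a0 ab.
apply: (spectral_commute hp pvm mid AE Alin dense_test (mcell a b) (K := (b ^+ 2) ^+ 2)).
  by rewrite exprn_ge0// exprn_ge0.
move=> l /(cell_rt a0 ab)[l0 /andP[_ lb] _].
by rewrite ler_sqr ?nnegrE// exprn_ge0.
Qed.

Let comS a b : 0 <= a -> a <= b ->
  (forall x, opdom S (E (cell_of a b) x)) /\
  (forall x, E (cell_of a b) (S (E (cell_of a b) x)) = S (E (cell_of a b) x)) /\
  (forall x, opdom S x -> S (E (cell_of a b) x) = E (cell_of a b) (S x)).
Proof.
move=> a0 ab; have b0 := le_trans a0 ab.
apply: (spectral_commute hp pvm mrt SE S_linear S_dense (mcell a b) (K := b ^+ 2)).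
  by rewrite exprn_ge0.
move=> l /(cell_rt a0 ab)[l0 _ /andP[_ lb]].
by rewrite ler_sqr ?nnegrE.
Qed.

Let A_form a b x : 0 <= a -> a <= b -> E (cell_of a b) x = x ->
  a ^+ 2 * `|x| ^+ 2 <= dot (A x) x <= b ^+ 2 * `|x| ^+ 2.
Proof.
move=> a0 ab Qx; have b0 := le_trans a0 ab.
apply: (spectral_form_bounds hp pvm mid AE (mcell a b)) => //.
- by rewrite ler_sqr.
- by move=> l /(cell_rt a0 ab)[].
- by rewrite -Qx; have [] := comA a0 ab.
Qed.

Let S_formb a b x : 0 <= a -> a <= b -> E (cell_of a b) x = x ->
  a * `|x| ^+ 2 <= dot (S x) x <= b * `|x| ^+ 2.
Proof.
move=> a0 ab Qx.
apply: (spectral_form_bounds hp pvm mrt SE (mcell a b)) => //.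
- by move=> l /(cell_rt a0 ab)[].
- by rewrite -Qx; have [] := comS a0 ab.
Qed.

Let A_bound a b x : 0 <= a -> a <= b -> E (cell_of a b) x = x ->
  `|A x| <= b ^+ 2 * `|x|.
Proof.
move=> a0 ab Qx; have [d [rng _]] := comA a0 ab.
have Q2 y : E (cell_of a b) y = y -> opdom A y by move=> <-.
apply: (@form_norm_bound _ _ dot hp A [set y | E (cell_of a b) y = y] (b ^+ 2)) => //=.
- exact: sqr_ge0.
- move=> c y z Qy Qz; split; first by rewrite (E_linear pvm)// Qy Qz.
  by case: Alin => _ h; have [] := h c y z (Q2 _ Qy) (Q2 _ Qz).
- by move=> y Qy; rewrite -Qy.
- by move=> y z Qy Qz; apply: Asym; exact: Q2.
move=> y Qy; have /andP[h1 ->] := A_form a0 ab Qy; rewrite andbT.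
by apply: le_trans h1; rewrite mulr_ge0 ?sqr_ge0.
Qed.

Let S_bound a b x : 0 <= a -> a <= b -> E (cell_of a b) x = x ->
  `|S x| <= b * `|x|.
Proof.
move=> a0 ab Qx; have [d [rng _]] := comS a0 ab.
have Q2 y : E (cell_of a b) y = y -> opdom S y by move=> <-.
apply: (@form_norm_bound _ _ dot hp S [set y | E (cell_of a b) y = y] b) => //=.
- exact: le_trans ab.
- move=> c y z Qy Qz; split; first by rewrite (E_linear pvm)// Qy Qz.
  by case: S_linear => _ h; have [] := h c y z (Q2 _ Qy) (Q2 _ Qz).
- by move=> y Qy; rewrite -Qy.
- by move=> y z Qy Qz; apply: Ssym; exact: Q2.
move=> y Qy; have /andP[h1 ->] := S_formb a0 ab Qy; rewrite andbT.
by apply: le_trans h1; rewrite mulr_ge0 ?sqr_ge0.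
Qed.

(** On a cell [[a^2, b^2[] both [<A z, z>] and [|S z|^2] lie between
[a^2 |z|^2] and [b^2 |z|^2]. Summing over a fine partition shows that they
agree. *)
Let q z : R := dot (A z) z - `|S z| ^+ 2.

Let cell_q a b x : 0 <= a -> a <= b ->
  `|q (E (cell_of a b) x)| <= (b ^+ 2 - a ^+ 2) * `|E (cell_of a b) x| ^+ 2.
Proof.
move=> a0 ab; set z := E _ x.
have Qz : E (cell_of a b) z = z by exact: E_idem pvm _ _ (mcell a b).
have /andP[h1 h2] := A_form a0 ab Qz; have /andP[h3 h4] := S_formb a0 ab Qz.
have b0 := le_trans a0 ab.
have h5 : `|S z| ^+ 2 <= b ^+ 2 * `|z| ^+ 2.
  rewrite -exprMn ler_sqr ?nnegrE ?mulr_ge0//; exact: S_bound Qz.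
have h6 : a ^+ 2 * `|z| ^+ 2 <= `|S z| ^+ 2.
  rewrite -exprMn ler_sqr ?nnegrE ?mulr_ge0//.
  have [->|z0] := eqVneq z 0; first by rewrite normr0 mulr0.
  have p : 0 < `|z| by rewrite normr_gt0.
  rewrite -(ler_pM2r p) -mulrA -expr2; apply: le_trans h3 _.
  by apply: le_trans (ler_norm _) _; exact: cauchy_schwarz.
by rewrite /q ler_norml; apply/andP; split; lra.
Qed.

Let cell_split a b : 0 <= a -> a <= b ->
  cell_of 0 b = cell_of 0 a `|` cell_of a b /\ cell_of 0 a `&` cell_of a b = set0.
Proof.
move=> a0 ab; have b0 := le_trans a0 ab.
have ab2 : a ^+ 2 <= b ^+ 2 by rewrite ler_sqr.
split; apply/seteqP; split => l; rewrite /cell_of/= !in_itv/= expr0n/=.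
- move=> /andP[l0 lb]; have [la|la] := ltP l (a ^+ 2); [left|right]; apply/andP => //.
- move=> [/andP[l0 la]|/andP[la lb]]; apply/andP; split => //.
    exact: lt_le_trans ab2.
  by apply: le_trans la; exact: sqr_ge0.
- by move=> [/andP[_ h1] /andP[h2 _]]; move: h1; rewrite ltNge h2.
- by [].
Qed.

Let q_add a b x : 0 <= a -> a <= b ->
  q (E (cell_of 0 b) x) = q (E (cell_of 0 a) x) + q (E (cell_of a b) x) /\
  `|E (cell_of 0 b) x| ^+ 2 = `|E (cell_of 0 a) x| ^+ 2 + `|E (cell_of a b) x| ^+ 2.
Proof.
move=> a0 ab; have [U D] := cell_split a0 ab.
rewrite U (E_setU hp pvm)//.
set z1 := E (cell_of 0 a) x; set z2 := E (cell_of a b) x.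
have Q1 : E (cell_of 0 a) z1 = z1 by exact: E_idem pvm _ _ (mcell _ _).
have Q2 : E (cell_of a b) z2 = z2 by exact: E_idem pvm _ _ (mcell _ _).
have [dA1 [rA1 _]] := comA (lexx 0) a0; have [dA2 [rA2 _]] := comA a0 ab.
have [dS1 [rS1 _]] := comS (lexx 0) a0; have [dS2 [rS2 _]] := comS a0 ab.
have orth u v : E (cell_of 0 a) u = u -> E (cell_of a b) v = v -> dot u v = 0.
  move=> <- <-; rewrite (E_sym pvm)//.
  by rewrite (E_disjoint hp pvm)// dot0r.
have AD : A (z1 + z2) = A z1 + A z2.
  by case: Alin => _ h; have [] := h 1 z1 z2 (dA1 x) (dA2 x); rewrite !scale1r.
have SD : S (z1 + z2) = S z1 + S z2.
  by case: S_linear => _ h; have [] := h 1 z1 z2 (dS1 x) (dS2 x); rewrite !scale1r.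
have o1 : dot z1 z2 = 0 by exact: orth.
have o2 : dot (A z1) z2 = 0 by apply: orth => //; exact: rA1.
have o3 : dot (A z2) z1 = 0 by rewrite dotC; apply: orth => //; exact: rA2.
have o4 : dot (S z1) (S z2) = 0 by apply: orth; [exact: rS1|exact: rS2].
split.
  rewrite /q AD SD -!hp !(dotDl, dotDr) o2 o3 (dotC _ (S z2)) o4; ring.
by rewrite -!hp !(dotDl, dotDr) (dotC _ z2) o1; ring.
Qed.

(* The partition has [J] cells of width [eta] in the variable [sqrt l], on which
   [l] varies by at most [2 J eta ^ 2]. *)
Let q_partition (eta : R) (J : nat) x : 0 <= eta -> forall j : nat, (j <= J)%N ->
  `|q (E (cell_of 0 (j%:R * eta)) x)|
  <= 2 * J%:R * eta ^+ 2 * `|E (cell_of 0 (j%:R * eta)) x| ^+ 2.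
Proof.
move=> e0; elim => [|j IH] jJ.
  by rewrite mul0r; apply: le_trans (cell_q _ (lexx 0) (lexx 0)) _;
    rewrite subrr mul0r !mulr_ge0 ?sqr_ge0.
have a0 : 0 <= j%:R * eta by rewrite mulr_ge0.
have ab : j%:R * eta <= j.+1%:R * eta by rewrite ler_wpM2r// ler_nat.
have [-> ->] := q_add x a0 ab; rewrite mulrDr.
apply: le_trans (ler_normD _ _) _; apply: lerD; first exact/IH/ltnW.
apply: le_trans (cell_q _ a0 ab) _; rewrite ler_wpM2r ?sqr_ge0//.
have -> : (j.+1%:R * eta) ^+ 2 - (j%:R * eta) ^+ 2 = (2 * j%:R + 1) * eta ^+ 2.
  by rewrite -natr1; ring.
rewrite ler_wpM2r ?sqr_ge0//.
have : (j.+1%:R : R) <= J%:R by rewrite ler_nat.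
by rewrite -natr1; lra.
Qed.

Definition spectral_cut (n : nat) x := E (cell_of 0 n%:R) x.

Let q_cut n x : q (spectral_cut n x) = 0.
Proof.
apply/eqP; rewrite -normr_eq0 eq_le normr_ge0 andbT.
set C := 2 * n%:R ^+ 2 * `|spectral_cut n x| ^+ 2.
have C0 : 0 <= C by rewrite /C mulr_ge0 ?sqr_ge0// mulr_ge0// sqr_ge0.
have h (J : nat) : `|q (spectral_cut n x)| * J.+1%:R <= C.
  have J0 : 0 < (J.+1%:R : R) by rewrite ltr0n.
  have e0 : 0 <= n%:R / J.+1%:R :> R by rewrite divr_ge0.
  have := q_partition x e0 (leqnn J.+1).
  rewrite mulrC divfK ?gt_eqF// -/(spectral_cut n x) => h.
  rewrite -ler_pdivlMr//; apply: (le_trans h).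
  by rewrite le_eqVlt; apply/orP; left; apply/eqP; rewrite /C; field; rewrite gt_eqF.
rewrite leNgt; apply/negP => p.
have := archi_boundP (divr_ge0 C0 (ltW p)).
set N := Num.bound _; rewrite ltr_pdivrMr// mulrC => h2.
have := h N; rewrite leNgt => /negP; apply; apply: (lt_le_trans h2).
by rewrite ler_wpM2l// ler_nat.
Qed.

Let cut_form n x y : dot (A (spectral_cut n x)) (spectral_cut n y)
  = dot (S (spectral_cut n x)) (S (spectral_cut n y)).
Proof.
set u := spectral_cut n x; set v := spectral_cut n y.
have n0 : 0 <= (n%:R : R) by [].
have [dA _] := comA (lexx 0) n0; have [dS _] := comS (lexx 0) n0.
have h1 : q (u + v) = 0 by rewrite /u /v /spectral_cut -(E_D pvm)//; exact: q_cut.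
have h2 : q u = 0 by exact: q_cut.
have h3 : q v = 0 by exact: q_cut.
have AD : A (u + v) = A u + A v.
  by case: Alin => _ h; have [] := h 1 u v (dA x) (dA y); rewrite !scale1r.
have SD : S (u + v) = S u + S v.
  by case: S_linear => _ h; have [] := h 1 u v (dS x) (dS y); rewrite !scale1r.
have sA : dot (A v) u = dot (A u) v by rewrite dotC Asym//; [exact: dA|exact: dA].
move: h1 h2 h3; rewrite /q AD SD -!hp !(dotDl, dotDr) sA (dotC _ (S v) (S u)).
lra.
Qed.

Let low (n : nat) : set R := `]-oo, n%:R ^+ 2[%classic.

Let mlow n : measurable (low n). Proof. exact: measurable_itv. Qed.

Let low_homo : {homo low : n m / (n <= m)%N >-> (n <= m)%O}.
Proof.
move=> n m nm; apply/subsetPset => l; rewrite /low/= !in_itv/= => h.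
by apply: (lt_le_trans h); rewrite ler_sqr ?nnegrE// ler_nat.
Qed.

Let low_in l : exists N, forall n, (N <= n)%N -> low n l.
Proof.
exists (Num.bound `|l|) => n hn; rewrite /low/= in_itv/=.
have h : `|l| < n%:R.
  by apply: (lt_le_trans (archi_boundP (normr_ge0 l))); rewrite ler_nat.
apply: le_lt_trans (ler_norm _) _; apply: (lt_le_trans h).
case: n hn h => [|n] _ h; first by move: h; rewrite ltNge normr_ge0.
by rewrite expr2 ler_peMl// ler1n.
Qed.

Let low_cut n x : E (low n) x = spectral_cut n x.
Proof.
have n0 : 0 <= (n%:R : R) ^+ 2 by exact: sqr_ge0.
have -> : low n = `]-oo, 0[%classic `|` cell_of 0 n%:R.
  apply/seteqP; split => l; rewrite /low /cell_of/= !in_itv/= expr0n/=.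
    by move=> h; have [l0|l0] := ltP l 0; [left|right; rewrite h].
  by move=> [h|/andP[_ h]] //; exact: lt_le_trans n0.
rewrite (E_setU hp pvm)//; last first.
  apply/seteqP; split => l //; rewrite /cell_of/= !in_itv/= expr0n/=.
  by move=> [h /andP[h2 _]]; move: h; rewrite ltNge h2.
  by rewrite E_negative add0r.
Qed.

Lemma cut_cvg x (e : R) : 0 < e ->
  exists N, forall n, (N <= n)%N -> `|spectral_cut n x - x| <= e.
Proof.
move=> e0.
have U : \bigcup_n low n = setT.
  by apply/seteqP; split => l //= _; have [N HN] := low_in l; exists N => //; exact: HN.
have mU : measurable (\bigcup_n low n) by rewrite U.
have := nondecreasing_cvg_mu (mu := m_ x) mlow mU low_homo.
rewrite U m_T.
have -> : m_ x \o low = (fun n => (`|spectral_cut n x| ^+ 2)%:E).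
  by apply/funext => n /=; rewrite m_E// (mass_sq hp pvm)// low_cut.
move=> /fine_cvg h; have {}h : (fun n => `|spectral_cut n x| ^+ 2) @ \oo --> `|x| ^+ 2 by [].
have e2 : 0 < e ^+ 2 by rewrite exprn_gt0.
move/cvgrPdist_le: h => /(_ _ e2)[N _ HN]; exists N => n Nn.
have /= h := HN n Nn.
rewrite -ler_sqr ?nnegrE ?(ltW e0)// (normB_sq hp).
have -> : dot (spectral_cut n x) x = `|spectral_cut n x| ^+ 2.
  by rewrite (mass_sq hp pvm).
by have := le_trans (ler_norm _) h; lra.
Qed.

Let J_cut n x : mI rtsq (spectral_cut n x) = (`|S (spectral_cut n x)| ^+ 2)%:E.
Proof.
set z := spectral_cut n x.
have n0 : 0 <= (n%:R : R) by [].
have [dA _] := comA (lexx 0) n0; have [dS _] := comS (lexx 0) n0.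
have ae w : (\int[m_ w]_l (id l)%:E = mI rtsq w)%E.
  apply: ae_eq_integral => //; [exact/measurable_EFinP|].
  exists `]-oo, 0[%classic; split; first exact: measurable_itv.
    by rewrite m_E// E_negative dot0l.
  move=> l /= h; rewrite in_itv/= ltNge; apply/negP => l0; apply: h => _.
  by rewrite /rtsq rt2.
have := spectral_form hp pvm AE (dA x) (dA x); rewrite -/(spectral_cut n x) -/z.
have zz : z + z = (2 : R) *: z by rewrite scaler_nat mulr2n.
rewrite cut_form hp !ae subrr mI_0// zz mI_scale//.
have f : mI rtsq z \is a fin_num.
  by rewrite ge0_fin_numE ?mI_ge0//; apply/domS; exact: dS.
by rewrite -(fineK f) -EFinM/= subr0 => ->; congr (_%:E); field.
Qed.

(** [S] maps the truncations of [x] to those of [y], so they are bounded, and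
monotone convergence puts [x] in the domain of [S]. *)
Lemma S_closed x y : (forall e : R, 0 < e ->
    exists z, [/\ opdom S z, `|z - x| <= e & `|S z - y| <= e]) ->
  opdom S x /\ S x = y.
Proof.
move=> h.
have step1 n : S (spectral_cut n x) = spectral_cut n y.
  have n0 : 0 <= (n%:R : R) by [].
  have [dS [_ cS]] := comS (lexx 0) n0.
  apply/eqP; rewrite -subr_eq0 -normr_eq0 eq_le normr_ge0 andbT.
  apply/ler_addgt0Pl => e e0; rewrite addr0.
  have n1 : 0 < 1 + (n%:R : R) by rewrite ltr_pwDl.
  have [z [Sz z1 z2]] := h _ (divr_gt0 e0 n1).
  have -> : S (spectral_cut n x) - spectral_cut n y
    = - S (spectral_cut n (z - x)) + spectral_cut n (S z - y).
    rewrite /spectral_cut !(E_B pvm)// -cS//.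
    have -> : S (E (cell_of 0 n%:R) z - E (cell_of 0 n%:R) x)
      = S (E (cell_of 0 n%:R) z) - S (E (cell_of 0 n%:R) x).
      have [_ hl] := S_linear; have [_] := hl (-1) _ _ (dS x) (dS z).
      by rewrite !scaleN1r ![- _ + _]addrC.
    by rewrite opprB subrKA.
  apply: le_trans (ler_normD _ _) _; rewrite normrN.
  apply: (@le_trans _ _ (n%:R * (e / (1 + n%:R)) + e / (1 + n%:R))).
    apply: lerD.
      apply: le_trans (S_bound (lexx 0) n0 (E_idem pvm _ _)) _ => //.
      rewrite ler_wpM2l//; apply: le_trans z1; exact: E_contract.
    by apply: le_trans z2; exact: E_contract.
  by rewrite le_eqVlt; apply/orP; left; apply/eqP; field; rewrite gt_eqF.
have step2 : (mI rtsq x <= (`|y| ^+ 2)%:E)%E.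
  pose g (n : nat) (l : R) : R := rtsq l * \1_(low n) l.
  have g0 n l : 0 <= g n l by rewrite mulr_ge0.
  have mg n : measurable_fun setT (g n).
    by apply: measurable_funM => //; exact: measurable_indic.
  have gy n : (\int[m_ x]_l (g n l)%:E <= (`|y| ^+ 2)%:E)%E.
    set z := spectral_cut n x.
    have zE : z = E (low n) x by rewrite low_cut.
    have := integral_of_mass_identity hp pvm (k := NngNum (ler01 : 0 <= (1 : R)))
      (x1 := x) (x2 := 0) (x3 := 0) (y1 := z) (y2 := x - z) (y3 := 0) (mg n) (g0 n).
    rewrite -![(\int[m_ _]_l _)%E]/(mI (g n) _) !mI_0// !mul1e !adde0.
    have -> : mI (g n) (x - z) = 0%E.
      transitivity (\int[m_ (x - z)%R]_l (cst 0%E l : \bar R))%E; last first.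
        by rewrite integral_cst// mul0e.
      apply: ae_eq_integral => //; first exact/measurable_EFinP.
      exists (low n); split; first exact: mlow.
        by rewrite m_E// (E_B pvm)// zE (E_idem pvm)// subrr dot0l.
      move=> l /= hl; apply: contrapT => nl; apply: hl => _.
      by rewrite /g indicE memNset// mulr0.
    rewrite adde0 => -> ; last first.
      move=> Q mQ /=; rewrite (E_B pvm)// (E_0 pvm)// !dot0l mul1r !addr0.
      rewrite !(dotDl, dotDr, dotNl, dotNr).
      have e1 : dot (E Q z) x = dot (E Q z) z.
        have zQ : E (low n) (E Q z) = E Q z.
          by rewrite (E_comm pvm)// zE (E_idem pvm).
        by rewrite -[in LHS]zQ (E_sym pvm)// -zE.
      have e2 : dot (E Q x) z = dot (E Q z) z.
        by rewrite (E_sym pvm x z)// dotC e1.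
      by rewrite e1 e2; ring.
    have hg : (mI (g n) z <= mI rtsq z)%E.
      apply: ge0_le_integral => //.
      - by move=> l _; rewrite lee_fin.
      - exact/measurable_EFinP.
      - exact/measurable_EFinP.
      move=> l _; rewrite lee_fin /g indicE; case: (_ \in _); first by rewrite mulr1.
      by rewrite mulr0.
    apply: (le_trans hg); rewrite J_cut step1 lee_fin ler_sqr ?nnegrE//.
    exact: E_contract.
  have lim l : (limn (fun n => (g n l)%:E) = (rtsq l)%:E)%E.
    have [N HN] := low_in l; apply/cvg_lim => //.
    apply: cvg_near_cst; exists N => // n Nn.
    by rewrite /g indicE mem_set ?mulr1//; exact: HN.
  have mono l : {homo (fun n => (g n l)%:E) : n m / (n <= m)%N >-> (n <= m)%E}.
    move=> n m nm; rewrite lee_fin /g ler_wpM2l// !indicE ler_nat.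
    have /subsetPset sub := low_homo nm.
    case: (boolP (l \in low n)) => // /set_mem /sub h2.
    by rewrite mem_set.
  have := @cvg_monotone_convergence _ _ _ (m_ x) setT measurableT (fun n l => (g n l)%:E)
    (fun n => proj2 (measurable_EFinP _ _) (mg n)) (fun n l _ => g0 n l) (fun l _ => mono l).
  move=> hc.
  rewrite /mI (eq_integral (fun l => limn (fun n => (g n l)%:E))); last first.
    by move=> l _; rewrite lim.
  rewrite -(cvg_lim _ hc)//; apply: lime_le; first by apply/cvg_ex; eexists; exact: hc.
  by apply: nearW => n; exact: gy.
have Sx : opdom S x by apply/domS; apply: (le_lt_trans step2); rewrite ltry.
split => //; apply/eqP; rewrite -subr_eq0; apply/eqP; apply: S_dense => z Sz.
apply/eqP; rewrite -normr_eq0 eq_le normr_ge0 andbT.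
apply/ler_addgt0Pl => e e0; rewrite addr0.
have C0 : 0 < 1 + `|z| + `|S z| by rewrite ltr_wpDr ?ltr_wpDr ?ltr01.
have [w [Sw w1 w2]] := h _ (divr_gt0 e0 C0).
have -> : dot (S x - y) z = dot (S w - y) z - dot (w - x) (S z).
  by rewrite !dotBl (Ssym Sx Sz) (Ssym Sw Sz); ring.
apply: le_trans (ler_normB _ _) _.
apply: (@le_trans _ _ (e / (1 + `|z| + `|S z|) * `|z| +
    e / (1 + `|z| + `|S z|) * `|S z|)).
  by apply: lerD; apply: le_trans (cauchy_schwarz hp _ _) _; rewrite ler_wpM2r.
rewrite -mulrDr; apply: (@le_trans _ _ (e / (1 + `|z| + `|S z|) * (1 + `|z| + `|S z|))).
  rewrite ler_wpM2l ?divr_ge0 ?(ltW e0) ?(ltW C0)// -addrA lerDr ler01//.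
by rewrite divfK// gt_eqF.
Qed.

(** The identity between the forms of [A] and [S] holds on the truncations and
passes to the limit. *)
Theorem spectral_truncation : truncation dot A S spectral_cut.
Proof.
have n0 n : 0 <= (n%:R : R) by [].
have id n x : E (cell_of 0 n%:R) (spectral_cut n x) = spectral_cut n x.
  exact: E_idem pvm _ _ (mcell _ _).
have cA n := comA (lexx 0) (n0 n); have cS n := comS (lexx 0) (n0 n).
have formP x y : opdom A x -> opdom S y -> dot (A x) y = dot (S x) (S y).
  move=> Ax Sy; apply/eqP; rewrite -subr_eq0 -normr_eq0 eq_le normr_ge0 andbT.
  apply/ler_addgt0Pl => e e0; rewrite addr0.
  have Sx := domA_domS Ax.
  have C0 : 0 < 1 + `|A x| + `|S x| by rewrite ltr_wpDr ?ltr_wpDr ?ltr01.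
  have [N1 HN1] := cut_cvg y (divr_gt0 e0 C0).
  have [N2 HN2] := cut_cvg (S y) (divr_gt0 e0 C0).
  pose n := maxn N1 N2.
  have h1 := HN1 n (leq_maxl _ _); have h2 := HN2 n (leq_maxr _ _).
  have [_ [_ kA]] := cA n; have [_ [_ kS]] := cS n.
  have key : dot (A x) (spectral_cut n y) = dot (S x) (spectral_cut n (S y)).
    rewrite /spectral_cut -(E_idem pvm y)// -(E_sym pvm)// -kA//.
    rewrite -/(spectral_cut n x) -/(spectral_cut n y) cut_form /spectral_cut.
    by rewrite !kS// (E_sym pvm)// (E_idem pvm).
  have -> : dot (A x) y - dot (S x) (S y)
    = dot (S x) (spectral_cut n (S y) - S y) - dot (A x) (spectral_cut n y - y).
    by rewrite !dotBr key; ring.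
  apply: le_trans (ler_normB _ _) _.
  apply: (@le_trans _ _ (`|S x| * (e / (1 + `|A x| + `|S x|)) +
      `|A x| * (e / (1 + `|A x| + `|S x|)))).
    by apply: lerD; apply: le_trans (cauchy_schwarz hp _ _) _; rewrite ler_wpM2l.
  rewrite -mulrDl; apply: (@le_trans _ _ ((1 + `|A x| + `|S x|) * (e / (1 + `|A x| + `|S x|)))).
    rewrite ler_wpM2r ?divr_ge0 ?(ltW e0) ?(ltW C0)//.
    by rewrite addrC -addrA lerDr ler01.
  by rewrite mulrC divfK// gt_eqF.
split => //.
- by move=> n a x y; exact: (E_linear pvm a x y (mcell _ _)).
- move=> m n x mn; rewrite /spectral_cut -!(E_cap pvm)//.
  have -> : cell_of 0 m%:R `&` cell_of 0 n%:R = cell_of 0 m%:R.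
    apply/setIidPl => l; rewrite /cell_of/= !in_itv/= => /andP[-> h]/=.
    by apply: (lt_le_trans h); rewrite ler_sqr ?nnegrE// ler_nat.
  by rewrite setIC; split => //; congr (E _ x); apply/setIidPl => l;
    rewrite /cell_of/= !in_itv/= => /andP[-> h]/=;
    apply: (lt_le_trans h); rewrite ler_sqr ?nnegrE// ler_nat.
- by move=> n x; exact: (E_contract hp pvm _ (mcell _ _)).
- exact: cut_cvg.
- by move=> n x; have [h _] := cA n; exact: h.
- by move=> n x; have [h _] := cS n; exact: h.
- by move=> n x; have [_ [h _]] := cA n; exact: h.
- move=> n x; apply: le_trans (A_bound (lexx 0) (n0 n) (id n x)) _.
  by rewrite ler_wpM2l ?sqr_ge0//; exact: (E_contract hp pvm _ (mcell _ _)).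
- move=> n x; apply: le_trans (S_bound (lexx 0) (n0 n) (id n x)) _.
  by rewrite ler_wpM2l//; exact: (E_contract hp pvm _ (mcell _ _)).
- by move=> n x Ax; have [_ [_ h]] := cA n; exact: h.
- by move=> n x Sx; have [_ [_ h]] := cS n; exact: h.
- exact: S_linear.
- exact: domA_domS.
- exact: A_closed.
- exact: S_closed.
Qed.

End SquareRoot.

(** * Gronwall's lemma and locally uniform limits *)

Section Auxiliary.
Context {R : realType}.

Lemma powR_lipschitz (g M x y : R) : 1 <= g -> 0 <= x <= M -> 0 <= y <= M ->
  `|y `^ g - x `^ g| <= g * M `^ (g - 1) * `|y - x|.
Proof.
move=> g1; wlog xy : x y / x <= y.
  move=> W hx hy; have [|/ltW h] := leP x y; first by move=> h; exact: W.
  by rewrite distrC [`|y - x|]distrC; exact: W.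
move=> /andP[x0 xM] /andP[y0 yM]; have g0 : 0 < g by apply: lt_le_trans g1.
rewrite !ger0_norm ?subr_ge0//; last by rewrite powR_mono// ltW.
have Mg (z : R) : 0 < z -> z <= M -> z `^ (g - 1) <= M `^ (g - 1).
  by move=> z0 zM; rewrite powR_mono ?subr_ge0// ltW.
move: x0; rewrite le_eqVlt => /predU1P[<-|x0].
  rewrite powR0 ?gt_eqF// !subr0.
  move: y0; rewrite le_eqVlt => /predU1P[<-|y0]; first by rewrite powR0 ?gt_eqF// mulr0.
  rewrite (powR_pred g y0) ler_pM2r//; apply: le_trans (Mg _ y0 yM) _.
  by rewrite ler_peMl// powR_ge0.
have h := @derive_le0_nonincreasing R (fun s => s `^ g - g * M `^ (g - 1) * s)
  (fun s => g * (1 / s) * s `^ g - g * M `^ (g - 1) * 1) x y xy.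
rewrite lerBlDr; suff : y `^ g - g * M `^ (g - 1) * y <= x `^ g - g * M `^ (g - 1) * x.
  by lra.
apply: h => s /andP[xs sy]; have s0 : 0 < s by apply: lt_le_trans xs.
  exact: (isder_sub (isder_powR g s0 (isder_id s))
    (isder_scale (g * M `^ (g - 1)) (isder_id s))).
rewrite mulr1 subr_le0 -mulrA ler_pM2l// mul1r (powR_pred g s0) mulrCA mulVf ?gt_eqF//.
by rewrite mulr1; apply: Mg => //; exact: le_trans yM.
Qed.

Lemma damping_lipschitz (p s t : R) : 0 <= p <= 1 -> 0 <= s -> 0 <= t ->
  `|(1 + s) `^ (- p) - (1 + t) `^ (- p)| <= `|s - t|.
Proof.
move=> p01; wlog st : s t / s <= t.
  move=> W hx hy; have [|/ltW h] := leP s t; first by move=> h; exact: W.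
  by rewrite distrC [`|s - t|]distrC; exact: W.
move=> s0 t0; have /andP[p0 p1] := p01.
have b0 (r : R) : 0 <= r -> 0 <= p / (1 + r) * (1 + r) `^ (- p) <= 1.
  move=> r0; have r1 : 1 <= 1 + r by rewrite lerDl.
  have r1' : 0 < 1 + r by apply: lt_le_trans r1.
  rewrite mulr_ge0 ?powR_ge0 ?divr_ge0 ?(ltW r1')//=.
  rewrite mulr_ile1 ?powR_ge0 ?divr_ge0 ?(ltW r1')//.
    by rewrite ler_pdivrMr// mul1r (le_trans p1).
  by rewrite powR_neg_le1// oppr_le0.
have d1 := @derive_le0_nonincreasing R (fun s => (1 + s) `^ (- p))
  (fun s => - p / (1 + s) * (1 + s) `^ (- p)) s t st.
have d2 := @derive_le0_nonincreasing R (fun s => - s - (1 + s) `^ (- p))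
  (fun s => - 1 - (- p / (1 + s) * (1 + s) `^ (- p))) s t st.
have h1 : (1 + t) `^ (- p) <= (1 + s) `^ (- p).
  apply: d1 => r /andP[sr rt]; have r0 := le_trans s0 sr; first exact: isder_1powR.
  by have /andP[h _] := b0 _ r0; rewrite !mulNr oppr_le0.
have h2 : - t - (1 + t) `^ (- p) <= - s - (1 + s) `^ (- p).
  apply: d2 => r /andP[sr rt]; have r0 := le_trans s0 sr.
    exact: isder_sub (isder_opp (isder_id r)) (isder_1powR (- p) r0).
  by have /andP[_ h] := b0 _ r0; rewrite !mulNr opprK; lra.
rewrite ger0_norm ?subr_ge0// distrC ger0_norm ?subr_ge0//; lra.
Qed.

Lemma gronwall (D dD : R -> R) (C T : R) :
  (forall t : R, 0 <= t -> hasd (D : R -> R^o) t (dD t)) ->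
  (forall t : R, 0 <= t <= T -> dD t <= C * D t) ->
  forall t : R, 0 <= t <= T -> D t <= expR (C * t) * D 0.
Proof.
move=> Dd DC t /andP[t0 tT]; have [G GE Gd] := two_sided_extension Dd.
have e (s : R) : is_derive s 1 (fun r : R => expR (- C * r)) (- C * expR (- C * s)).
  have h := @is_derive1_comp R expR (fun r => - C * r) s _ _
    (is_derive_expR _) (isder_scale (- C) (isder_id s)).
  by apply: (isder_eq h); ring.
have h := @derive_le0_nonincreasing R (fun s => expR (- C * s) * G s)
  (fun s => - C * expR (- C * s) * G s + expR (- C * s) * dD s) 0 t t0.
have {}h : expR (- C * t) * G t <= expR (- C * 0) * G 0.
  apply: h => s /andP[s0 st]; first exact: isder_mul (e s) (Gd _ s0).
  rewrite -mulrA mulrCA -mulrDr mulr_ge0_le0 ?expR_ge0//.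
  by have := DC s; rewrite s0 (le_trans st tT) GE// => /(_ isT); lra.
rewrite mulr0 expR0 mul1r !GE// in h.
rewrite -(ler_pM2l (expR_gt0 (- C * t))); apply: (le_trans h).
by rewrite mulrA -expRD mulNr addNr expR0 mul1r.
Qed.

Lemma hcont_bounded (V : normedModType R) (u : R -> V) (T : R) :
  (forall t : R, 0 <= t -> hcont u t) ->
  exists2 B : R, 0 <= B & forall t : R, 0 <= t <= T -> `|u t| <= B.
Proof.
move=> uc.
suff h : forall t : R, 0 <= t -> exists2 B : R, 0 <= B &
    forall s : R, 0 <= s <= t -> `|u s| <= B.
  have [T0|T0] := leP 0 T; first exact: h.
  by exists 0 => // t /andP[t0 tT]; move: T0; rewrite ltNge (le_trans t0 tT).
apply: real_induction => t t0 IH.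
have [d d0 Hd] := uc t t0 1 ltr01.
have [B B0 HB] : exists2 B : R, 0 <= B & forall s : R, 0 <= s -> s < t - d / 2 -> `|u s| <= B.
  have [h|h] := leP 0 (t - d / 2); last first.
    by exists 0 => // s s0 st; move: h; rewrite ltNge ltW// (le_lt_trans s0 st).
  have [|B B0 HB] := IH (t - d / 2).
    by rewrite h/= ltrBlDr ltrDl divr_gt0.
  by exists B => // s s0 st; apply: HB; rewrite s0 ltW.
exists d => // r /andP[tr rd].
exists (B + (`|u t| + 1)); first by rewrite addr_ge0.
move=> s /andP[s0 sr]; have [h|h] := ltP s (t - d / 2).
  by apply: (le_trans (HB _ s0 h)); rewrite lerDl addr_ge0.
apply: (@le_trans _ _ (`|u t| + 1)); last by rewrite lerDr.
rewrite -[u s](subrK (u t)) addrC; apply: le_trans (ler_normD _ _) _.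
rewrite lerD2l; apply: Hd => //.
rewrite ltr_norml; apply/andP; split; lra.
Qed.

Lemma luc_map (V W : normedModType R) (L : V -> W) (K : R) (u_ : nat -> R -> V) u :
  (forall x y, `|L x - L y| <= K * `|x - y|) -> luc u_ u ->
  luc (fun n t => L (u_ n t)) (fun t => L (u t)).
Proof.
move=> LK h T e e0; have n0 : 0 < 1 + `|K| by rewrite ltr_pwDl.
have [N HN] := h T _ (divr_gt0 e0 n0); exists N => n Nn t tT.
have K1 : K <= 1 + `|K| by apply: le_trans (ler_norm K) _; rewrite lerDr.
apply: le_trans (LK _ _) _; apply: le_trans (ler_wpM2r (normr_ge0 _) K1) _.
apply: (@le_trans _ _ ((1 + `|K|) * (e / (1 + `|K|)))).
  by rewrite ler_wpM2l ?(ltW n0)// HN.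
by rewrite mulrC divfK// gt_eqF.
Qed.

Lemma lucD (V : normedModType R) (u_ w_ : nat -> R -> V) u w :
  luc u_ u -> luc w_ w -> luc (fun n t => u_ n t + w_ n t) (fun t => u t + w t).
Proof.
move=> h k T e e0; have e2 : 0 < e / 2 by rewrite divr_gt0.
have [N HN] := h T _ e2; have [N' HN'] := k T _ e2.
exists (maxn N N') => n; rewrite geq_max => /andP[n1 n2] t tT.
rewrite opprD addrACA; apply: le_trans (ler_normD _ _) _.
by rewrite (splitr e) lerD// ?HN ?HN'.
Qed.

Lemma lucZ (V : normedModType R) (c_ : nat -> R -> R) (u_ : nat -> R -> V) c u :
  (forall T : R, exists2 B : R, 0 <= B & forall n (t : R), 0 <= t <= T -> `|c_ n t| <= B) ->
  (forall T : R, exists2 B : R, 0 <= B & forall (t : R), 0 <= t <= T -> `|u t| <= B) ->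
  luc (c_ : nat -> R -> R^o) c -> luc u_ u ->
  luc (fun n t => c_ n t *: u_ n t) (fun t => c t *: u t).
Proof.
move=> cb ub h k T e e0; have [B B0 HB] := cb T; have [B' B'0 HB'] := ub T.
have e2 : 0 < e / 2 by rewrite divr_gt0.
have b1 : 0 < 1 + B by rewrite ltr_pwDl.
have b2 : 0 < 1 + B' by rewrite ltr_pwDl.
have [N HN] := h T _ (divr_gt0 e2 b2); have [N' HN'] := k T _ (divr_gt0 e2 b1).
exists (maxn N N') => n; rewrite geq_max => /andP[n1 n2] t tT.
have -> : c_ n t *: u_ n t - c t *: u t = c_ n t *: (u_ n t - u t) + (c_ n t - c t) *: u t.
  by rewrite scalerBr scalerBl addrA subrK.
apply: le_trans (ler_normD _ _) _; rewrite !normrZ (splitr e); apply: lerD.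
  apply: (@le_trans _ _ ((1 + B) * (e / 2 / (1 + B)))).
    by rewrite ler_pM ?HN'//; apply: le_trans (HB _ _ tT) _; rewrite lerDr.
  by rewrite mulrC divfK// gt_eqF.
apply: (@le_trans _ _ (e / 2 / (1 + B') * (1 + B'))).
  rewrite ler_pM// ?HB' //; first exact: HN.
  by apply: le_trans (HB' _ tT) _; rewrite lerDr.
by rewrite divfK// gt_eqF.
Qed.

Lemma luc_cst (V : normedModType R) (u : R -> V) : luc (fun _ : nat => u) u.
Proof. by move=> T e e0; exists 0%N => n _ t _; rewrite subrr normr0 ltW. Qed.

Lemma luc_cauchy_derivative (H : completeNormedModType R)
    (dot : {dot H for (idfun : R -> R)}) (u_ v_ : nat -> R -> H) :
  hilbert_product dot ->
  (forall n (t : R), 0 <= t -> hasd (u_ n) t (v_ n t)) ->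
  luc_cauchy v_ ->
  (forall e : R, 0 < e -> exists N, forall m n, (N <= m)%N -> (N <= n)%N ->
     `|u_ m 0 - u_ n 0| <= e) ->
  luc_cauchy u_.
Proof.
move=> hp ud vc u0 T e e0; have e2 : 0 < e / 2 by rewrite divr_gt0.
have T1 : 0 < 1 + `|T| by rewrite ltr_pwDl.
have [N HN] := vc T _ (divr_gt0 e2 T1); have [N' HN'] := u0 _ e2.
exists (maxn N N') => m n; rewrite !geq_max => /andP[m1 m2] /andP[n1 n2] t tT.
have /andP[t0 tT'] := tT.
have := mean_value_cst hp (lexx 0) t0 (fun s s0 => hasdB (ud m s s0) (ud n s s0))
  (k := e / 2 / (1 + `|T|)).
move=> h; have {}h := h (fun s sI => HN _ _ m1 n1 s
  ltac:(by have /andP[-> h2] := sI; rewrite (le_trans h2 tT'))).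
rewrite -[u_ m t - u_ n t](subrK (u_ m 0 - u_ n 0)).
apply: le_trans (ler_normD _ _) _; rewrite (splitr e) lerD ?HN'//.
apply: (le_trans h); rewrite subr0.
apply: (@le_trans _ _ (e / 2 / (1 + `|T|) * (1 + `|T|))); last by rewrite divfK// gt_eqF.
rewrite ler_wpM2l//; first by rewrite ltW// divr_gt0.
apply: (le_trans tT'); by apply: le_trans (ler_norm T) _; rewrite lerDr.
Qed.

End Auxiliary.

(** * The truncated problem *)

Section TruncatedProblem.
Context {R : realType} {H : completeNormedModType R}.
Variable dot : {dot H for (idfun : R -> R)}.
Hypothesis hp : hilbert_product dot.
Variables (A S : operator H) (P : nat -> H -> H).
Hypothesis tr : truncation dot A S P.
Implicit Types (x y z : H) (u v : R -> H).

Lemma trunc_A_linear n (a : R) x y :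
  A (P n (a *: x + y)) = a *: A (P n x) + A (P n y).
Proof.
rewrite (tr_lin tr); have [_ h] := tr_linA tr.
by have [] := h a _ _ (tr_domA tr n x) (tr_domA tr n y).
Qed.

Lemma trunc_S_linear n (a : R) x y :
  S (P n (a *: x + y)) = a *: S (P n x) + S (P n y).
Proof.
rewrite (tr_lin tr); have [_ h] := tr_linS tr.
by have [] := h a _ _ (tr_domS tr n x) (tr_domS tr n y).
Qed.

Lemma linear_distance (L : H -> H) (K : R) :
  (forall (a : R) x y, L (a *: x + y) = a *: L x + L y) ->
  (forall x, `|L x| <= K * `|x|) ->
  forall x y, L x - L y = L (x - y) /\ `|L x - L y| <= K * `|x - y|.
Proof.
move=> Ll LK x y; have E : L (x - y) = L x - L y.
  by rewrite addrC -scaleN1r Ll scaleN1r addrC.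
by rewrite -E.
Qed.

(** [A] acts as the square of [S] on the range of [P n]. *)
Lemma trunc_A_le_S n x : `|A (P n x)| <= n%:R * `|S (P n x)|.
Proof.
have [->|h] := eqVneq (A (P n x)) 0; first by rewrite normr0 mulr_ge0.
have h0 : 0 < `|A (P n x)| by rewrite normr_gt0.
rewrite -(ler_pM2l h0) -expr2 -hp.
rewrite -{2}(tr_rngA tr n x) (tr_form tr (tr_domA tr n x) (tr_domS tr n _)).
apply: le_trans (ler_norm _) _; apply: le_trans (cauchy_schwarz hp _ _) _.
rewrite mulrC [leRHS]mulrA [`|A _| * _]mulrC ler_wpM2r//.
exact: tr_bndS tr _ _.
Qed.

(** Energy identities only see derivatives at nonnegative times, so one-sided
derivatives suffice. *)
Lemma energy_system_of_hasd (p eps : R) (c U V W X Y Z Q dQ : R -> R) :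
  (forall t : R, 0 <= t ->
    [/\ 0 <= U t, 0 <= W t, 0 <= X t, 0 <= Z t & 0 <= Q t]) ->
  (forall t : R, 0 <= t ->
    [/\ V t ^+ 2 <= U t * W t, Y t ^+ 2 <= X t * Z t & Y t ^+ 2 <= Q t * W t]) ->
  (forall t : R, 0 <= t -> hasd (U : R -> R^o) t (2 * V t)) ->
  (forall t : R, 0 <= t ->
    hasd (V : R -> R^o) t (W t - ((1 + t) `^ (- p) * V t + c t * X t) / eps)) ->
  (forall t : R, 0 <= t ->
    hasd (W : R -> R^o) t (- (2 * (1 + t) `^ (- p) * W t + 2 * c t * Y t) / eps)) ->
  (forall t : R, 0 <= t -> hasd (X : R -> R^o) t (2 * Y t)) ->
  (forall t : R, 0 <= t ->
    hasd (Y : R -> R^o) t (Z t - ((1 + t) `^ (- p) * Y t + c t * Q t) / eps)) ->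
  (forall t : R, 0 <= t ->
    hasd (Z : R -> R^o) t (- (2 * (1 + t) `^ (- p) * Z t + c t * dQ t) / eps)) ->
  (forall t : R, 0 <= t -> hasd (Q : R -> R^o) t (dQ t)) ->
  exists U' V' W' X' Y' Z' Q' : R -> R, energy_system p eps c U' V' W' X' Y' Z' Q' dQ /\
    forall t : R, 0 <= t ->
      [/\ U' t = U t, W' t = W t, X' t = X t, Z' t = Z t & Q' t = Q t].
Proof.
move=> pos sch /two_sided_extension[U' UE dU] /two_sided_extension[V' VE dV].
move=> /two_sided_extension[W' WE dW] /two_sided_extension[X' XE dX].
move=> /two_sided_extension[Y' YE dY] /two_sided_extension[Z' ZE dZ].
move=> /two_sided_extension[Q' QE ddQ].
exists U', V', W', X', Y', Z', Q'; split; last first.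
  by move=> t t0; rewrite UE// WE// XE// ZE// QE.
split=> t t0; rewrite ?UE// ?VE// ?WE// ?XE// ?YE// ?ZE// ?QE//; first exact: pos.
  exact: sch.
split; split; [exact: dU|exact: dV|exact: dW|exact: dX|exact: dY|exact: dZ|exact: ddQ].
Qed.

(** The linear equation with the coefficient [c] on the range of a projection,
as a first order system for the curve [u] and its velocity [v]. *)
Record damped_wave (p eps : R) (Pn : H -> H) (c : R -> R) u v : Prop := {
  dw_rngu : forall t, Pn (u t) = u t;
  dw_rngv : forall t, Pn (v t) = v t;
  dw_du : forall t : R, 0 <= t -> hasd u t (v t);
  dw_dv : forall t : R, 0 <= t ->
    hasd v t (- eps^-1 *: ((1 + t) `^ (- p) *: v t + c t *: A (u t))) }.

Lemma damped_wave_hasdA p eps n c u v : damped_wave p eps (P n) c u v ->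
  forall t : R, 0 <= t -> hasd (fun s => A (u s)) t (A (v t)).
Proof.
move=> dw t t0; rewrite -(dw_rngv dw).
have -> : (fun s => A (u s)) = (fun s => A (P n (u s))).
  by apply/funext => s; rewrite (dw_rngu dw).
apply: (hasd_map (trunc_A_linear n)) (dw_du dw t0) => x.
exact: tr_bndA tr n x.
Qed.

Lemma damped_wave_hasdS p eps n c u v : damped_wave p eps (P n) c u v ->
  forall t : R, 0 <= t -> hasd (fun s => S (u s)) t (S (v t)).
Proof.
move=> dw t t0; rewrite -(dw_rngv dw).
have -> : (fun s => S (u s)) = (fun s => S (P n (u s))).
  by apply/funext => s; rewrite (dw_rngu dw).
apply: (hasd_map (trunc_S_linear n)) (dw_du dw t0) => x.
exact: tr_bndS tr n x.
Qed.

Lemma trunc_domA n x : P n x = x -> opdom A x.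
Proof. by move=> <-; exact: (tr_domA tr). Qed.

Lemma trunc_domS n x : P n x = x -> opdom S x.
Proof. by move=> <-; exact: (tr_domS tr). Qed.

Lemma damped_wave_hasdSv p eps n c u v : damped_wave p eps (P n) c u v ->
  forall t : R, 0 <= t -> hasd (fun s => S (v s)) t
    (- eps^-1 *: ((1 + t) `^ (- p) *: S (v t) + c t *: S (A (u t)))).
Proof.
move=> dw t t0.
have rA : P n (A (u t)) = A (u t) by rewrite -(dw_rngu dw) (tr_rngA tr).
have E a b : S (P n (a *: (b *: v t + c t *: A (u t)))) =
    a *: (b *: S (v t) + c t *: S (A (u t))).
  have SZ := homogeneous_of_linear (trunc_S_linear n).
  by rewrite SZ trunc_S_linear SZ (dw_rngv dw) rA.
rewrite -E.
have -> : (fun s => S (v s)) = (fun s => S (P n (v s))).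
  by apply/funext => s; rewrite (dw_rngv dw).
apply: (hasd_map (trunc_S_linear n)) (dw_dv dw t0) => x.
exact: tr_bndS tr n x.
Qed.

Lemma hasd_val (V : normedModType R) (f : R -> V) (t : R) (a b : V) :
  hasd f t a -> a = b -> hasd f t b.
Proof. by move=> h <-. Qed.

Lemma damped_wave_energy_system p eps n c u v : 0 < eps ->
  damped_wave p eps (P n) c u v ->
  exists U V W X Y Z Q dQ : R -> R, energy_system p eps c U V W X Y Z Q dQ /\
    forall t : R, 0 <= t -> [/\ U t = `|u t| ^+ 2, W t = `|v t| ^+ 2,
      X t = `|S (u t)| ^+ 2, Z t = `|S (v t)| ^+ 2 & Q t = `|A (u t)| ^+ 2].
Proof.
move=> eps0 dw.
have en := gt_eqF eps0.
have du := dw_du dw; have dv := dw_dv dw.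
have dA := damped_wave_hasdA dw; have dS := damped_wave_hasdS dw.
have dSv := damped_wave_hasdSv dw.
have Du t : opdom A (u t) := trunc_domA (dw_rngu dw t).
have Dv t : opdom A (v t) := trunc_domA (dw_rngv dw t).
have Su t : opdom S (u t) := trunc_domS (dw_rngu dw t).
have Sv t : opdom S (v t) := trunc_domS (dw_rngv dw t).
have SA t : opdom S (A (u t)).
  by apply: (@trunc_domS n); rewrite -(dw_rngu dw) (tr_rngA tr).
have f := tr_form tr.
pose U t := dot (u t) (u t); pose V t := dot (u t) (v t); pose W t := dot (v t) (v t).
pose X t := dot (S (u t)) (S (u t)); pose Y t := dot (S (u t)) (S (v t)).
pose Z t := dot (S (v t)) (S (v t)); pose Q t := dot (A (u t)) (A (u t)).
pose dQ t := 2 * dot (A (v t)) (A (u t)).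
have YE t : Y t = dot (A (u t)) (v t) by rewrite /Y f.
have XE t : X t = dot (A (u t)) (u t) by rewrite /X f.
have [] := @energy_system_of_hasd p eps c U V W X Y Z Q dQ.
- by move=> t t0; split; exact: dot_ge0.
- move=> t t0; split; [exact: cauchy_schwarz_sq|exact: cauchy_schwarz_sq|].
  by rewrite YE; exact: cauchy_schwarz_sq.
- move=> t t0; apply: hasd_val (hasd_dot hp (du t t0) (du t t0)) _.
  by rewrite (dotC _ (v t)) /V (dotC _ (u t)); ring.
- move=> t t0; apply: hasd_val (hasd_dot hp (du t t0) (dv t t0)) _.
  rewrite dotZr dotDr !dotZr /W /V XE (dotC _ (u t) (A _)); field.
  by rewrite en.
- move=> t t0; apply: hasd_val (hasd_dot hp (dv t t0) (dv t t0)) _.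
  rewrite dotZl dotZr dotDr dotDl !(dotZr, dotZl) /W YE (dotC _ (v t) (A _)); field.
  by rewrite en.
- move=> t t0; apply: hasd_val (hasd_dot hp (dS t t0) (dS t t0)) _.
  by rewrite (dotC _ (S (v t))) /Y; ring.
- move=> t t0; apply: hasd_val (hasd_dot hp (dS t t0) (dSv t t0)) _.
  rewrite dotZr dotDr !dotZr /Z /Y /Q.
  have -> : dot (S (u t)) (S (A (u t))) = dot (A (u t)) (A (u t)) by rewrite f.
  by field; rewrite en.
- move=> t t0; apply: hasd_val (hasd_dot hp (dSv t t0) (dSv t t0)) _.
  rewrite dotZl dotZr dotDr dotDl !(dotZr, dotZl) /Z /dQ (dotC _ (S (A _))).
  have -> : dot (S (v t)) (S (A (u t))) = dot (A (v t)) (A (u t)) by rewrite f.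
  by field; rewrite en.
- move=> t t0; apply: hasd_val (hasd_dot hp (dA t t0) (dA t t0)) _.
  by rewrite /dQ (dotC _ (A (u t))); ring.
move=> U' [V'] [W'] [X'] [Y'] [Z'] [Q'] [es E].
exists U', V', W', X', Y', Z', Q', dQ; split=> // t t0.
by have [-> -> -> -> ->] := E t t0; rewrite /U /W /X /Z /Q !hp.
Qed.

End TruncatedProblem.

Section TruncatedExistence.
Context {R : realType} {H : completeNormedModType R}.
Variable dot : {dot H for (idfun : R -> R)}.
Hypothesis hp : hilbert_product dot.
Variables (A S : operator H) (P : nat -> H -> H).
Hypothesis tr : truncation dot A S P.
Implicit Types (x y z : H) (u v : R -> H).

Lemma min_lipschitz (a b m : R) : `|Num.min a m - Num.min b m| <= `|a - b|.
Proof.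
rewrite ler_norml; have := ler_norm (a - b); have := ler_norm (b - a).
rewrite (distrC b) => h1 h2.
by apply/andP; split; rewrite /Num.min; case: ltP => h3; case: ltP => h4; lra.
Qed.

(** The a priori bound on [s = |S u|] is below the cut-off [m], so that the cut-off
is invisible in the end. *)
Definition cut_power (m g s : R) : R := Num.min s m `^ (2 * g).

Lemma cut_power_bound m g s : 0 <= m -> 1 <= g -> 0 <= s ->
  0 <= cut_power m g s <= m `^ (2 * g).
Proof.
move=> m0 g1 s0; rewrite powR_ge0 powR_mono//; first by lra.
  by rewrite le_min s0.
by rewrite ge_min lexx orbT.
Qed.

(** Beyond the cut-off the coefficient is constant, and below it the operator
part is bounded, so the product is globally Lipschitz. *)
Lemma cut_nonlinearity_lipschitz n (m g : R) : 0 <= m -> 1 <= g ->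
  exists2 C : R, 0 <= C & forall x y,
  `|cut_power m g `|S (P n x)| *: A (P n x) - cut_power m g `|S (P n y)| *: A (P n y)|
  <= C * `|x - y|.
Proof.
move=> m0 g1.
have nn : 0 <= (n%:R : R) by [].
pose C1 := m `^ (2 * g) * n%:R ^+ 2.
pose C2 := 2 * g * m `^ (2 * g - 1) * n%:R * (n%:R * m).
have g20 : 0 <= 2 * g by lra.
have C10 : 0 <= C1 by rewrite mulr_ge0 ?powR_ge0 ?sqr_ge0.
have C20 : 0 <= C2 by rewrite !mulr_ge0 ?powR_ge0//; lra.
exists (C1 + C2); first exact: addr_ge0.
move=> x y; wlog yx : x y / `|S (P n y)| <= `|S (P n x)|.
  move=> W; have [|/ltW h] := leP `|S (P n y)| `|S (P n x)|; first exact: W.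
  by rewrite distrC [`|x - y|]distrC; exact: W.
set a := `|S (P n x)|; set b := `|S (P n y)|.
have -> : cut_power m g a *: A (P n x) - cut_power m g b *: A (P n y) =
    cut_power m g a *: (A (P n x) - A (P n y)) +
    (cut_power m g a - cut_power m g b) *: A (P n y).
  by rewrite scalerBr scalerBl addrA subrK.
apply: le_trans (ler_normD _ _) _; rewrite mulrDl !normrZ; apply: lerD.
  have /andP[c0 c1] := cut_power_bound m0 g1 (normr_ge0 (S (P n x))).
  rewrite ger0_norm// -mulrA; apply: ler_pM => //.
  by have [] := linear_distance (trunc_A_linear tr n) (tr_bndA tr n) x y.
have [mb|bm] := leP m b.
  have -> : cut_power m g a = cut_power m g b.
    by rewrite /cut_power !(min_idPr _)// (le_trans mb).
  by rewrite subrr normr0 mul0r mulr_ge0.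
have ab : `|cut_power m g a - cut_power m g b| <=
    2 * g * m `^ (2 * g - 1) * (n%:R * `|x - y|).
  have hI z : 0 <= Num.min `|S (P n z)| m <= m.
    by rewrite le_min normr_ge0 m0 ge_min lexx orbT.
  apply: (le_trans (@powR_lipschitz R (2 * g) m _ _ _ (hI y) (hI x))); first by lra.
  rewrite ler_wpM2l ?mulr_ge0 ?powR_ge0//; first by lra.
  apply: (le_trans (min_lipschitz _ _ _)).
  apply: (le_trans (ler_dist_dist _ _)).
  by have [] := linear_distance (trunc_S_linear tr n) (tr_bndS tr n) x y.
have bA : `|A (P n y)| <= n%:R * m.
  apply: (le_trans (trunc_A_le_S hp tr n y)); rewrite ler_wpM2l//; exact: ltW.
apply: (le_trans (ler_pM _ _ ab bA)) => //.
by rewrite le_eqVlt; apply/orP; left; apply/eqP; rewrite /C2; ring.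
Qed.

Lemma damped_wave_exists n (m g p eps : R) x0 y0 : 0 <= m -> 1 <= g -> 0 <= p <= 1 ->
  0 < eps -> exists u v, [/\ u 0 = P n x0, v 0 = P n y0 &
    damped_wave A p eps (P n) (fun t => cut_power m g `|S (u t)|) u v].
Proof.
move=> m0 g1 p01 eps0; have /andP[p0 p1] := p01.
have [C C0 HC] := cut_nonlinearity_lipschitz n m0 g1.
have ei : 0 < eps^-1 by rewrite invr_gt0.
pose phi x := cut_power m g `|S (P n x)| *: A (P n x).
pose f (t : R) x y : H := - eps^-1 *: ((1 + t) `^ (- p) *: y + phi x).
have b1 (t : R) : 0 <= t -> (1 + t) `^ (- p) <= 1.
  by move=> t0; rewrite powR_neg_le1 ?oppr_le0// lerDl.
have b0 (t : R) : `|(1 + t) `^ (- p)| = (1 + t) `^ (- p) by rewrite ger0_norm// powR_ge0.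
have [u [v [u0 v0 du dv]]] : exists u v : R -> H,
    [/\ u 0 = x0, v 0 = y0, (forall t : R, 0 <= t -> hasd u t (v t)) &
      forall t : R, 0 <= t -> hasd v t (f t (u t) (v t))].
  apply: (@second_order_picard R H dot hp f (1 + eps^-1 * (1 + C))
    (eps^-1 * (`|y0| + `|phi x0|)) x0 y0).
  - by rewrite lerDl mulr_ge0 ?addr_ge0// ltW.
  - move=> t x y x' y' t0; rewrite /f -scalerBr normrZ normrN (gtr0_norm ei).
    rewrite opprD addrACA -scalerBr.
    apply: (@le_trans _ _ (eps^-1 * (1 + C) * (`|x - x'| + `|y - y'|))); last first.
      by rewrite ler_wpM2r ?addr_ge0// lerDr.
    rewrite -mulrA ler_wpM2l ?(ltW ei)//; apply: le_trans (ler_normD _ _) _.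
    rewrite normrZ b0.
    apply: (@le_trans _ _ (1 * `|y - y'| + C * `|x - x'|)).
      by apply: lerD; [rewrite ler_wpM2r// b1|exact: HC].
    have := normr_ge0 (x - x'); have := normr_ge0 (y - y').
    move: (`|_|) (`|_|) => r s r0 s0; have := mulr_ge0 C0 r0; nra.
  - move=> T; exists eps^-1; first exact: ltW.
    move=> s t x y /andP[s0 _] /andP[t0 _].
    rewrite /f -scalerBr opprD addrACA subrr addr0 -scalerBl !normrZ normrN (gtr0_norm ei).
    rewrite -!mulrA ler_wpM2l ?(ltW ei)//; apply: ler_pM => //.
      exact: damping_lipschitz.
    by rewrite lerDr addr_ge0.
  - move=> t t0; rewrite /f normrZ normrN (gtr0_norm ei) ler_wpM2l ?(ltW ei)//.
    apply: le_trans (ler_normD _ _) _; rewrite normrZ b0 lerD2r.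
    by rewrite ler_piMl// b1.
have PZ := homogeneous_of_linear (tr_lin tr n).
have PP x : P n (P n x) = P n x by have [] := tr_mono tr x (leqnn n).
have cP x : `|P n x| <= 1 * `|x| by rewrite mul1r; exact: tr_contract tr n x.
exists (fun t => P n (u t)), (fun t => P n (v t)); split; rewrite ?u0 ?v0//.
split=> [t|t|t t0|t t0]; rewrite ?PP//.
  exact: hasd_map (tr_lin tr n) cP (du t t0).
apply: (hasd_val (hasd_map (tr_lin tr n) cP (dv t t0))).
by rewrite /f /phi PZ (tr_lin tr) PZ (tr_rngA tr).
Qed.

End TruncatedExistence.

Section Approximation.
Context {R : realType} {H : completeNormedModType R}.
Variable dot : {dot H for (idfun : R -> R)}.
Hypothesis hp : hilbert_product dot.
Variables (A S : operator H) (P : nat -> H -> H).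
Hypothesis tr : truncation dot A S P.
Implicit Types (x y z : H) (u v : R -> H).

(** The numbers [x], [q], [w] stand for [|S u|^2], [|A u|^2], [|u'|^2]. *)
Definition decay_bounds (g p M C1 C2 t x q w : R) : Prop :=
  [/\ x <= M, C1 <= x * (1 + t) `^ ((p + 1) / g),
      x * (1 + t) `^ ((p + 1) / (g + 1)) <= C2,
      q * (1 + t) `^ ((p + 1) / g) <= C2 &
      w * (1 + t) `^ ((p + 1) / g + 2 * ((p + 1) / (g + 1)) * g - 2 * p) <= C2].

Lemma normr_sqr_powR (V : normedModType R) (x : V) (g : R) :
  (`|x| ^+ 2) `^ g = `|x| `^ (2 * g).
Proof. by rewrite powRrM powR_mulrn. Qed.

Lemma cut_power_sqr (M g s : R) : 0 <= s -> s ^+ 2 <= M ->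
  cut_power (Num.sqrt M) g s = (s ^+ 2) `^ g.
Proof.
move=> s0 sM; rewrite /cut_power (min_idPl _) ?powRrM ?powR_mulrn//.
by rewrite -(ger0_norm s0) -sqrtr_sqr ler_wsqrtr.
Qed.

(** Skipping the first [N] truncations keeps [|S (P n u0)|] away from zero, so
that the a priori estimates are uniform in [n]. *)
Lemma approximants_exist (g p : R) (u0 u1 : H) :
  1 <= g -> 0 <= p <= 1 -> 2 * p <= (p + 1) / g + (p + 1) / (g + 1) * (g - 1) ->
  opdom A u0 -> opdom S u1 -> S u0 <> 0 ->
  exists eps0 M C1 C2 : R, [/\ 0 < eps0, 1 <= M, 0 < C1 & 0 < C2] /\
    forall eps : R, 0 < eps < eps0 ->
    exists (N : nat) (u_ v_ : nat -> R -> H), forall n,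
      [/\ u_ n 0 = P (N + n) u0, v_ n 0 = P (N + n) u1,
        damped_wave A p eps (P (N + n)) (fun t => (`|S (u_ n t)| ^+ 2) `^ g) (u_ n) (v_ n) &
        forall t : R, 0 <= t -> decay_bounds g p M C1 C2 t
          (`|S (u_ n t)| ^+ 2) (`|A (u_ n t)| ^+ 2) (`|v_ n t| ^+ 2)].
Proof.
move=> g1 p01 pg Du0 Su1 Su0.
have Du0' := tr_domAS tr Du0.
pose K := 1 + `|u0| ^+ 2 + `|u1| ^+ 2 + `|S u0| ^+ 2 + `|S u1| ^+ 2 + `|A u0| ^+ 2.
have K1 : 1 <= K by rewrite /K -!addrA lerDl !addr_ge0 ?sqr_ge0.
have x0p : 0 < `|S u0| by rewrite normr_gt0; exact/eqP.
have x0 : 0 < (`|S u0| / 2) ^+ 2 by rewrite exprn_gt0// divr_gt0.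
have [eps0 [M [C1 [C2 [[e0 M1 C10 C20] HU]]]]] := uniform_energy_estimates g1 p01 pg x0 K1.
have M0 : 0 <= M by apply: le_trans M1.
exists eps0, M, C1, C2; split=> // eps epsI; have /andP[eps_gt0 _] := epsI.
have [N HN] := tr_cvg tr (S u0) (divr_gt0 x0p (ltr0n _ 2 : 0 < 2)).
pose sol n (uv : (R -> H) * (R -> H)) := [/\ uv.1 0 = P (N + n) u0, uv.2 0 = P (N + n) u1 &
  damped_wave A p eps (P (N + n)) (fun t => cut_power (Num.sqrt M) g `|S (uv.1 t)|) uv.1 uv.2].
have /choice[uv uvP] : forall n, exists w, sol n w.
  move=> n; have [u [v h]] := damped_wave_exists hp tr (N + n) u0 u1 (sqrtr_ge0 M) g1 p01 eps_gt0.
  by exists (u, v).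
exists N, (fun n => (uv n).1), (fun n => (uv n).2) => n.
have [i1 i2 dw] := uvP n.
have b : forall t : R, 0 <= t -> decay_bounds g p M C1 C2 t (`|S ((uv n).1 t)| ^+ 2)
    (`|A ((uv n).1 t)| ^+ 2) (`|(uv n).2 t| ^+ 2).
  have [U [V [W [X [Y [Z [Q [dQ [es E]]]]]]]]] := damped_wave_energy_system hp tr eps_gt0 dw.
  have [U0 W0 X0 Z0 Q0] := E 0 (lexx 0).
  have sqle (V' : normedModType R) (a b : V') : `|a| <= `|b| -> `|a| ^+ 2 <= `|b| ^+ 2.
    by move=> h; rewrite ler_sqr ?nnegrE.
  have h := HU eps _ U V W X Y Z Q dQ epsI es.
  move=> t t0; have [E1 E2 E3 E4 E5] := E t t0.
  have [] := h _ _ _ t t0.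
  - move=> s s0; have [_ _ -> _ _] := E s s0 => h'.
    by rewrite cut_power_sqr.
  - rewrite X0 i1 (tr_comS tr)// ler_sqr ?nnegrE ?divr_ge0//.
    have h1 := HN _ (leq_addr n N).
    have := ler_normB (P (N + n) (S u0)) (P (N + n) (S u0) - S u0).
    by rewrite opprB addrC subrK => h2; lra.
  - rewrite U0 W0 X0 Z0 Q0 i1 i2 (tr_comS tr)// (tr_comS tr)// (tr_comA tr)//.
    have h1 := sqle _ _ _ (tr_contract tr (N + n) u0).
    have h2 := sqle _ _ _ (tr_contract tr (N + n) u1).
    have h3 := sqle _ _ _ (tr_contract tr (N + n) (S u0)).
    have h4 := sqle _ _ _ (tr_contract tr (N + n) (S u1)).
    have h5 := sqle _ _ _ (tr_contract tr (N + n) (A u0)).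
    have q1 := sqr_ge0 `|u0|; have q2 := sqr_ge0 `|u1|; have q3 := sqr_ge0 `|S u0|.
    have q4 := sqr_ge0 `|S u1|; have q5 := sqr_ge0 `|A u0|.
    by rewrite /K; split; lra.
  rewrite E3 E5 E2 E4 => b1 b2 b3 b4 b5; split=> //.
  apply: le_trans b4; rewrite ler_wpM2r ?powR_ge0// lerDr divr_ge0 ?mulr_ge0 ?sqr_ge0//.
    exact: ltW.
  by rewrite powR_ge0.
split=> //; split; [exact: dw_rngu dw|exact: dw_rngv dw|exact: dw_du dw|].
move=> t t0; have [h _ _ _ _] := b t t0.
by have := dw_dv dw t0; rewrite cut_power_sqr.
Qed.

End Approximation.

(** * Energy estimates for differences *)

Section EnergyMethod.
Context {R : realType} {H : completeNormedModType R}.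
Variable dot : {dot H for (idfun : R -> R)}.
Hypothesis hp : hilbert_product dot.
Implicit Types (x y z : H) (u v : R -> H).

Lemma hasdM (f df h dh : R -> R) :
  (forall t : R, 0 <= t -> hasd (f : R -> R^o) t (df t)) ->
  (forall t : R, 0 <= t -> hasd (h : R -> R^o) t (dh t)) ->
  forall t : R, 0 <= t ->
    hasd ((fun s => f s * h s) : R -> R^o) t (df t * h t + f t * dh t).
Proof.
move=> /two_sided_extension[f' fE fd] /two_sided_extension[h' hE hd] t t0.
have := hasd_is_derive (isder_mul (fd t t0) (hd t t0)); rewrite fE// hE//.
by apply: hasd_ext => // s s0; rewrite fE// hE.
Qed.

(** The energy [eps |y|^2 + c |z|^2] covers two orders: [(y, z)] is [(u', S u)] or
[(S u', A u)]. *)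
Lemma energy_estimate (y y' z z' : R -> H) (c dc : R -> R) (eps k K1 K2 T : R) :
  0 < eps -> 0 < k -> 0 <= K1 ->
  (forall t : R, 0 <= t -> hasd y t (y' t)) ->
  (forall t : R, 0 <= t -> hasd z t (z' t)) ->
  (forall t : R, 0 <= t -> hasd (c : R -> R^o) t (dc t)) ->
  (forall t : R, 0 <= t <= T -> [/\ k <= c t, `|dc t| <= K1 &
     eps * dot (y t) (y' t) + c t * dot (z t) (z' t) <= K2 * (`|y t| * `|z t|)]) ->
  forall t : R, 0 <= t <= T ->
    eps * `|y t| ^+ 2 + k * `|z t| ^+ 2 <=
    expR ((eps^-1 + (K1 + K2 ^+ 2) / k) * t) * (eps * `|y 0| ^+ 2 + c 0 * `|z 0| ^+ 2).
Proof.
move=> e0 k0 K10 yd zd cd h t tT.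
pose D (s : R) := eps * dot (y s) (y s) + c s * dot (z s) (z s).
have Dd (s : R) : 0 <= s -> hasd (D : R -> R^o) s
    (eps * (dot (y' s) (y s) + dot (y s) (y' s)) +
     (dc s * dot (z s) (z s) + c s * (dot (z' s) (z s) + dot (z s) (z' s)))).
  move=> s0; apply: hasdD.
    exact: hasdZ (hasd_dot hp (yd s s0) (yd s s0)).
  apply: (@hasdM c dc (fun r => dot (z r) (z r))
    (fun r => dot (z' r) (z r) + dot (z r) (z' r)) cd _ s s0) => r r0.
  by apply: hasd_val (hasd_dot hp (zd r r0) (zd r r0)) _.
have := gronwall (C := eps^-1 + (K1 + K2 ^+ 2) / k) (T := T) Dd _ tT.
rewrite /D !hp => G; have {}G := G _.
have [kc _ _] := h t tT.
apply: le_trans (G _).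
  by rewrite lerD2l ler_wpM2r ?sqr_ge0.
move=> s sT; have [{}kc dcK hs] := h s sT.
rewrite !hp (dotC _ (y' s)) (dotC _ (z' s)).
have h1 : dc s * `|z s| ^+ 2 <= K1 * `|z s| ^+ 2.
  by rewrite ler_wpM2r ?sqr_ge0// (le_trans (ler_norm _)).
have h2 : 2 * K2 * (`|y s| * `|z s|) <= `|y s| ^+ 2 + K2 ^+ 2 * `|z s| ^+ 2.
  by have := sqr_ge0 (`|y s| - K2 * `|z s|); rewrite !expr2; lra.
have h3 : (K1 + K2 ^+ 2) * `|z s| ^+ 2 <= (K1 + K2 ^+ 2) / k * (c s * `|z s| ^+ 2).
  rewrite -!mulrA ler_wpM2l ?addr_ge0 ?sqr_ge0//.
  by rewrite ler_pdivlMl// ler_wpM2r// sqr_ge0.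
have h4 : 0 <= (K1 + K2 ^+ 2) / k * (eps * `|y s| ^+ 2).
  by rewrite mulr_ge0// ?divr_ge0 ?addr_ge0 ?sqr_ge0 ?(ltW k0)// mulr_ge0 ?sqr_ge0 ?(ltW e0).
have h5 : 0 <= eps^-1 * (c s * `|z s| ^+ 2).
  rewrite mulr_ge0 ?invr_ge0 ?(ltW e0)// mulr_ge0 ?sqr_ge0//.
  exact: le_trans (ltW k0) kc.
have h6 : eps^-1 * (eps * `|y s| ^+ 2) = `|y s| ^+ 2 by rewrite mulrA mulVf ?mul1r// gt_eqF.
rewrite mulrDl !mulrDr h6.
clear -hs h1 h2 h3 h4 h5; lra.
Qed.

Lemma energy_small (eps k B G e : R) : 0 < eps -> 0 < k -> 0 <= B -> 0 <= G -> 0 < e ->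
  exists2 d : R, 0 < d & forall y z a b : R, 0 <= y -> 0 <= z -> 0 <= a <= d -> 0 <= b <= d ->
    eps * y ^+ 2 + k * z ^+ 2 <= B * (eps * a ^+ 2 + G * b ^+ 2) -> y <= e /\ z <= e.
Proof.
move=> eps0 k0 B0 G0 e0.
have m0 : 0 < Num.min eps k by rewrite lt_min eps0.
have c0 : 0 < 1 + B * (eps + G) by rewrite ltr_pwDl// mulr_ge0// addr_ge0// ltW.
exists (Num.min 1 (Num.min eps k * e ^+ 2 / (1 + B * (eps + G)))).
  by rewrite lt_min ltr01 divr_gt0// mulr_gt0// exprn_gt0.
move=> y z a b y0 z0 /andP[a0]; rewrite le_min => /andP[a1 ad] /andP[b0].
rewrite le_min => /andP[b1 bd] h.
set d := _ / _ in ad bd.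
have sq (r : R) : 0 <= r -> r <= 1 -> r <= d -> r ^+ 2 <= d.
  by move=> r0 r1 rd; apply: le_trans rd; rewrite expr2 ler_piMr.
have d0 : 0 <= d := le_trans a0 ad.
have h1 : B * (eps * a ^+ 2 + G * b ^+ 2) <= Num.min eps k * e ^+ 2.
  apply: (@le_trans _ _ (B * (eps * d + G * d))).
    by rewrite ler_wpM2l// lerD// ler_wpM2l ?(ltW eps0) ?sq.
  apply: (@le_trans _ _ ((1 + B * (eps + G)) * d)).
    by rewrite mulrDl mul1r -mulrDl mulrA lerDr.
  by rewrite /d mulrC divfK// gt_eqF.
have {}h := le_trans h h1.
have sqy (q r : R) : 0 <= q -> 0 < r -> Num.min eps k <= r ->
    r * q ^+ 2 <= Num.min eps k * e ^+ 2 -> q <= e.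
  move=> q0 r0 mr hq; rewrite -ler_sqr ?nnegrE ?(ltW e0)// -(ler_pM2l r0).
  by apply: (le_trans hq); rewrite ler_wpM2r ?sqr_ge0.
split.
  apply: (sqy y eps) => //; first by rewrite ge_min lexx.
  by apply: le_trans h; rewrite lerDl mulr_ge0 ?sqr_ge0// ltW.
apply: (sqy z k) => //; first by rewrite ge_min lexx orbT.
by apply: le_trans h; rewrite lerDr mulr_ge0 ?sqr_ge0// ltW.
Qed.

Variables (A S : operator H) (P : nat -> H -> H).
Hypothesis tr : truncation dot A S P.

(** The same system for curves with values in the domains of [A] and [S]. *)
Record strong_wave (p eps : R) (c : R -> R) u v : Prop := {
  sw_domA : forall t : R, 0 <= t -> opdom A (u t);
  sw_domS : forall t : R, 0 <= t -> opdom S (v t);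
  sw_du : forall t : R, 0 <= t -> hasd u t (v t);
  sw_dS : forall t : R, 0 <= t -> hasd (fun s => S (u s)) t (S (v t));
  sw_dv : forall t : R, 0 <= t ->
    hasd v t (- eps^-1 *: ((1 + t) `^ (- p) *: v t + c t *: A (u t))) }.

Lemma damped_wave_strong p eps n c u v : damped_wave A p eps (P n) c u v ->
  strong_wave p eps c u v.
Proof.
move=> dw; split=> t t0.
- exact: (trunc_domA tr (dw_rngu dw t)).
- exact: (trunc_domS tr (dw_rngv dw t)).
- exact: (dw_du dw t0).
- exact: (damped_wave_hasdS tr dw t0).
- exact: (dw_dv dw t0).
Qed.

Lemma op_sub (B : operator H) x y : linear_operator B -> opdom B x -> opdom B y ->
  opdom B (x - y) /\ B (x - y) = B x - B y.
Proof.
move=> [_ h] Bx By; have [] := h (- 1) y x By Bx.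
by rewrite !scaleN1r ![- _ + _]addrC.
Qed.

(** The difference of two waves solves the first equation up to the error
[(c1 - c2) A u2]; controlling it by [|S u1 - S u2|] closes the energy
estimate. *)
Lemma wave_difference p eps (c1 dc1 c2 : R -> R) u1 v1 u2 v2 (k K1 K2 T : R) :
  0 < eps -> 0 < k -> 0 <= K1 ->
  strong_wave p eps c1 u1 v1 -> strong_wave p eps c2 u2 v2 ->
  (forall t : R, 0 <= t -> hasd (c1 : R -> R^o) t (dc1 t)) ->
  (forall t : R, 0 <= t <= T -> [/\ k <= c1 t, `|dc1 t| <= K1 &
     `|c1 t - c2 t| * `|A (u2 t)| <= K2 * `|S (u1 t) - S (u2 t)|]) ->
  forall t : R, 0 <= t <= T ->
    eps * `|v1 t - v2 t| ^+ 2 + k * `|S (u1 t) - S (u2 t)| ^+ 2 <=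
    expR ((eps^-1 + (K1 + K2 ^+ 2) / k) * t) *
      (eps * `|v1 0 - v2 0| ^+ 2 + c1 0 * `|S (u1 0) - S (u2 0)| ^+ 2).
Proof.
move=> e0 k0 K10 w1 w2 cd h.
apply: (energy_estimate e0 k0 K10
  (fun t t0 => hasdB (sw_dv w1 t0) (sw_dv w2 t0))
  (fun t t0 => hasdB (sw_dS w1 t0) (sw_dS w2 t0)) cd) => t tT.
have [h1 h2 h3] := h t tT; split=> //.
have /andP[t0 _] := tT.
set b := (1 + t) `^ (- p); have b0 : 0 <= b by exact: powR_ge0.
have [Dw Aw] := op_sub (tr_linA tr) (sw_domA w1 t0) (sw_domA w2 t0).
have [Dv Sv] := op_sub (tr_linS tr) (sw_domS w1 t0) (sw_domS w2 t0).
have [_ Sw] := op_sub (tr_linS tr) (tr_domAS tr (sw_domA w1 t0)) (tr_domAS tr (sw_domA w2 t0)).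
rewrite -Sv -{1}Sw -(tr_form tr Dw Dv) Aw.
set y := v1 t - v2 t.
have -> : - eps^-1 *: (b *: v1 t + c1 t *: A (u1 t)) - - eps^-1 *: (b *: v2 t + c2 t *: A (u2 t)) =
   - eps^-1 *: (b *: y + c1 t *: (A (u1 t) - A (u2 t)) + (c1 t - c2 t) *: A (u2 t)).
  rewrite -scalerBr; congr (_ *: _).
  rewrite opprD addrACA -scalerBr -addrA; congr (_ + _).
  by rewrite scalerBr scalerBl addrA subrK.
set d := A (u1 t) - A (u2 t); set a := A (u2 t).
have -> : eps * dot y (- eps^-1 *: (b *: y + c1 t *: d + (c1 t - c2 t) *: a)) + c1 t * dot d y =
   - (b * `|y| ^+ 2) - (c1 t - c2 t) * dot y a.
  clearbody d a y; rewrite dotZr !dotDr !dotZr hp (dotC _ d y); field.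
  by rewrite gt_eqF.
have c : - ((c1 t - c2 t) * dot y a) <= K2 * (`|y| * `|S (u1 t) - S (u2 t)|).
  apply: le_trans (ler_norm _) _; rewrite normrN normrM.
  apply: (@le_trans _ _ (`|c1 t - c2 t| * (`|y| * `|a|))).
    by rewrite ler_wpM2l// (cauchy_schwarz hp).
  by rewrite [leLHS]mulrCA [leRHS]mulrCA ler_wpM2l.
have : 0 <= b * `|y| ^+ 2 by rewrite mulr_ge0 ?sqr_ge0.
by move: c; clear; lra.
Qed.

End EnergyMethod.

(** * Convergence of the approximations *)

Section Coefficient.
Context {R : realType} {H : completeNormedModType R}.
Variable dot : {dot H for (idfun : R -> R)}.
Hypothesis hp : hilbert_product dot.
Implicit Types (x y z : H) (u v : R -> H).

Lemma le_of_sqr_le (a C : R) : a ^+ 2 <= C -> a <= 1 + C.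
Proof. by have := sqr_ge0 (a - 1); have := sqr_ge0 a; rewrite !expr2; lra. Qed.

Lemma twice_product_le (a b d C : R) : a ^+ 2 <= C -> b ^+ 2 <= C -> d <= a * b ->
  2 * d <= 2 * C.
Proof. by have := sqr_ge0 (a - b); rewrite !expr2; lra. Qed.

Lemma coefficient_derivative (z z' : R -> H) (g : R) :
  (forall t : R, 0 <= t -> hasd z t (z' t)) -> (forall t : R, 0 <= t -> 0 < `|z t|) ->
  forall t : R, 0 <= t -> hasd ((fun s => (`|z s| ^+ 2) `^ g) : R -> R^o) t
    (g * (2 * dot (z t) (z' t) / `|z t| ^+ 2) * (`|z t| ^+ 2) `^ g).
Proof.
move=> zd z0 t t0.
have Xd (s : R) : 0 <= s -> hasd ((fun r => `|z r| ^+ 2) : R -> R^o) s (2 * dot (z s) (z' s)).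
  move=> s0; apply: (hasd_ext (fun r _ => hp (z r)) s0).
  apply: hasd_val (hasd_dot hp (zd s s0) (zd s s0)) _.
  by rewrite (dotC _ (z' s)); ring.
have [X XE dX] := two_sided_extension Xd.
have Xt : 0 < X t by rewrite XE// exprn_gt0// z0.
have := hasd_is_derive (isder_powR g Xt (dX t t0)); rewrite XE//.
by apply: hasd_ext => // s s0; rewrite XE.
Qed.

Lemma coefficient_derivative_bound (g M X d : R) : 1 <= g -> 0 < X <= M ->
  `|g * (d / X) * X `^ g| <= g * M `^ (g - 1) * `|d|.
Proof.
move=> g1 /andP[X0 XM]; have g0 : 0 <= g by apply: le_trans g1.
have -> : g * (d / X) * X `^ g = g * (X `^ (g - 1) * d).
  by rewrite (powR_pred g X0); field; rewrite gt_eqF.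
rewrite !normrM (ger0_norm g0) ger0_norm ?powR_ge0// mulrA ler_wpM2r// ler_wpM2l//.
by rewrite powR_mono ?subr_ge0// ltW.
Qed.

Lemma coefficient_lipschitz (g M : R) x y : 1 <= g -> `|x| ^+ 2 <= M -> `|y| ^+ 2 <= M ->
  `|(`|x| ^+ 2) `^ g - (`|y| ^+ 2) `^ g| <= g * M `^ (g - 1) * (2 * (1 + M)) * `|x - y|.
Proof.
move=> g1 xM yM; have g0 : 0 <= g by apply: le_trans g1.
have M0 : 0 <= M by apply: le_trans xM; exact: sqr_ge0.
apply: (le_trans (@powR_lipschitz R g M _ _ g1 _ _)); rewrite ?sqr_ge0//=.
rewrite -[leRHS]mulrA ler_wpM2l ?mulr_ge0 ?powR_ge0//.
rewrite subr_sqr normrM mulrC; apply: ler_pM => //; last exact: ler_dist_dist.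
by rewrite ger0_norm ?addr_ge0//; have := le_of_sqr_le xM; have := le_of_sqr_le yM; lra.
Qed.

Lemma decay_bounds_local (g p M C1 C2 T t x q w : R) : 1 <= g -> 0 <= p <= 1 ->
  0 < C1 -> 0 <= x -> 0 <= q -> 0 <= w -> 0 <= t <= T ->
  decay_bounds g p M C1 C2 t x q w ->
  [/\ C1 / (1 + T) `^ ((p + 1) / g) <= x, x <= M, q <= C2 & w <= C2].
Proof.
move=> g1 /andP[p0 p1] C10 x0 q0 w0 /andP[t0 tT] [b1 b2 _ b4 b5].
have g0 : 0 < g by apply: lt_le_trans g1.
have e1 : 0 <= (p + 1) / g by rewrite divr_ge0 ?addr_ge0// ltW.
have e2 : 0 <= (p + 1) / g + 2 * ((p + 1) / (g + 1)) * g - 2 * p.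
  rewrite -addrA addr_ge0// subr_ge0.
  have h : 1 / 2 <= g / (g + 1) by rewrite ler_pdivlMr ?addr_gt0//; lra.
  have -> : 2 * ((p + 1) / (g + 1)) * g = 2 * (p + 1) * (g / (g + 1)).
    by field; rewrite gt_eqF// addr_gt0.
  by nra.
have t1 : 1 <= 1 + t by rewrite lerDl.
have P0 (r s : R) : 0 <= s -> 0 < (1 + s) `^ r by move=> s0; rewrite powR_gt0// ltr_pwDl.
have P1 (r : R) : 0 <= r -> 1 <= (1 + t) `^ r.
  by move=> r0; rewrite -{1}(powRr0 (1 + t)) ler_powR.
have le1 (r s C : R) : 0 <= s -> 1 <= r -> s * r <= C -> s <= C.
  by move=> s0 r1; apply: le_trans; rewrite ler_peMr.
split=> //; [|exact: le1 (P1 _ e1) b4|exact: le1 (P1 _ e2) b5].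
rewrite ler_pdivrMr ?P0 ?(le_trans t0)//; apply: (le_trans b2).
by rewrite ler_wpM2l// powR_mono//; lra.
Qed.

End Coefficient.

Section Limit.
Context {R : realType} {H : completeNormedModType R}.
Variable dot : {dot H for (idfun : R -> R)}.
Hypothesis hp : hilbert_product dot.
Variables (A S : operator H) (P : nat -> H -> H).
Hypothesis tr : truncation dot A S P.
Variables (g p eps M C1 C2 : R) (u0 u1 : H) (N : nat) (u_ v_ : nat -> R -> H).
Hypotheses (g1 : 1 <= g) (p01 : 0 <= p <= 1) (eps0 : 0 < eps) (M1 : 1 <= M)
  (C10 : 0 < C1) (C20 : 0 < C2).
Hypotheses (Du0 : opdom A u0) (Du1 : opdom S u1).
Let cf (x : H) : R := (`|S x| ^+ 2) `^ g.
Hypothesis approximants : forall n,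
  [/\ u_ n 0 = P (N + n) u0, v_ n 0 = P (N + n) u1,
    damped_wave A p eps (P (N + n)) (fun t => cf (u_ n t)) (u_ n) (v_ n) &
    forall t : R, 0 <= t -> decay_bounds g p M C1 C2 t
      (`|S (u_ n t)| ^+ 2) (`|A (u_ n t)| ^+ 2) (`|v_ n t| ^+ 2)].
Implicit Types (x y z : H) (u v : R -> H).

Let g0 : 0 < g. Proof. exact: lt_le_trans g1. Qed.
Let M0 : 0 <= M. Proof. exact: le_trans M1. Qed.

Lemma approx_wave n : damped_wave A p eps (P (N + n)) (fun t => cf (u_ n t)) (u_ n) (v_ n).
Proof. by have [] := approximants n. Qed.

Lemma approx_bounds n (t T : R) : 0 <= t <= T ->
  [/\ C1 / (1 + T) `^ ((p + 1) / g) <= `|S (u_ n t)| ^+ 2,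
      `|S (u_ n t)| ^+ 2 <= M, `|A (u_ n t)| ^+ 2 <= C2 & `|v_ n t| ^+ 2 <= C2].
Proof.
move=> tT; have /andP[t0 _] := tT; have [_ _ _ /(_ t t0)] := approximants n.
by apply: decay_bounds_local; rewrite ?sqr_ge0.
Qed.

Lemma approx_S_gt0 n (t : R) : 0 <= t -> 0 < `|S (u_ n t)|.
Proof.
move=> t0; have [|h _ _ _] := approx_bounds n (t := t) (T := t); first by rewrite t0 lexx.
rewrite normr_gt0; apply/eqP => E; move: h; rewrite E normr0 expr0n/= leNgt divr_gt0//.
by rewrite powR_gt0// ltr_pwDl.
Qed.

Definition approx_dcf n (t : R) : R :=
  g * (2 * dot (S (u_ n t)) (S (v_ n t)) / `|S (u_ n t)| ^+ 2) * cf (u_ n t).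

Lemma approx_cf_der n (t : R) : 0 <= t ->
  hasd ((fun s => cf (u_ n s)) : R -> R^o) t (approx_dcf n t).
Proof.
move=> t0.
exact: (coefficient_derivative hp g (damped_wave_hasdS tr (approx_wave n))
  (@approx_S_gt0 n) t0).
Qed.

Let K1 := g * M `^ (g - 1) * (2 * C2).

Let K1_ge0 : 0 <= K1.
Proof. by rewrite !mulr_ge0 ?powR_ge0 ?(ltW g0) ?(ltW C20). Qed.

Lemma approx_dcf_bound n (t : R) : 0 <= t -> `|approx_dcf n t| <= K1.
Proof.
move=> t0; have [|h1 h2 h3 h4] := approx_bounds n (t := t) (T := t); first by rewrite t0 lexx.
have X0 : 0 < `|S (u_ n t)| ^+ 2 by rewrite exprn_gt0// approx_S_gt0.
apply: (le_trans (coefficient_derivative_bound _ g1 _)); first by rewrite X0; exact: h2.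
have Du : opdom A (u_ n t) := trunc_domA tr (dw_rngu (approx_wave n) t).
have Dv : opdom S (v_ n t) := trunc_domS tr (dw_rngv (approx_wave n) t).
rewrite ler_wpM2l ?mulr_ge0 ?powR_ge0 ?(ltW g0)//.
rewrite -(tr_form tr Du Dv) normrM ger0_norm//.
exact: twice_product_le h3 h4 (cauchy_schwarz hp _ _).
Qed.

Definition coefficient_floor (T : R) := (C1 / (1 + T) `^ ((p + 1) / g)) `^ g.

Lemma coefficient_floor_gt0 T : 0 <= T -> 0 < coefficient_floor T.
Proof. by move=> T0; rewrite powR_gt0// divr_gt0// powR_gt0// ltr_pwDl. Qed.

Lemma approx_cf_ge n (t T : R) : 0 <= t <= T -> coefficient_floor T <= cf (u_ n t) <= M `^ g.
Proof.
move=> tT; have [h1 h2 _ _] := approx_bounds n tT; have /andP[t0 tT'] := tT.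
apply/andP; split; apply: powR_mono; rewrite ?(ltW g0) ?sqr_ge0//.
by rewrite divr_ge0 ?powR_ge0 ?ltW.
Qed.

Lemma approx_init (x : H) (e : R) : 0 < e ->
  exists n0, forall m n, (n0 <= m)%N -> (n0 <= n)%N -> `|P (N + m) x - P (N + n) x| <= e.
Proof.
move=> e0; have [n0 h] := tr_cvg tr x (divr_gt0 e0 (ltr0n _ 2 : 0 < 2)).
exists n0 => m n m0 n0'; rewrite -[P (N + m) x](subrK x) -addrA.
apply: le_trans (ler_normD _ _) _; rewrite (splitr e) lerD//.
  by rewrite h// (leq_trans m0)// leq_addl.
by rewrite distrC h// (leq_trans n0')// leq_addl.
Qed.

(** The constants in [wave_difference] are the same for all pairs of
approximations, and the initial data converge. *)
Lemma approx_cauchy : luc_cauchy v_ /\ luc_cauchy (fun n t => S (u_ n t)).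
Proof.
suff h : forall T e : R, 0 < e -> exists n0, forall m n, (n0 <= m)%N -> (n0 <= n)%N ->
    forall t : R, 0 <= t <= T -> `|v_ m t - v_ n t| <= e /\ `|S (u_ m t) - S (u_ n t)| <= e.
  by split=> T e e0; have [n0 H0] := h T e e0; exists n0 => m n m0 n0' t tT;
    have [] := H0 m n m0 n0' t tT.
move=> T e e0.
have [T0|T0] := leP 0 T; last first.
  by exists 0%N => m n _ _ t /andP[t0 tT]; move: T0; rewrite ltNge (le_trans t0 tT).
pose K2 := g * M `^ (g - 1) * (2 * (1 + M)) * (1 + C2).
pose C := eps^-1 + (K1 + K2 ^+ 2) / coefficient_floor T.
have k0 := coefficient_floor_gt0 T0.
have [d d0 Hd] := energy_small eps0 k0 (expR_ge0 (C * T)) (powR_ge0 M g) e0.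
have [n1 H1] := approx_init u1 d0; have [n2 H2] := approx_init (S u0) d0.
exists (maxn n1 n2) => m n; rewrite !geq_max => /andP[m1 m2] /andP[n1' n2'] t tT.
have /andP[t0 tT'] := tT.
have [iu iv _ _] := approximants m; have [ju jv _ _] := approximants n.
have hw := wave_difference hp tr eps0 k0 K1_ge0
  (damped_wave_strong tr (approx_wave m)) (damped_wave_strong tr (approx_wave n))
  (@approx_cf_der m).
have {}hw := hw K2 T _ t tT.
apply: (Hd _ _ `|v_ m 0 - v_ n 0| `|S (u_ m 0) - S (u_ n 0)|) => //.
- by rewrite normr_ge0 iv jv H1.
- by rewrite normr_ge0 iu ju !(tr_comS tr) ?H2//; exact: (tr_domAS tr Du0).
apply: (le_trans (hw _)).
  move=> s sT; have /andP[s0 _] := sT; have /andP[h1 _] := approx_cf_ge m sT.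
  split=> //; first exact: approx_dcf_bound.
  have [_ a1 _ _] := approx_bounds m sT; have [_ b1 b2 _] := approx_bounds n sT.
  have h := coefficient_lipschitz g1 a1 b1.
  have bA : `|A (u_ n s)| <= 1 + C2.
    exact: (le_of_sqr_le b2).
  by rewrite /K2 [leRHS]mulrAC; apply: ler_pM.
rewrite -/C; apply: ler_pM; rewrite ?expR_ge0//.
- by rewrite addr_ge0 ?mulr_ge0 ?sqr_ge0 ?powR_ge0 ?(ltW eps0).
- rewrite ler_expR ler_wpM2l// addr_ge0 ?invr_ge0 ?(ltW eps0)// divr_ge0 ?(ltW k0)//.
  by rewrite addr_ge0 ?sqr_ge0.
- rewrite lerD2l ler_wpM2r ?sqr_ge0//.
  have zT : 0 <= (0 : R) <= T by rewrite lexx.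
  by have /andP[] := approx_cf_ge m zT.
Qed.

Lemma trunc_comm k n x : P k (P n x) = P n (P k x).
Proof.
have [h|/ltnW h] := leqP k n; first by have [-> ->] := tr_mono tr x h.
by have [-> ->] := tr_mono tr x h.
Qed.

(** The high frequencies [x - P k x] of an approximation solve the same linear
equation, so the energy of the next order is controlled by that of the data,
uniformly in the approximation. *)
Lemma approx_tails (T e : R) : 0 < e -> exists k, forall n (t : R), 0 <= t <= T ->
  `|S (v_ n t) - P k (S (v_ n t))| <= e /\ `|A (u_ n t) - P k (A (u_ n t))| <= e.
Proof.
move=> e0.
have [T0|T0] := leP 0 T; last first.
  by exists 0%N => n t /andP[t0 tT]; move: T0; rewrite ltNge (le_trans t0 tT).
pose C := eps^-1 + (K1 + 0 ^+ 2) / coefficient_floor T.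
have k0 := coefficient_floor_gt0 T0.
have [d d0 Hd] := energy_small eps0 k0 (expR_ge0 (C * T)) (powR_ge0 M g) e0.
have [n1 H1] := tr_cvg tr (S u1) d0; have [n2 H2] := tr_cvg tr (A u0) d0.
pose k := maxn n1 n2; exists k => n t tT.
have dw := approx_wave n; have [iu iv _ _] := approximants n.
have Pk x : `|P k x| <= 1 * `|x| by rewrite mul1r; exact: (tr_contract tr k x).
pose Q x := x - P k x.
have Ql (a : R) x y : Q (a *: x + y) = a *: Q x + Q y.
  by rewrite /Q (tr_lin tr) scalerBr opprD addrACA.
have Qd (w w' : R -> H) (s : R) : hasd w s (w' s) -> hasd (fun r => Q (w r)) s (Q (w' s)).
  by move=> h; apply: hasdB => //; exact: hasd_map (tr_lin tr k) Pk h.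
pose Sv' (s : R) : H := - eps^-1 *: ((1 + s) `^ (- p) *: S (v_ n s) + cf (u_ n s) *: S (A (u_ n s))).
have yd (s : R) : 0 <= s -> hasd (fun r => Q (S (v_ n r))) s (Q (Sv' s)).
  by move=> s0; apply: (Qd _ Sv'); exact: (damped_wave_hasdSv tr dw s0).
have zd (s : R) : 0 <= s -> hasd (fun r => Q (A (u_ n r))) s (Q (A (v_ n s))).
  by move=> s0; apply: (Qd _ (fun r => A (v_ n r))); exact: (damped_wave_hasdA tr dw s0).
have h := energy_estimate hp eps0 k0 K1_ge0 yd zd (@approx_cf_der n).
have {}h := h 0 T _ t tT.
have QP x (r : nat) : Q (P r x) = P r (Q x).
  rewrite /Q trunc_comm.
  have := tr_lin tr r (- 1) (P k x) x.
  by rewrite !scaleN1r ![- _ + _]addrC => ->.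
apply: (Hd _ _ `|Q (S (v_ n 0))| `|Q (A (u_ n 0))|) => //.
- rewrite normr_ge0 iv (tr_comS tr)// QP; apply: le_trans (tr_contract tr _ _) _.
  by rewrite /Q distrC H1// leq_maxl.
- rewrite normr_ge0 iu (tr_comA tr)// QP; apply: le_trans (tr_contract tr _ _) _.
  by rewrite /Q distrC H2// leq_maxr.
apply: (le_trans (h _)); last first.
  apply: ler_pM; rewrite ?expR_ge0//.
  - rewrite addr_ge0 ?mulr_ge0 ?sqr_ge0 ?powR_ge0 ?(ltW eps0)//.
  - have /andP[t0 tT'] := tT.
    rewrite ler_expR ler_wpM2l// addr_ge0 ?invr_ge0 ?(ltW eps0)// divr_ge0 ?(ltW k0)//.
    by rewrite addr_ge0 ?sqr_ge0.
  - rewrite lerD2l ler_wpM2r ?sqr_ge0//.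
    have zT : 0 <= (0 : R) <= T by rewrite lexx.
    by have /andP[] := approx_cf_ge n zT.
move=> s sT; have /andP[s0 _] := sT; have /andP[h1 _] := approx_cf_ge n sT.
split=> //; first exact: approx_dcf_bound.
have Du : opdom A (u_ n s) := trunc_domA tr (dw_rngu dw s).
have Dv : opdom A (v_ n s) := trunc_domA tr (dw_rngv dw s).
have Sv := tr_domAS tr Dv.
have SA : opdom S (A (u_ n s)).
  by apply: (trunc_domS tr (n := N + n)); rewrite -(dw_rngu dw) (tr_rngA tr).
have QZ := homogeneous_of_linear Ql.
have form : dot (Q (S (v_ n s))) (Q (S (A (u_ n s)))) = dot (Q (A (v_ n s))) (Q (A (u_ n s))).
  have [Dq qA] := op_sub (tr_linA tr) Dv (tr_domA tr k (v_ n s)).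
  have [_ qS] := op_sub (tr_linS tr) Sv (tr_domS tr k (v_ n s)).
  have [Dq' qS'] := op_sub (tr_linS tr) SA (tr_domS tr k (A (u_ n s))).
  rewrite /Q -(tr_comS tr k Sv) -(tr_comS tr k SA) -qS -qS'.
  by rewrite -(tr_form tr Dq Dq') qA (tr_comA tr).
rewrite mul0r /Sv' QZ Ql QZ dotZr dotDr !dotZr form hp (dotC _ (Q (A (u_ n s)))).
have b0 : 0 <= (1 + s) `^ (- p) * `|Q (S (v_ n s))| ^+ 2 by rewrite mulr_ge0 ?powR_ge0 ?sqr_ge0.
rewrite -oppr_le0 in b0; apply: le_trans b0; rewrite le_eqVlt; apply/orP; left; apply/eqP.
by field; rewrite gt_eqF.
Qed.

Lemma cauchy_of_tails (y_ : nat -> R -> H) :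
  (forall T e : R, 0 < e -> exists k, forall n (t : R), 0 <= t <= T ->
    `|y_ n t - P k (y_ n t)| <= e) ->
  (forall k, luc_cauchy (fun n t => P k (y_ n t))) -> luc_cauchy y_.
Proof.
move=> tl low T e e0; have e3 : 0 < e / 3 by rewrite divr_gt0.
have [k Hk] := tl T _ e3; have [n0 H0] := low k T _ e3.
exists n0 => m n m0 n0' t tT.
have -> : y_ m t - y_ n t = (y_ m t - P k (y_ m t)) + (P k (y_ m t) - P k (y_ n t))
    - (y_ n t - P k (y_ n t)).
  by rewrite subrKA opprB subrKA.
apply: (le_trans (ler_normB _ _)).
have h1 := ler_normD (y_ m t - P k (y_ m t)) (P k (y_ m t) - P k (y_ n t)).
have h2 := Hk m t tT; have h3 := Hk n t tT; have h4 := H0 m n m0 n0' t tT.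
by move: h1 h2 h3 h4; lra.
Qed.

Lemma luc_cauchy_lipschitz (L : H -> H) (K : R) (y_ : nat -> R -> H) : 0 <= K ->
  (forall x y, `|L x - L y| <= K * `|x - y|) ->
  luc_cauchy y_ -> luc_cauchy (fun n t => L (y_ n t)).
Proof.
move=> K0 LK h T e e0; have n0 : 0 < 1 + K by rewrite ltr_pwDl.
have [N0 HN] := h T _ (divr_gt0 e0 n0); exists N0 => m n m0 n0' t tT.
apply: le_trans (LK _ _) _; apply: (@le_trans _ _ ((1 + K) * (e / (1 + K)))).
  by apply: ler_pM => //; [rewrite lerDr|exact: HN].
by rewrite mulrC divfK// gt_eqF.
Qed.

Lemma approx_cauchy_u : luc_cauchy u_.
Proof.
apply: (luc_cauchy_derivative hp (v_ := v_)).
- by move=> n t t0; exact: (dw_du (approx_wave n) t0).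
- by have [] := approx_cauchy.
move=> e e0; have [n0 H0] := approx_init u0 e0; exists n0 => m n m0 n0'.
have [-> _ _ _] := approximants m; have [-> _ _ _] := approximants n.
exact: H0.
Qed.

(** Low frequencies converge because [A] is bounded on the range of [P k], and
high frequencies are uniformly small by [approx_tails]. *)
Lemma approx_cauchy_A : luc_cauchy (fun n t => A (u_ n t)).
Proof.
apply: cauchy_of_tails => [T e e0|k].
  by have [k Hk] := approx_tails T e0; exists k => n t tT; have [] := Hk n t tT.
have := luc_cauchy_lipschitz _ _ approx_cauchy_u.
move=> /(_ (fun x => A (P k x)) (k%:R ^+ 2) (sqr_ge0 _)) h.
have {}h := h (fun x y => (linear_distance (trunc_A_linear tr k) (tr_bndA tr k) x y).2).
move=> T e e0; have [n0 H0] := h T e e0; exists n0 => m n m0 n0' t tT.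
have D i : opdom A (u_ i t) := trunc_domA tr (dw_rngu (approx_wave i) t).
by rewrite -!(tr_comA tr)//; exact: H0.
Qed.

Lemma approx_cauchy_Sv : luc_cauchy (fun n t => S (v_ n t)).
Proof.
apply: cauchy_of_tails => [T e e0|k].
  by have [k Hk] := approx_tails T e0; exists k => n t tT; have [] := Hk n t tT.
have [vc _] := approx_cauchy.
have := luc_cauchy_lipschitz _ _ vc.
move=> /(_ (fun x => S (P k x)) k%:R (ler0n _ _)) h.
have {}h := h (fun x y => (linear_distance (trunc_S_linear tr k) (tr_bndS tr k) x y).2).
move=> T e e0; have [n0 H0] := h T e e0; exists n0 => m n m0 n0' t tT.
have D i : opdom S (v_ i t) := trunc_domS tr (dw_rngv (approx_wave i) t).
by rewrite -!(tr_comS tr)//; exact: H0.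
Qed.

Lemma luc_sqr_le (f_ : nat -> R -> H) (f : R -> H) (t k C : R) : luc f_ f -> 0 <= t ->
  0 < k -> (forall n, `|f_ n t| ^+ 2 * k <= C) -> `|f t| ^+ 2 * k <= C.
Proof.
move=> lf t0 k0 fC.
have C0 : 0 <= C / k.
  by rewrite divr_ge0 ?(ltW k0)// (le_trans _ (fC 0%N))// mulr_ge0 ?sqr_ge0 ?(ltW k0).
rewrite -ler_pdivlMr// -[leRHS]sqr_sqrtr// ler_sqr ?nnegrE ?sqrtr_ge0//.
apply: (le_of_luc lf t0); exists 0%N => n _.
by rewrite -[`|f_ n t|]ger0_norm// -sqrtr_sqr ler_wsqrtr// ler_pdivlMr.
Qed.

Lemma luc_sqr_ge (f_ : nat -> R -> H) (f : R -> H) (t k C : R) : luc f_ f -> 0 <= t ->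
  0 < k -> 0 <= C -> (forall n, C <= `|f_ n t| ^+ 2 * k) -> C <= `|f t| ^+ 2 * k.
Proof.
move=> lf t0 k0 C0 fC; have Ck : 0 <= C / k by rewrite divr_ge0 ?(ltW k0).
rewrite -ler_pdivrMr// -[leLHS]sqr_sqrtr// ler_sqr ?nnegrE ?sqrtr_ge0//.
apply/ler_addgt0Pr => e e0; have tt : 0 <= t <= t by rewrite t0 lexx.
have [n0 H0] := lf t e e0; have h := H0 n0 (leqnn _) t tt.
apply: (@le_trans _ _ `|f_ n0 t|).
  by rewrite -[`|f_ n0 t|]ger0_norm// -sqrtr_sqr ler_wsqrtr// ler_pdivrMr.
rewrite -[f_ n0 t](subrK (f t)) addrC; apply: (le_trans (ler_normD _ _)).
by rewrite lerD2l.
Qed.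

Lemma hcont_damping (t : R) : 0 <= t -> hcont ((fun s => (1 + s) `^ (- p)) : R -> R^o) t.
Proof. by move=> t0; apply: hasd_cont (hasd_is_derive (isder_1powR (- p) t0)). Qed.

(** [A] and [S] are closed, and locally uniform limits commute with
differentiation. *)
Lemma approx_limit : exists u v : R -> H,
  [/\ strong_wave A S p eps (fun t => cf (u t)) u v, u 0 = u0, v 0 = u1,
    forall t : R, 0 <= t -> hcont (fun s => A (u s)) t /\ hcont (fun s => S (v s)) t &
    forall t : R, 0 <= t -> decay_bounds g p M C1 C2 t
      (`|S (u t)| ^+ 2) (`|A (u t)| ^+ 2) (`|v t| ^+ 2)].
Proof.
have [vc sc] := approx_cauchy.
have [u Lu] := luc_complete approx_cauchy_u; have [v Lv] := luc_complete vc.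
have [s Ls] := luc_complete sc; have [a La] := luc_complete approx_cauchy_A.
have [w Lw] := luc_complete approx_cauchy_Sv.
have both (x_ y_ : nat -> R -> H) (x y : R -> H) (t e : R) : luc x_ x -> luc y_ y -> 0 <= t -> 0 < e ->
    exists n, `|x_ n t - x t| <= e /\ `|y_ n t - y t| <= e.
  move=> Lx Ly t0 e0; have tt : 0 <= t <= t by rewrite t0 lexx.
  have [n0 H0] := Lx t e e0; have [n1 H1] := Ly t e e0.
  by exists (maxn n0 n1); rewrite H0 ?leq_maxl// H1// leq_maxr.
have dw := approx_wave.
have uA (t : R) : 0 <= t -> opdom A (u t) /\ A (u t) = a t.
  move=> t0; apply: (tr_closedA tr) => e e0; have [n [h1 h2]] := both _ _ _ _ _ _ Lu La t0 e0.
  by exists (u_ n t); split=> //; exact: (trunc_domA tr (dw_rngu (dw n) t)).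
have uS (t : R) : 0 <= t -> opdom S (u t) /\ S (u t) = s t.
  move=> t0; apply: (tr_closedS tr) => e e0; have [n [h1 h2]] := both _ _ _ _ _ _ Lu Ls t0 e0.
  by exists (u_ n t); split=> //; exact: (trunc_domS tr (dw_rngu (dw n) t)).
have vS (t : R) : 0 <= t -> opdom S (v t) /\ S (v t) = w t.
  move=> t0; apply: (tr_closedS tr) => e e0; have [n [h1 h2]] := both _ _ _ _ _ _ Lv Lw t0 e0.
  by exists (v_ n t); split=> //; exact: (trunc_domS tr (dw_rngv (dw n) t)).
have cv_ n (t : R) : 0 <= t -> hcont (v_ n) t.
  by move=> t0; apply: hasd_cont (dw_dv (dw n) t0).
have cSv n (t : R) : 0 <= t -> hcont (fun r => S (v_ n r)) t.
  by move=> t0; apply: hasd_cont (damped_wave_hasdSv tr (dw n) t0).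
have cA n (t : R) : 0 <= t -> hcont (fun r => A (u_ n r)) t.
  by move=> t0; apply: hasd_cont (damped_wave_hasdA tr (dw n) t0).
have ca := luc_cont La cA; have cw := luc_cont Lw cSv; have cv := luc_cont Lv cv_.
have bounds (t : R) : 0 <= t -> decay_bounds g p M C1 C2 t
    (`|S (u t)| ^+ 2) (`|A (u t)| ^+ 2) (`|v t| ^+ 2).
  move=> t0; have [_ ->] := uA t t0; have [_ ->] := uS t t0.
  have h n : decay_bounds g p M C1 C2 t (`|S (u_ n t)| ^+ 2) (`|A (u_ n t)| ^+ 2) (`|v_ n t| ^+ 2).
    by have [_ _ _ /(_ t t0)] := approximants n.
  have w0 (r : R) : 0 < (1 + t) `^ r by rewrite powR_gt0// ltr_pwDl.
  split.
  - rewrite -[leLHS]mulr1; apply: (luc_sqr_le Ls t0 ltr01) => n.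
    by have [] := h n; rewrite mulr1.
  - by apply: (luc_sqr_ge Ls t0 (w0 _) (ltW C10)) => n; have [] := h n.
  - by apply: (luc_sqr_le Ls t0 (w0 _)) => n; have [] := h n.
  - by apply: (luc_sqr_le La t0 (w0 _)) => n; have [] := h n.
  - by apply: (luc_sqr_le Lv t0 (w0 _)) => n; have [] := h n.
have Lcf : luc ((fun n t => cf (u_ n t)) : nat -> R -> R^o) (fun t => cf (u t)).
  pose L := g * M `^ (g - 1) * (2 * (1 + M)).
  have L1 : 0 <= L by rewrite !mulr_ge0 ?powR_ge0 ?(ltW g0)// addr_ge0.
  have L0 : 0 < 1 + L by rewrite ltr_pwDl.
  move=> T e e0; have [n0 H0] := Ls T _ (divr_gt0 e0 L0).
  exists n0 => n nn t tT; have /andP[t0 _] := tT.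
  have [_ h1 _ _] := approx_bounds n tT; have [h2 _ _ _ _] := bounds t t0.
  apply: (le_trans (coefficient_lipschitz g1 h1 h2)); have [_ ->] := uS t t0.
  apply: (@le_trans _ _ ((1 + L) * (e / (1 + L)))).
    apply: ler_pM => //; first by rewrite lerDr.
    exact: H0.
  by rewrite mulrC divfK// gt_eqF.
have Ldv : luc (fun n t => - eps^-1 *: ((1 + t) `^ (- p) *: v_ n t + cf (u_ n t) *: A (u_ n t)))
    (fun t => - eps^-1 *: ((1 + t) `^ (- p) *: v t + cf (u t) *: a t)).
  apply: (luc_map (L := fun x => - eps^-1 *: x) (K := eps^-1)).
    by move=> x y; rewrite -scalerBr normrZ normrN gtr0_norm// invr_gt0.
  have vb := fun T => hcont_bounded T cv; have ab := fun T => hcont_bounded T ca.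
  apply: lucD; apply: lucZ => //.
  - move=> T; exists 1 => // _ t /andP[t0 _]; rewrite ger0_norm ?powR_ge0//.
    by have /andP[p0 _] := p01; rewrite powR_neg_le1 ?oppr_le0// lerDl.
  - exact: luc_cst.
  - move=> T; exists (M `^ g); first exact: powR_ge0.
    by move=> n t tT; rewrite ger0_norm ?powR_ge0//; have /andP[] := approx_cf_ge n tT.
have ccf n (t : R) : 0 <= t -> hcont ((fun r => cf (u_ n r)) : R -> R^o) t.
  by move=> t0; apply: hasd_cont (approx_cf_der n t0).
have cdv n (t : R) : 0 <= t ->
    hcont (fun t => - eps^-1 *: ((1 + t) `^ (- p) *: v_ n t + cf (u_ n t) *: A (u_ n t))) t.
  move=> t0; apply: (hcont_map (L := fun x => - eps^-1 *: x) (K := eps^-1)).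
    by move=> x y; rewrite -scalerBr normrZ normrN gtr0_norm// invr_gt0.
  by apply: hcontD; apply: hcontZ; [exact: hcont_damping|exact: cv_|exact: ccf|exact: cA].
exists u, v; split=> //.
- split=> t t0.
  + by have [] := uA t t0.
  + by have [] := vS t t0.
  + exact: (luc_derivative hp (fun n r r0 => dw_du (dw n) r0) Lu Lv cv_ t0).
  + have [_ ->] := vS t t0.
    have := luc_derivative hp (fun n r r0 => damped_wave_hasdS tr (dw n) r0) Ls Lw cSv t0.
    by apply: hasd_ext => // r r0; have [_ ->] := uS r r0.
  + have [_ ->] := uA t t0.
    exact: (luc_derivative hp (fun n r r0 => dw_dv (dw n) r0) Lv Ldv cdv t0).
- have L0 : luc (fun n (t : R) => u_ n 0) (fun t => u 0).
    move=> T e e0; have [n0 H0] := Lu 0 e e0; exists n0 => n nn t _.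
    by apply: H0; rewrite ?lexx.
  have L1 : luc (fun n (t : R) => u_ n 0) (fun t => u0).
    move=> T e e0; have [n0 H0] := tr_cvg tr u0 e0; exists n0 => n nn t _.
    by have [-> _ _ _] := approximants n; apply: H0; rewrite (leq_trans nn)// leq_addl.
  exact: (luc_unique L0 L1 (lexx 0)).
- have L0 : luc (fun n (t : R) => v_ n 0) (fun t => v 0).
    move=> T e e0; have [n0 H0] := Lv 0 e e0; exists n0 => n nn t _.
    by apply: H0; rewrite ?lexx.
  have L1 : luc (fun n (t : R) => v_ n 0) (fun t => u1).
    move=> T e e0; have [n0 H0] := tr_cvg tr u1 e0; exists n0 => n nn t _.
    by have [_ -> _ _] := approximants n; apply: H0; rewrite (leq_trans nn)// leq_addl.
  exact: (luc_unique L0 L1 (lexx 0)).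
- move=> t t0; split.
    by apply: hcont_ext t0 (ca t t0) => r r0; have [_ ->] := uA r r0.
  by apply: hcont_ext t0 (cw t t0) => r r0; have [_ ->] := vS r r0.
Qed.

End Limit.

(** * Solutions in the sense of one-sided limits *)

Section HalfLineLimits.
Context {R : realType}.

Lemma near_half_line (P : R -> Prop) (t : R) :
  (\forall s \near within `[0, +oo[ (nbhs t), P s) <->
  exists2 d : R, 0 < d & forall s : R, 0 <= s -> `|s - t| < d -> P s.
Proof.
rewrite near_withinE; split.
  move=> /nbhs_ballP[d /= d0 h]; exists d => // s s0 st; apply: h.
    by rewrite /ball/= distrC.
  by rewrite /= in_itv/= s0.
move=> [d d0 h]; apply/nbhs_ballP; exists d => // s; rewrite /ball/= distrC => st.
by rewrite in_itv/= andbT => s0; exact: h.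
Qed.

Lemma near_half_line_punctured (P : R -> Prop) (t : R) :
  (\forall s \near within `[0, +oo[ t^', P s) <->
  exists2 d : R, 0 < d & forall s : R, 0 <= s -> `|s - t| < d -> s != t -> P s.
Proof.
rewrite near_withinE near_withinE; split.
  move=> /nbhs_ballP[d /= d0 h]; exists d => // s s0 st nst; apply: h => //.
    by rewrite /ball/= distrC.
  by rewrite /= in_itv/= s0.
move=> [d d0 h]; apply/nbhs_ballP; exists d => // s; rewrite /ball/= distrC => st nst.
by rewrite in_itv/= andbT => s0; exact: h.
Qed.

Lemma half_line_proper (t : R) : 0 <= t -> ProperFilter (within `[0, +oo[ t^').
Proof.
move=> t0; split; last exact: within_filter.
move=> /near_half_line_punctured[d d0 h].
apply: (h (t + d / 2)); first by rewrite addr_ge0// divr_ge0// ltW.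
  by rewrite addrAC subrr add0r gtr0_norm ?divr_gt0// ltr_pdivrMr// ltr_pMr// ltr1n.
by rewrite -subr_eq0 addrAC subrr add0r gt_eqF// divr_gt0.
Qed.

Lemma half_line_cvg (f : R -> R) (t : R) : (forall s, 0 <= f s) ->
  (f s @[s --> within `[0, +oo[ (nbhs t)] --> (0 : R)) <->
  (forall e : R, 0 < e -> exists2 d : R, 0 < d &
    forall s : R, 0 <= s -> `|s - t| < d -> f s <= e).
Proof.
move=> f0; have E s : `|0 - f s| = f s by rewrite sub0r normrN ger0_norm.
split.
  move=> /cvgrPdist_le h e e0; have /near_half_line[d d0 H] := h e e0.
  by exists d => // s s0 st; rewrite -E; exact: H.
move=> h; apply/cvgrPdist_le => e e0; apply/near_half_line.
by have [d d0 H] := h e e0; exists d => // s s0 st; rewrite E; exact: H.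
Qed.

Lemma half_line_cvg_punctured (f : R -> R) (t : R) : (forall s, 0 <= f s) ->
  (f s @[s --> within `[0, +oo[ t^'] --> (0 : R)) <->
  (forall e : R, 0 < e -> exists2 d : R, 0 < d &
    forall s : R, 0 <= s -> `|s - t| < d -> s != t -> f s <= e).
Proof.
move=> f0; have E s : `|0 - f s| = f s by rewrite sub0r normrN ger0_norm.
split.
  move=> /cvgrPdist_le h e e0; have /near_half_line_punctured[d d0 H] := h e e0.
  by exists d => // s s0 st nst; rewrite -E; exact: H.
move=> h; apply/cvgrPdist_le => e e0; apply/near_half_line_punctured.
by have [d d0 H] := h e e0; exists d => // s s0 st nst; rewrite E; exact: H.
Qed.

Context {H : completeNormedModType R}.
Implicit Types (x y z : H) (u v w : R -> H) (B : operator H).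

Lemma diff_quotient_bound u (t s e : R) z : s != t ->
  (`|diff_quotient u t s - z| <= e) = (`|u s - u t - (s - t) *: z| <= e * `|s - t|).
Proof.
move=> st; have st0 : s - t != 0 by rewrite subr_eq0.
have -> : u s - u t - (s - t) *: z = (s - t) *: (diff_quotient u t s - z).
  by rewrite /diff_quotient scalerBr scalerA divff// scale1r.
by rewrite normrZ [e * _]mulrC ler_pM2l// normr_gt0.
Qed.

Lemma hasdP u (t : R) z : hasd u t z <->
  (forall e : R, 0 < e -> exists2 d : R, 0 < d & forall s : R, 0 <= s -> `|s - t| < d ->
    s != t -> `|diff_quotient u t s - z| <= e).
Proof.
split=> h e e0; have [d d0 Hd] := h e e0; exists d => // s s0 sd.
  by move=> st; rewrite diff_quotient_bound// Hd.
have [->|st] := eqVneq s t; first by rewrite !subrr scale0r subrr !normr0 mulr0.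
by rewrite -diff_quotient_bound// Hd.
Qed.

Lemma hderiv_eq u (t : R) z : 0 <= t -> hasd u t z -> hderiv u t = z.
Proof.
move=> t0 /hasdP h; have F := half_line_proper t0.
apply: cvg_lim; first exact: norm_hausdorff.
apply/cvgrPdist_le => e e0; apply/near_half_line_punctured.
have [d d0 Hd] := h e e0; exists d => // s s0 sd st.
by rewrite distrC; exact: Hd.
Qed.

Lemma C0_norm w : C0_into setT (fun x => `|x|) w <-> forall t : R, 0 <= t -> hcont w t.
Proof.
split=> h t t0.
  by have [_ /half_line_cvg k] := h t t0; apply: k.
by split=> //; apply/half_line_cvg => //; exact: h.
Qed.

Lemma C1_norm u v : (forall t : R, 0 <= t -> hasd u t (v t)) ->
  C1_into setT (fun x => `|x|) u <-> forall t : R, 0 <= t -> hcont v t.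
Proof.
move=> uv; have E t : 0 <= t -> hderiv u t = v t by move=> t0; exact: hderiv_eq (uv t t0).
have E' : C0_into setT (fun x => `|x|) (hderiv u) <-> forall t : R, 0 <= t -> hcont v t.
  rewrite C0_norm; split=> h t t0; apply: hcont_ext t0 (h t t0) => s s0; rewrite E//.
split=> [[_ h]|h]; first exact/E'.
split; last exact/E'.
move=> t t0; split=> //; apply/half_line_cvg_punctured => //.
by rewrite E//; apply/hasdP; exact: uv.
Qed.

Lemma C0_graph B w : linear_operator B ->
  C0_into (opdom B) (graph_norm B) w <->
  forall t : R, 0 <= t -> [/\ opdom B (w t), hcont w t & hcont (fun s => B (w s)) t].
Proof.
move=> Bl; have N0 x : 0 <= graph_norm B x by rewrite addr_ge0.
have D (t s : R) : (forall r : R, 0 <= r -> opdom B (w r)) -> 0 <= t -> 0 <= s ->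
    graph_norm B (w s - w t) = `|w s - w t| + `|B (w s) - B (w t)|.
  by move=> Bw t0 s0; rewrite /graph_norm; have [_ ->] := op_sub Bl (Bw s s0) (Bw t t0).
split=> h t t0.
  have Bw (r : R) : 0 <= r -> opdom B (w r) by move=> /h[].
  have [Bt /half_line_cvg k] := h t t0; split=> //.
    move=> e e0; have [d d0 Hd] := k (fun=> N0 _) e e0; exists d => // s s0 sd.
    by apply: le_trans (Hd s s0 sd); rewrite D// lerDl.
  move=> e e0; have [d d0 Hd] := k (fun=> N0 _) e e0; exists d => // s s0 sd.
  by apply: le_trans (Hd s s0 sd); rewrite D// lerDr.
have Bw (r : R) : 0 <= r -> opdom B (w r) by move=> /h[].
have [Bt c1 c2] := h t t0; split=> //; apply/half_line_cvg => // e e0.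
have e2 : 0 < e / 2 by rewrite divr_gt0.
have [d1 d10 H1] := c1 _ e2; have [d2 d20 H2] := c2 _ e2.
exists (Num.min d1 d2); first by rewrite lt_min d10.
move=> s s0; rewrite lt_min => /andP[s1 s2]; rewrite D//.
by rewrite (splitr e) lerD ?H1 ?H2.
Qed.

Lemma graph_diff_quotient B u (t s : R) z : linear_operator B ->
  opdom B (u s) -> opdom B (u t) -> opdom B z ->
  B (diff_quotient u t s - z) = diff_quotient (fun r => B (u r)) t s - B z.
Proof.
move=> Bl Bs Bt Bz; have [Bd E] := op_sub Bl Bs Bt.
have [B0 h] := Bl; have [Bq q] := h (s - t)^-1 _ 0 Bd B0.
have [_ z0] := op_sub Bl B0 B0; rewrite !subrr in z0.
rewrite z0 !addr0 in Bq q.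
by have [_ ->] := op_sub Bl Bq Bz; rewrite q E.
Qed.

Lemma C1_graph B u v : linear_operator B -> (forall t : R, 0 <= t -> hasd u t (v t)) ->
  C1_into (opdom B) (graph_norm B) u <->
  forall t : R, 0 <= t -> [/\ opdom B (u t), opdom B (v t),
    hasd (fun s => B (u s)) t (B (v t)), hcont v t & hcont (fun s => B (v s)) t].
Proof.
move=> Bl uv; have E t : 0 <= t -> hderiv u t = v t by move=> t0; exact: hderiv_eq (uv t t0).
have N0 x : 0 <= graph_norm B x by rewrite addr_ge0.
have D (t s : R) : (forall r : R, 0 <= r -> opdom B (u r)) -> 0 <= t -> 0 <= s ->
    opdom B (v t) -> graph_norm B (diff_quotient u t s - v t) =
    `|diff_quotient u t s - v t| + `|diff_quotient (fun r => B (u r)) t s - B (v t)|.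
  move=> Bu t0 s0 Bv; rewrite /graph_norm graph_diff_quotient//; exact: Bu.
split.
  move=> [h1 /(C0_graph _ Bl) h2] t t0.
  have Bu (r : R) : 0 <= r -> opdom B (u r) by move=> /h1[].
  have [b1] := h1 t t0; rewrite E// => b2 /half_line_cvg_punctured k.
  have [_ c1 c2] := h2 t t0; split=> //.
  - apply/hasdP => e e0; have [d d0 Hd] := k (fun=> N0 _) e e0; exists d => // s s0 sd st.
    by apply: le_trans (Hd s s0 sd st); rewrite D// lerDr.
  - by apply: hcont_ext t0 c1 => s s0; rewrite E.
  - by apply: hcont_ext t0 c2 => s s0; rewrite E.
move=> h; have Bu (r : R) : 0 <= r -> opdom B (u r) by move=> /h[].
split.
  move=> t t0; have [b1 b2 dB _ _] := h t t0; rewrite E//; split=> //.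
  apply/half_line_cvg_punctured => // e e0; have e2 : 0 < e / 2 by rewrite divr_gt0.
  have /hasdP/(_ _ e2)[d1 d10 H1] := uv t t0; have /hasdP/(_ _ e2)[d2 d20 H2] := dB.
  exists (Num.min d1 d2); first by rewrite lt_min d10.
  move=> s s0; rewrite lt_min => /andP[s1 s2] st; rewrite D//.
  by rewrite (splitr e) lerD ?H1 ?H2.
apply/(C0_graph _ Bl) => t t0; have [_ b2 _ c1 c2] := h t t0; rewrite E//; split=> //.
  by apply: hcont_ext t0 c1 => s s0; rewrite E.
by apply: hcont_ext t0 c2 => s s0; rewrite E.
Qed.

End HalfLineLimits.

(** * Uniqueness and conclusion *)

Section Uniqueness.
Context {R : realType} {H : completeNormedModType R}.
Variable dot : {dot H for (idfun : R -> R)}.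
Hypothesis hp : hilbert_product dot.
Variables (A S : operator H) (P : nat -> H -> H).
Hypothesis tr : truncation dot A S P.
Implicit Types (x y z : H) (u v : R -> H).

(** [wave_difference] with the coefficient of the first wave, which is bounded
away from zero on bounded intervals. *)
Lemma wave_unique (p eps g : R) u v u' v' : 1 <= g -> 0 < eps ->
  strong_wave A S p eps (fun t => (`|S (u t)| ^+ 2) `^ g) u v ->
  strong_wave A S p eps (fun t => (`|S (u' t)| ^+ 2) `^ g) u' v' ->
  (forall t : R, 0 <= t -> hcont (fun s => S (v s)) t) ->
  (forall t : R, 0 <= t -> hcont (fun s => A (u' s)) t) ->
  (forall T : R, 0 <= T -> exists2 k : R, 0 < k &
     forall t : R, 0 <= t <= T -> k <= `|S (u t)| ^+ 2) ->
  u 0 = u' 0 -> v 0 = v' 0 -> forall t : R, 0 <= t -> u' t = u t.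
Proof.
move=> g1 e0 w w' cSv cAu' lowX iu iv T T0; have g0 : 0 < g by apply: lt_le_trans g1.
have [k k0 Hk] := lowX T T0.
have [B1 B10 HB1] := hcont_bounded T (fun t t0 => hasd_cont (sw_dS w t0)).
have [B1' B1'0 HB1'] := hcont_bounded T (fun t t0 => hasd_cont (sw_dS w' t0)).
have [B2 B20 HB2] := hcont_bounded T cSv; have [B3 B30 HB3] := hcont_bounded T cAu'.
pose M := (B1 + B1') ^+ 2.
have XM t : 0 <= t <= T -> `|S (u t)| ^+ 2 <= M.
  move=> tT; rewrite ler_sqr ?nnegrE ?addr_ge0//; apply: (le_trans (HB1 t tT)).
  by rewrite lerDl.
have XM' t : 0 <= t <= T -> `|S (u' t)| ^+ 2 <= M.
  move=> tT; rewrite ler_sqr ?nnegrE ?addr_ge0//; apply: (le_trans (HB1' t tT)).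
  by rewrite lerDr.
have Su0 (t : R) : 0 <= t -> 0 < `|S (u t)|.
  move=> t0; have [r r0 Hr] := lowX t t0.
  have := Hr t; rewrite t0 lexx => /(_ isT) h.
  by rewrite lt0r normr_ge0 andbT -sqrf_eq0 gt_eqF// (lt_le_trans r0).
have cd := coefficient_derivative hp g (sw_dS w) Su0.
pose K1 := g * M `^ (g - 1) * (2 * (B1 * B2)).
pose K2 := g * M `^ (g - 1) * (2 * (1 + M)) * B3.
have K10 : 0 <= K1 by rewrite !mulr_ge0 ?powR_ge0 ?(ltW g0).
have kg0 : 0 < k `^ g by rewrite powR_gt0.
have wd := wave_difference hp tr e0 kg0 K10 w w' cd.
have {}wd := wd K2 T.
have vv t : 0 <= t <= T -> `|v t - v' t| <= 0.
  move=> tT; have := wd _ t tT.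
  rewrite iu iv !subrr normr0 expr0n/= !mulr0 addr0 mulr0 => h.
  have {}h : eps * `|v t - v' t| ^+ 2 + k `^ g * `|S (u t) - S (u' t)| ^+ 2 <= 0.
    apply: h => s sT; have h1 := Hk s sT; have h2 := XM s sT; have h3 := XM' s sT.
    have X0 : 0 < `|S (u s)| ^+ 2 by apply: lt_le_trans h1.
    split; first by rewrite powR_mono ?(ltW g0) ?(ltW k0).
      apply: (le_trans (coefficient_derivative_bound _ g1 _)); first by rewrite X0; exact: h2.
      rewrite ler_wpM2l ?mulr_ge0 ?powR_ge0 ?(ltW g0)// normrM ger0_norm// ler_wpM2l//.
      apply: (le_trans (cauchy_schwarz hp _ _)).
      by apply: ler_pM => //; [exact: HB1|exact: HB2].
    have h := coefficient_lipschitz g1 h2 h3.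
    by rewrite /K2 [leRHS]mulrAC; apply: ler_pM => //; exact: HB3.
  have h2 : 0 <= k `^ g * `|S (u t) - S (u' t)| ^+ 2 by rewrite mulr_ge0 ?sqr_ge0 ?(ltW kg0).
  have {h h2} : eps * `|v t - v' t| ^+ 2 <= 0 by lra.
  by rewrite pmulr_rle0// real_exprn_even_le0//= => /eqP->.
have := mean_value_cst hp (lexx 0) T0 (fun t t0 => hasdB (sw_du w t0) (sw_du w' t0)) vv.
by rewrite mul0r iu subrr subr0 normr_le0 subr_eq0 => /eqP.
Qed.

End Uniqueness.

Section Solutions.
Context {R : realType} {H : completeNormedModType R}.
Variable dot : {dot H for (idfun : R -> R)}.
Hypothesis hp : hilbert_product dot.
Variables (A : operator H) (P : nat -> H -> H).
Let S := power dot A (1 / 2).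
Hypothesis tr : truncation dot A S P.
Variables (p g eps : R) (u0 u1 : H).
Hypothesis eps0 : 0 < eps.
Implicit Types (u v : R -> H).

Let acceleration u v (t : R) : H :=
  - eps^-1 *: ((1 + t) `^ (- p) *: v t + (`|S (u t)| ^+ 2) `^ g *: A (u t)).

Lemma equation_acceleration u v (t : R) z :
  (eps *: z + (1 / (1 + t) `^ p) *: v t + `|S (u t)| `^ (2 * g) *: A (u t) = 0) <->
  z = acceleration u v t.
Proof.
rewrite /acceleration powRN div1r normr_sqr_powR; have en : eps != 0 by rewrite gt_eqF.
split=> [/eqP|->].
  rewrite -addrA addr_eq0 => /eqP E.
  by rewrite scaleNr -scalerN -E scalerA mulVf// scale1r.
by rewrite scaleNr scalerN scalerA divff// scale1r -addrA addNr.
Qed.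

Lemma solution_wave u : global_solution dot A p g eps u0 u1 u ->
  [/\ strong_wave A S p eps (fun t => (`|S (u t)| ^+ 2) `^ g) u (hderiv u),
    u 0 = u0, hderiv u 0 = u1 &
    forall t : R, 0 <= t -> hcont (fun s => A (u s)) t].
Proof.
move=> [[[c1 c2] cS cA] eq i0 i1].
have du (w : R -> H) : C1_into setT (fun x => `|x|) w -> forall t : R, 0 <= t -> hasd w t (hderiv w t).
  move=> [h _] t t0; apply/hasdP; have [_ _ k] := h t t0.
  by move/half_line_cvg_punctured : k; apply.
have hA := (C0_graph _ (tr_linA tr)).1 cA.
have hS := (C1_graph (tr_linS tr) (du _ c1)).1 cS.
split=> //; last by move=> t /hA[].
split=> t t0.
- by have [] := hA t t0.
- by have [] := hS t t0.
- exact: du c1 t t0.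
- by have [] := hS t t0.
- have := du _ c2 t t0; suff -> : hderiv (hderiv u) t = acceleration u (hderiv u) t by [].
  by apply/equation_acceleration; exact: eq.
Qed.

Lemma wave_solution u v : 
  strong_wave A S p eps (fun t => (`|S (u t)| ^+ 2) `^ g) u v ->
  (forall t : R, 0 <= t -> hcont ((fun s => (`|S (u s)| ^+ 2) `^ g) : R -> R^o) t) ->
  (forall t : R, 0 <= t -> hcont (fun s => A (u s)) t /\ hcont (fun s => S (v s)) t) ->
  u 0 = u0 -> v 0 = u1 -> global_solution dot A p g eps u0 u1 u.
Proof.
move=> w cc hc i0 i1.
have du := sw_du w.
have E (t : R) : 0 <= t -> hderiv u t = v t by move=> t0; exact: hderiv_eq (du t t0).
have dv (t : R) : 0 <= t -> hasd (hderiv u) t (acceleration u v t).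
  move=> t0; apply: hasd_ext t0 (sw_dv w t0) => s s0; by rewrite E.
have E2 (t : R) : 0 <= t -> hderiv (hderiv u) t = acceleration u v t.
  by move=> t0; exact: hderiv_eq (dv t t0).
have cv (t : R) : 0 <= t -> hcont v t by move=> t0; apply: hasd_cont (sw_dv w t0).
have ca (t : R) : 0 <= t -> hcont (acceleration u v) t.
  move=> t0; apply: (hcont_map (L := fun x => - eps^-1 *: x) (K := eps^-1)).
    by move=> x y; rewrite -scalerBr normrZ normrN gtr0_norm// invr_gt0.
  have [c1 _] := hc t t0.
  by apply: hcontD; apply: hcontZ; [exact: hcont_damping|exact: cv|exact: cc|exact: c1].
split=> //; last 1 first.
- by rewrite E.
- split; first split.
  + exact/(C1_norm du).
  + exact/(C1_norm dv).
  + apply/(C1_graph (tr_linS tr) du) => t t0; have [_ c2] := hc t t0; split=> //.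
    * exact: (tr_domAS tr (sw_domA w t0)).
    * exact: (sw_domS w t0).
    * exact: (sw_dS w t0).
    * exact: cv.
  + apply/(C0_graph _ (tr_linA tr)) => t t0; have [c1 _] := hc t t0; split=> //.
      exact: (sw_domA w t0).
    exact: hasd_cont (du t t0).
- move=> t t0; rewrite E// E2//; exact/equation_acceleration.
Qed.

End Solutions.

Lemma exponent_conditions (R : realType) (g p : R) : 1 <= g ->
  0 <= p <= (g ^+ 2 + 1) / (g ^+ 2 + 2 * g - 1) ->
  0 <= p <= 1 /\ 2 * p <= (p + 1) / g + (p + 1) / (g + 1) * (g - 1).
Proof.
move=> g1 /andP[p0]; have d0 : 0 < g ^+ 2 + 2 * g - 1 by have := sqr_ge0 g; lra.
rewrite ler_pdivlMr// => h; split.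
  by rewrite p0/= -(ler_pM2r d0) mul1r (le_trans h)//; lra.
have g0 : 0 < g by lra.
have gg : 0 < g * (g + 1) by rewrite mulr_gt0// addr_gt0.
rewrite -(ler_pM2r gg).
have -> : ((p + 1) / g + (p + 1) / (g + 1) * (g - 1)) * (g * (g + 1)) =
    (p + 1) * (g + 1) + (p + 1) * (g - 1) * g.
  by field; rewrite !gt_eqF ?addr_gt0.
by move: h; rewrite !expr2; lra.
Qed.

Lemma velocity_exponent (R : realType) (g p : R) : 0 < g ->
  (2 * g ^+ 2 + (1 - p) * g + p + 1) / (g ^+ 2 + g) =
  (p + 1) / g + 2 * ((p + 1) / (g + 1)) * g - 2 * p.
Proof.
move=> g0; have -> : g ^+ 2 + g = g * (g + 1) by ring.
by field; rewrite !gt_eqF ?addr_gt0.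
Qed.

Theorem theorem2p2 (R : realType) (H : completeNormedModType R)
    (dot : {dot H for (idfun : R -> R)}) (A : operator H)
    (gamma p : R) (u0 u1 : H) :
  hilbert_product dot ->
  linear_operator A -> densely_defined A ->
  selfadjoint dot A -> nonnegative dot A ->
  1 <= gamma ->
  0 <= p <= (gamma ^+ 2 + 1) / (gamma ^+ 2 + 2 * gamma - 1) ->
  opdom A u0 -> opdom (power dot A (1 / 2)) u1 ->
  power dot A (1 / 2) u0 <> 0 ->
  exists eps0 : R, 0 < eps0 /\
    (forall eps, 0 < eps < eps0 ->
       exists u, global_solution dot A p gamma eps u0 u1 u /\
         forall v, global_solution dot A p gamma eps u0 u1 v ->
           forall t, 0 <= t -> v t = u t) /\
    (exists C1 C2 : R, [/\ 0 < C1, 0 < C2 &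
       forall eps, 0 < eps < eps0 ->
       forall u, global_solution dot A p gamma eps u0 u1 u ->
       forall t, 0 <= t ->
         [/\ C1 / (1 + t) `^ ((p + 1) / gamma)
               <= `|power dot A (1 / 2) (u t)| ^+ 2,
             `|power dot A (1 / 2) (u t)| ^+ 2
               <= C2 / (1 + t) `^ ((p + 1) / (gamma + 1)),
             `|A (u t)| ^+ 2 <= C2 / (1 + t) `^ ((p + 1) / gamma) &
             `|hderiv u t| ^+ 2
               <= C2 / (1 + t) `^ ((2 * gamma ^+ 2 + (1 - p) * gamma + p + 1)
                                    / (gamma ^+ 2 + gamma))]]).
Proof.
move=> hp Al Ad Asa Ann g1 pI Du0 Du1 Su0.
have g0 : 0 < gamma by apply: lt_le_trans g1.
have [p01 pg] := exponent_conditions g1 pI.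
have [E [pvm EA ES]] : is_power dot A (1 / 2) (power dot A (1 / 2)).
  by move: Du1; rewrite /power; case: xgetP => [B _ []|_ []].
have tr := spectral_truncation hp pvm Al Ad Asa Ann EA ES.
have [eps0 [M [C1 [C2 [[e0 M1 C10 C20] approx]]]]] :=
  approximants_exist hp tr g1 p01 pg Du0 Du1 Su0.
have key eps : 0 < eps < eps0 -> exists u v : R -> H,
    [/\ global_solution dot A p gamma eps u0 u1 u,
      (forall t : R, 0 <= t -> decay_bounds gamma p M C1 C2 t
        (`|power dot A (1 / 2) (u t)| ^+ 2) (`|A (u t)| ^+ 2) (`|v t| ^+ 2)) &
      forall w, global_solution dot A p gamma eps u0 u1 w ->
        forall t : R, 0 <= t -> w t = u t /\ hderiv w t = v t].
  move=> epsI; have /andP[eps_gt0 _] := epsI.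
  have [N [u_ [v_ ap]]] := approx eps epsI.
  have [u [v [w iu iv cc bd]]] :=
    approx_limit hp tr g1 p01 eps_gt0 M1 C10 C20 Du0 Du1 ap.
  have low T : 0 <= T -> exists2 k : R, 0 < k &
      forall t : R, 0 <= t <= T -> k <= `|power dot A (1 / 2) (u t)| ^+ 2.
    move=> T0; exists (C1 / (1 + T) `^ ((p + 1) / gamma)).
      by rewrite divr_gt0// powR_gt0// ltr_pwDl.
    move=> t tT; have /andP[t0 _] := tT.
    by have [] := decay_bounds_local g1 p01 C10 (sqr_ge0 _) (sqr_ge0 _) (sqr_ge0 _) tT (bd t t0).
  have S0 (t : R) : 0 <= t -> 0 < `|power dot A (1 / 2) (u t)|.
    move=> t0; have [k k0 Hk] := low t t0.
    have := Hk t; rewrite t0 lexx => /(_ isT) h.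
    by rewrite lt0r normr_ge0 andbT -sqrf_eq0 gt_eqF// (lt_le_trans k0).
  have cf (t : R) : 0 <= t ->
      hcont ((fun s => (`|power dot A (1 / 2) (u s)| ^+ 2) `^ gamma) : R -> R^o) t.
    by move=> t0; apply: hasd_cont (coefficient_derivative hp gamma (sw_dS w) S0 t0).
  exists u, v; split=> //.
  - exact: (wave_solution tr eps_gt0 w cf cc iu iv).
  move=> w' sw'; have [ww iu' iv' cA] := solution_wave tr eps_gt0 sw'.
  have uw : forall t : R, 0 <= t -> w' t = u t.
    apply: (wave_unique hp tr g1 eps_gt0 w ww) => //.
    - by move=> t /cc[].
    - by rewrite iu iu'.
    - by rewrite iv iv'.
  move=> t t0; split; first exact: uw.
  apply: (hderiv_eq t0); apply: hasd_ext t0 (sw_du w t0) => s s0.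
  by rewrite uw.
exists eps0; split=> //; split.
  move=> eps /key[u [v [su _ uu]]]; exists u; split=> // w sw t t0.
  by have [] := uu w sw t t0.
exists C1, C2; split=> // eps /key[u [v [_ bd uu]]] w sw t t0.
have [-> ->] := uu w sw t t0; have [_ b2 b3 b4 b5] := bd t t0.
have w0 (r : R) : 0 < (1 + t) `^ r by rewrite powR_gt0// ltr_pwDl.
by split; rewrite ?ler_pdivrMr ?ler_pdivlMr// velocity_exponent.
Qed.
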